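(* Let $K$ be the attractor of the system $\mathcal{S}=\{S_0,S_1,S_2,S_3\}$ corresponding to admissible parameters $p_1,p_2,p_3,B_1,B_2,B_3$. Let $O$ be the fixed point of $S_0$, let $\gamma_1\subset K$ be the arc in $K$ with endpoints $O$ and $A_1$, and let $s=\dim_H(\gamma_1)$. For $x\in K$, let $\ell_{Ox}=H^s(\gamma_{Ox})$ be the $s$-dimensional Hausdorff measure of the arc $\gamma_{Ox}\subset K$ with endpoints $O$ and $x$. Put $$\mathcal{M}=\{\ell_{Ox}: x\in K\cap[0,p_1]\},\qquad \mathcal{N}=\{\ell_{Ox}: x\in K\cap[1-p_2,1]\}.$$ Then $\mathcal{M}$ and $\mathcal{N}$ are components of the attractor of some graph-directed system of contraction similarities in $\mathbb{R}$, and $$\dim_H\mathcal{M}=\dim_H\mathcal{N}\le\dim_H(K'\cap[0,1])<1.$$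
   Context: Identify $\mathbb{R}^2$ with $\mathbb{C}$, so that $[0,1]$, $[0,p_1]$, $[1-p_2,1]$ are segments on the real axis. Let $\Delta$ be the (closed, filled) triangle with vertices $A_1=0$, $A_2=1$, $A_3=e^{i\pi/3}=(1/2,\sqrt3/2)$. For positive numbers $p_1,p_2,p_3$ with $p_1+p_2+p_3<1$ put $S_1(z)=p_1z$, $S_2(z)=p_2z-p_2+1$, $S_3(z)=p_3z-p_3e^{i\pi/3}+e^{i\pi/3}$ (contracting similarities fixing $A_1,A_2,A_3$ respectively), and write $S_{ij}=S_i\circ S_j$. Let $K'$ be the attractor of $\{S_1,S_2,S_3\}$, i.e. the unique nonempty compact set with $K'=S_1(K')\cup S_2(K')\cup S_3(K')$. The parameters $p_1,p_2,p_3,B_1,B_2,B_3$ are called admissible if $p_1,p_2,p_3>0$, $p_1+p_2+p_3<1$, and $B_1,B_2,B_3$ are the vertices of an equilateral triangle with $$B_1\in K'\cap S_{12}([A_2A_3]),\quad B_2\in K'\cap S_{23}([A_1A_3]),\quad B_3\in K'\cap S_{31}([A_1A_2]),$$ where $[A_iA_j]$ denotes the closed side of $\Delta$ joining $A_i$ and $A_j$. For admissible parameters, $S_0$ is the similarity of the plane with $S_0(A_k)=B_k$, $k=1,2,3$. The attractor $K$ of $\mathcal{S}$ is the unique nonempty compact set with $K=\bigcup_{i=0}^3S_i(K)$. It is a dendrite, so any two distinct points of $K$ are joined by a unique arc in $K$. $\dim_H$ denotes Hausdorff dimension and $H^s$ the $s$-dimensional Hausdorff measure. A graph-directed system of contraction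 similarities in $\mathbb{R}$ consists of a finite directed multigraph with vertex set $V$, in which every vertex has at least one outgoing edge, and, for each edge $e$, a contracting similarity $\sigma_e:\mathbb{R}\to\mathbb{R}$; its attractor is the unique family $(X_v)_{v\in V}$ of nonempty compact subsets of $\mathbb{R}$ with $X_v=\bigcup_{e:\,v\to w}\sigma_e(X_w)$ for all $v\in V$ (union over all edges $e$ starting at $v$, with $w$ the end of $e$), and the sets $X_v$ are called its components. *)

(* Defs.v *)
From HB Require Import structures.
From mathcomp Require Import all_boot all_order all_algebra.
From mathcomp Require Import all_classical all_reals all_analysis.

Set Implicit Arguments.
Unset Strict Implicit.
Unset Printing Implicit Defensive.

Import Order.TTheory GRing.Theory Num.Theory.
Import numFieldNormedType.Exports.

Local Open Scope classical_set_scope.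
Local Open Scope ring_scope.

(* The metric is an argument: the library norm on [R * R] is the maximum norm,
   whereas Hausdorff measures in the plane are taken for the Euclidean
   distance. *)

Definition diam (R : realType) (T : Type) (d : T -> T -> R) (U : set T) :
    \bar R :=
  ereal_sup [set (d x y)%:E | x in U & y in U].

(* [diam U ^ s], with value 0 on the empty set also when [s = 0]; for a
   nonempty [U] one has [diam U ^ 0 = 1]. *)
Definition hausdorff_gauge (R : realType) (T : Type) (d : T -> T -> R) (s : R)
    (U : set T) : \bar R :=
  if U == set0 then 0%E else poweR (diam d U) s.

Definition hausdorff_content (R : realType) (T : Type) (d : T -> T -> R)
    (s delta : R) (A : set T) : \bar R :=
  ereal_inf [set (\sum_(0 <= i <oo) hausdorff_gauge d s (U i))%E | U in
    [set U : nat -> set T | A `<=` \bigcup_i U i /\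
                            forall i, (diam d (U i) <= delta%:E)%E]].

(* The content increases as [delta] decreases, so the limit as [delta] tends
   to 0 is a supremum. *)
Definition hausdorff_measure (R : realType) (T : Type) (d : T -> T -> R)
    (s : R) (A : set T) : \bar R :=
  ereal_sup [set hausdorff_content d s delta A | delta in
    [set delta : R | 0 < delta]].

Definition hausdorff_dim (R : realType) (T : Type) (d : T -> T -> R)
    (A : set T) : \bar R :=
  ereal_inf [set s%:E | s in
    [set s : R | 0 <= s /\ hausdorff_measure d s A = 0%E]].

Definition real_dist (R : realType) (x y : R) : R := `|x - y|.

(* The product topology of [R * R] is the topology of [euclidean_dist]. *)
Definition plane (R : realType) : normedModType R := (R * R)%type.

Definition euclidean_dist (R : realType) (x y : plane R) : R :=
  Num.sqrt ((x.1 - y.1) ^+ 2 + (x.2 - y.2) ^+ 2).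

Definition plane_segment (R : realType) (a b : plane R) : set (plane R) :=
  [set (1 - t) *: a + t *: b | t in `[0, 1]].

(* The segment [a, b] of the real axis. *)
Definition axis_segment (R : realType) (a b : R) : set (plane R) :=
  plane_segment ((a, 0) : plane R) ((b, 0) : plane R).

Definition equilateral (R : realType) (a b c : plane R) : Prop :=
  [/\ a <> b, euclidean_dist a b = euclidean_dist b c &
      euclidean_dist b c = euclidean_dist c a].

Definition scales_by (R : realType) (T : Type) (d : T -> T -> R) (r : R)
    (f : T -> T) : Prop :=
  forall x y, d (f x) (f y) = r * d x y.

Definition similarity (R : realType) (T : Type) (d : T -> T -> R)
    (f : T -> T) : Prop :=
  exists2 r : R, 0 < r & scales_by d r f.

Definition contracting_similarity (R : realType) (T : Type)
    (d : T -> T -> R) (f : T -> T) : Prop :=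
  exists2 r : R, 0 < r < 1 & scales_by d r f.

Definition is_attractor (T : topologicalType) (fs : seq (T -> T))
    (K : set T) : Prop :=
  [/\ K !=set0, compact K & K = \big[setU/set0]_(f <- fs) (f @` K)].

(* A continuous injection of the compact interval [0, 1] into the plane is a
   homeomorphism onto its image. *)
Definition is_arc (R : realType) (a b : plane R) (g : set (plane R)) : Prop :=
  exists f : R -> plane R,
    [/\ {within `[0, 1], continuous f}, {in `[0, 1] &, injective f},
        f 0 = a, f 1 = b & g = f @` `[0, 1]].

(* The arc contained in [K] with endpoints [a] and [b], for a uniquely arcwise
   connected [K]; the default value [[set a]] is the degenerate arc for
   [a = b]. *)
Definition arc_in (R : realType) (K : set (plane R)) (a b : plane R) :
    set (plane R) :=
  xget [set a] [set g | is_arc a b g /\ g `<=` K].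

Definition A1 (R : realType) : plane R := (0, 0).
Definition A2 (R : realType) : plane R := (1, 0).
Definition A3 (R : realType) : plane R := (1 / 2, Num.sqrt 3 / 2).

Definition S1 (R : realType) (p : R) (z : plane R) : plane R := p *: z.
Definition S2 (R : realType) (p : R) (z : plane R) : plane R :=
  p *: z - p *: A2 R + A2 R.
Definition S3 (R : realType) (p : R) (z : plane R) : plane R :=
  p *: z - p *: A3 R + A3 R.

(* [K'] stands for the attractor of [S1 p1], [S2 p2], [S3 p3]. *)
Definition admissible (R : realType) (K' : set (plane R)) (p1 p2 p3 : R)
    (B1 B2 B3 : plane R) : Prop :=
  [/\ [/\ 0 < p1, 0 < p2, 0 < p3 & p1 + p2 + p3 < 1],
      equilateral B1 B2 B3,
      (K' `&` (S1 p1 \o S2 p2) @` plane_segment (A2 R) (A3 R)) B1,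
      (K' `&` (S2 p2 \o S3 p3) @` plane_segment (A1 R) (A3 R)) B2 &
      (K' `&` (S3 p3 \o S1 p1) @` plane_segment (A1 R) (A2 R)) B3].

Record gd_system (R : realType) := GDSystem {
  vertex : finType;
  edge : finType;
  source : edge -> vertex;
  target : edge -> vertex;
  edge_map : edge -> R -> R;
  has_out_edge : forall v, exists e, source e = v;
  edge_map_contracting :
    forall e, contracting_similarity (@real_dist R) (edge_map e) }.

Definition is_gd_attractor (R : realType) (G : gd_system R)
    (X : vertex G -> set R) : Prop :=
  forall v, [/\ X v !=set0, compact (X v) &
    X v = \bigcup_(e in [set e : edge G | source e = v])
            (edge_map e @` X (target e))].

Definition arc_length (R : realType) (s : R) (K : set (plane R))
    (a x : plane R) : \bar R :=
  hausdorff_measure (@euclidean_dist R) s (arc_in K a x).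

(* Main.v *)
Require Import Defs.
From mathcomp Require Import all_boot all_order all_algebra.
From mathcomp Require Import finmap.
From mathcomp Require Import all_classical all_reals all_analysis.
From mathcomp Require Import ring lra.
Import Order.TTheory GRing.Theory Num.Theory.
Import numFieldNormedType.Exports.
Local Open Scope classical_set_scope.
Local Open Scope ring_scope.

Set Implicit Arguments.
Unset Strict Implicit.
Unset Printing Implicit Defensive.

(* Write $B_i = S_0(A_i) = S_i(C_i)$ with $C_i \in K'$. In barycentric coordinates
   one sees that $S_1(K), S_2(K), S_3(K)$ are disjoint and that each meets $S_0(K)$
   only in $B_i$, so any two points of $K$ are separated by a third one, which gives
   unique arcs. For $a \in S_i(K)$, $b \in S_j(K)$, $i \ne j$, the arc from $a$ to $b$
   passes through $B_i$, $O$, $B_j$, and so consists of similar copies of the arcs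
   from $S_i^{-1}(a)$ to $C_i$, from $A_i$ to $A_j$ and from $C_j$ to $S_j^{-1}(b)$.

   Every ball centred on the arc $\gamma$ from $A_1$ to $A_2$ contains a copy of
   $\gamma$ of comparable size; as in Falconer's implicit theorems, too many disjoint
   copies would force $\dim_H\gamma > s$, hence $H^s(\gamma) < \infty$. Since
   $s \ge 1$ and $p_1 + p_2 + p_3 < 1$, all arcs between points of $K'$ have bounded
   length, and the length is a Lipschitz function of the endpoints in $K'$.

   With $E = K \cap [0,1] = S_1(E) \cup S_2(E)$ and $\ell(c, E)$ the set of lengths of
   arcs from $c$ to points of $E$, $\mathcal{M}$ is an affine image of $\ell(C_1, E)$
   and $\mathcal{N}$ one of $\mathcal{M} \cup \mathcal{N}$, while $\ell(S_2(c), E)$ is the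
   union of a translate of $\mathcal{M}$ and a similar copy of $\ell(c, E)$, and
   $\ell(c, E)$ is a translate of $\mathcal{M} \cup \mathcal{N}$ for $c \in S_3(K')$. As
   $C_1$ lies on the side $[A_2A_3]$, finitely many steps close this system,
   unless $C_1 = A_2$ is the fixed point of $S_2$, which closes it at once. *)

(** * Hausdorff measures *)

(** The obstacle is the additivity of length. $H^s$ enters as an outer measure built from covers,
    and the additivity at hand is that for sets at positive distance, whereas consecutive subarcs
    touch. Self-similarity repairs this: each junction is reached through tails of arbitrarily small
    length, and cutting off a tail leaves two sets with a gap between them. The bound $s\ge1$ holds
    because the distance to one of its points maps a connected set with two points onto a set
    containing an interval. Several estimates are made on contents at a fixed scale, since an
    inequality $H\le qH+c$ says nothing while $H$ may be infinite; at a coarse scale the content is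
    bounded by the diameter, and self-similarity carries this bound to finer scales. The same
    mechanism gives the dimension claims: some $t<1$ with $p_1^t+p_2^t<1$ makes $H^t(K'\cap[0,1])$
    vanish, and $\mathcal M$ and $\mathcal N$ have the same null exponents because $\mathcal N$
    contains an affine copy of $\mathcal M$ and is otherwise a contracted copy of itself. *)

Section diameter.
Context (R : realType) (T : Type) (d : T -> T -> R).
Hypothesis d_ge0 : forall x y, 0 <= d x y.
Local Notation gauge := (hausdorff_gauge d).
Local Notation HC := (hausdorff_content d).
Local Notation HM := (hausdorff_measure d).
Implicit Types (U V A B : set T) (s t delta c : R).

Lemma diam_ub U x y : U x -> U y -> ((d x y)%:E <= diam d U)%E.
Proof. by move=> Ux Uy; apply: ereal_sup_ubound; exists x => //; exists y. Qed.

Lemma diam_le U c : (forall x y, U x -> U y -> d x y <= c) ->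
  (diam d U <= c%:E)%E.
Proof.
by move=> h; apply: ge_ereal_sup => _ [x Ux [y Uy <-]]; rewrite lee_fin h.
Qed.

Lemma diam_leP U c : (diam d U <= c%:E)%E ->
  forall x y, U x -> U y -> d x y <= c.
Proof.
by move=> h x y Ux Uy; rewrite -lee_fin (le_trans (diam_ub Ux Uy)).
Qed.

Lemma diam_ge0 U : U !=set0 -> (0 <= diam d U)%E.
Proof. by move=> [x Ux]; rewrite (le_trans _ (diam_ub Ux Ux))// lee_fin. Qed.

Lemma diam_sub U V : U `<=` V -> (diam d U <= diam d V)%E.
Proof.
by move=> UV; apply: ge_ereal_sup => _ [x Ux [y Uy <-]]; apply: diam_ub; apply: UV.
Qed.

Lemma hausdorff_gauge0 s : gauge s set0 = 0%E.
Proof. by rewrite /hausdorff_gauge eqxx. Qed.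

Lemma hausdorff_gauge_ge0 s U : (0 <= gauge s U)%E.
Proof. by rewrite /hausdorff_gauge; case: ifPn => // _; apply: poweR_ge0. Qed.

Lemma hausdorff_gauge_le s U c : 0 <= s -> 0 <= c -> (diam d U <= c%:E)%E ->
  (gauge s U <= (c `^ s)%:E)%E.
Proof.
move=> s0 c0 h; rewrite /hausdorff_gauge; case: ifPn => [_|/set0P U0].
  by rewrite lee_fin powR_ge0.
rewrite -poweR_EFin; apply: gt0_ler_poweR => //; rewrite in_itv/= leey andbT.
- exact: diam_ge0.
- by rewrite lee_fin.
Qed.

Lemma hausdorff_gauge_sub s U V : 0 <= s -> U `<=` V ->
  (gauge s U <= gauge s V)%E.
Proof.
move=> s0 UV; rewrite {1}/hausdorff_gauge; case: ifPn => [_|/set0P U0].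
  exact: hausdorff_gauge_ge0.
have V0 : V !=set0 by case: U0 => x /UV; exists x.
rewrite /hausdorff_gauge ifN; last exact/set0P.
by apply: gt0_ler_poweR => //; rewrite ?in_itv/= ?leey ?andbT ?diam_ge0// diam_sub.
Qed.

(** Trades the extended real diameter for a real bound [u]; the empty set takes [u = 0], whose power
    vanishes because [t] is positive. *)
Lemma hausdorff_gauge_radius t delta U : 0 < t -> (diam d U <= delta%:E)%E ->
  exists u, [/\ 0 <= u, forall x y, U x -> U y -> d x y <= u &
    ((u `^ t)%:E <= gauge t U)%E].
Proof.
move=> t0 Ud; have [->|/set0P Un] := eqVneq U set0.
  by exists 0; split => //; rewrite powR0 ?gt_eqF// hausdorff_gauge_ge0.
have := Ud; have := diam_ge0 Un; case e : (diam d U) => [u||]//; rewrite lee_fin => u0 _.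
exists u; split => //; first by move=> x y Ux Uy; rewrite -lee_fin -e diam_ub.
by rewrite /hausdorff_gauge ifN ?e//; apply/set0P.
Qed.

Lemma hausdorff_content_ge0 s delta A : (0 <= HC s delta A)%E.
Proof.
apply: le_ereal_inf_tmp => _ [U _ <-].
by apply: nneseries_ge0 => n _ _; apply: hausdorff_gauge_ge0.
Qed.

Lemma hausdorff_content_le_cover s delta A (U : nat -> set T) :
  A `<=` \bigcup_i U i -> (forall i, (diam d (U i) <= delta%:E)%E) ->
  (HC s delta A <= \sum_(0 <= i <oo) gauge s (U i))%E.
Proof. by move=> AU Ud; apply: ereal_inf_lbound; exists U. Qed.

Lemma hausdorff_content_cover s delta A (c : \bar R) :
  (HC s delta A < c)%E ->
  exists U : nat -> set T, [/\ A `<=` \bigcup_i U i,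
    forall i, (diam d (U i) <= delta%:E)%E &
    (\sum_(0 <= i <oo) gauge s (U i) < c)%E].
Proof. by move=> /ereal_inf_lt[_ [U [AU Ud] <-] h]; exists U. Qed.

Lemma hausdorff_content_sub s delta A B : A `<=` B ->
  (HC s delta A <= HC s delta B)%E.
Proof.
move=> AB; apply: le_ereal_inf_tmp => _ [U [BU Ud] <-].
by apply: hausdorff_content_le_cover => //; apply: subset_trans BU.
Qed.

Lemma hausdorff_content_antitone s delta delta' A : delta <= delta' ->
  (HC s delta' A <= HC s delta A)%E.
Proof.
move=> dd; apply: le_ereal_inf_tmp => _ [U [BU Ud] <-].
by apply: hausdorff_content_le_cover => // i; rewrite (le_trans (Ud i))// lee_fin.
Qed.

Lemma hausdorff_content_le_measure s delta A : 0 < delta ->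
  (HC s delta A <= HM s A)%E.
Proof. by move=> d0; apply: ereal_sup_ubound; exists delta. Qed.

Lemma hausdorff_measure_le s A x :
  (forall delta, 0 < delta -> (HC s delta A <= x)%E) ->
  (HM s A <= x)%E.
Proof. by move=> h; apply: ge_ereal_sup => _ [e /= e0 <-]; apply: h. Qed.

Lemma hausdorff_measure_ge0 s A : (0 <= HM s A)%E.
Proof.
apply: le_trans (hausdorff_content_ge0 s 1 A) _.
exact: hausdorff_content_le_measure.
Qed.

Lemma hausdorff_measure_sub s A B : A `<=` B ->
  (HM s A <= HM s B)%E.
Proof.
move=> AB; apply: hausdorff_measure_le => delta d0.
apply: le_trans (hausdorff_content_sub s delta AB) _.
exact: hausdorff_content_le_measure.
Qed.

Lemma hausdorff_content_le_gauge s delta A : 0 <= delta -> 0 <= s ->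
  (diam d A <= delta%:E)%E ->
  (HC s delta A <= gauge s A)%E.
Proof.
move=> de0 s0 Ad; pose U n := if n is 0%N then A else set0.
apply: (@le_trans _ _ (\sum_(0 <= i <oo) gauge s (U i))%E).
  apply: hausdorff_content_le_cover; first by move=> x Ax; exists 0%N.
  by move=> [|i] //=; apply: diam_le.
rewrite nneseries_recl//; last by move=> k _; apply: hausdorff_gauge_ge0.
rewrite eseries0 ?adde0// => -[|i]//= _ _; exact: hausdorff_gauge0.
Qed.

Lemma hausdorff_content_le_diam s delta A c : 0 <= c <= delta -> 0 <= s ->
  (forall x y, A x -> A y -> d x y <= c) ->
  (HC s delta A <= (c `^ s)%:E)%E.
Proof.
move=> /andP[c0 cd] s0 /diam_le Ac.
apply: le_trans (hausdorff_gauge_le s0 c0 Ac).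
apply: hausdorff_content_le_gauge => //; first exact: le_trans cd.
by rewrite (le_trans Ac)// lee_fin.
Qed.

Lemma hausdorff_content_setU s delta A B :
  (HC s delta (A `|` B) <=
   HC s delta A + HC s delta B)%E.
Proof.
have [->|An] := eqVneq (HC s delta A) +oo%E.
  by rewrite addye ?leey// -ltNye (lt_le_trans _ (hausdorff_content_ge0 _ _ _)).
have [->|Bn] := eqVneq (HC s delta B) +oo%E.
  by rewrite addey ?leey// -ltNye (lt_le_trans _ (hausdorff_content_ge0 _ _ _)).
have fA : HC s delta A \is a fin_num.
  by rewrite ge0_fin_numE ?hausdorff_content_ge0// ltey.
have fB : HC s delta B \is a fin_num.
  by rewrite ge0_fin_numE ?hausdorff_content_ge0// ltey.
apply/lee_addgt0Pr => e e0.
have e20 : 0 < e / 2 by rewrite divr_gt0.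
have /hausdorff_content_cover[U [AU Ud Us]] :
    (HC s delta A < HC s delta A + (e / 2)%:E)%E.
  by rewrite lteDl.
have /hausdorff_content_cover[V [BV Vd Vs]] :
    (HC s delta B < HC s delta B + (e / 2)%:E)%E.
  by rewrite lteDl.
(* Even indices carry the cover of [A] and odd ones that of [B], so a partial sum of length [n.*2]
   groups into [n] pairs. *)
pose W n := if odd n then V n./2 else U n./2.
have g0 := hausdorff_gauge_ge0 s.
apply: (@le_trans _ _ (\sum_(0 <= i <oo) gauge s (W i))%E).
  apply: hausdorff_content_le_cover.
    move=> x [/AU[n _ Ux]|/BV[n _ Vx]].
      by exists n.*2 => //; rewrite /W odd_double doubleK.
    by exists n.*2.+1 => //; rewrite /W /= odd_double/= uphalf_double.
  by move=> i; rewrite /W; case: ifP.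
have -> : (HC s delta A + HC s delta B + e%:E =
    (HC s delta A + (e / 2)%:E) +
    (HC s delta B + (e / 2)%:E))%E.
  by rewrite addeACA -EFinD -splitr.
apply: (@le_trans _ _ (\sum_(0 <= i <oo)
    (gauge s (U i) + gauge s (V i)))%E); last first.
  by rewrite nneseriesD//; apply: leeD; apply: ltW.
have WE n : (\sum_(0 <= i < n.*2) gauge s (W i))%E =
    (\sum_(0 <= i < n) (gauge s (U i) + gauge s (V i)))%E.
  elim: n => [|n IH]; first by rewrite !big_geq.
  rewrite doubleS !big_nat_recr//= IH /W /= odd_double/= uphalf_double doubleK.
  by rewrite addeA.
apply: lime_le; first by apply: is_cvg_nneseries => *; apply: g0.
near=> n.
apply: (@le_trans _ _ (\sum_(0 <= i < n.*2) gauge s (W i))%E).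
  rewrite -addnn [leRHS](@big_cat_nat _ _ _ n) ?leq_addr//=.
  by apply: leeDl; apply: sume_ge0.
apply: le_trans (nneseries_lim_ge n _); last by move=> *; apply: adde_ge0.
rewrite WE; exact: lexx.
Unshelve. all: by end_near.
Qed.

Lemma hausdorff_measure_setU s A B :
  (HM s (A `|` B) <=
   HM s A + HM s B)%E.
Proof.
apply: hausdorff_measure_le => delta d0.
apply: le_trans (hausdorff_content_setU _ _ _ _) _.
by apply: leeD; apply: hausdorff_content_le_measure.
Qed.

Lemma hausdorff_measure_set1 s a : d a a = 0 -> 0 < s ->
  HM s [set a] = 0%E.
Proof.
move=> daa s0; apply/eqP; rewrite eq_le hausdorff_measure_ge0 andbT.
apply: hausdorff_measure_le => e e0.
have /(_ 0) := @hausdorff_content_le_diam s e [set a].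
rewrite powR0 ?gt_eqF//; apply; rewrite ?lexx ?ltW//.
by move=> x y -> ->; rewrite daa.
Qed.

(** At exponent 0 a cover set that meets [A] has gauge 1, so a single point already forces the
    measure up to 1. *)
Lemma hausdorff_measure0_eq0 A : HM 0 A = 0%E -> A = set0.
Proof.
move=> h; apply: contrapT => /eqP/set0P[x Ax].
have : (HC 0 1 A < 1%E)%E.
  by apply: le_lt_trans (hausdorff_content_le_measure _ _ _) _; rewrite ?h ?lte01.
move=> /hausdorff_content_cover[U [AU _ +]]; apply/negP; rewrite -leNgt.
have [n _ Unx] := AU _ Ax.
apply: le_trans (nneseries_lim_ge n.+1 _); last by move=> *; apply: hausdorff_gauge_ge0.
rewrite big_nat_recr//= -[leLHS]add0e leeD ?sume_ge0//.
  by move=> i _; apply: hausdorff_gauge_ge0.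
rewrite /hausdorff_gauge ifN ?poweRe0//.
by apply/set0P; exists x.
Qed.

Lemma hausdorff_measure_eq0_le s t A : 0 <= s <= t ->
  HM s A = 0%E -> HM t A = 0%E.
Proof.
move=> /andP[s0 st] h; apply/eqP; rewrite eq_le hausdorff_measure_ge0 andbT.
apply: hausdorff_measure_le => e e0.
(* Restricting to diameters at most 1 makes the gauge decrease when the exponent grows. *)
apply: (@le_trans _ _ (HC s (Num.min e 1) A)); last first.
  by rewrite -h; apply: hausdorff_content_le_measure; rewrite lt_min e0/=.
apply: le_ereal_inf_tmp => _ [U [AU Ud] <-].
apply: (@le_trans _ _ (\sum_(0 <= i <oo) gauge t (U i))%E).
  apply: hausdorff_content_le_cover => // i.
  by rewrite (le_trans (Ud i))// lee_fin ge_min lexx.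
apply: lee_nneseries => [i _ _|i _]; first exact: hausdorff_gauge_ge0.
rewrite /hausdorff_gauge; case: ifPn => // /set0P U0.
have := Ud i; have := diam_ge0 U0.
case: (diam d (U i)) => [r||]//; rewrite !lee_fin => r0 r1.
have {}r1 : r <= 1 by rewrite (le_trans r1)// ge_min lexx orbT.
have [->|rn] := eqVneq r 0.
  have [t0|tn] := eqVneq t 0; last by rewrite (powR0 tn) powR_ge0.
  by have -> : s = t by apply/eqP; rewrite eq_le st t0.
by apply: ger_powR => //; rewrite lt_neqAle eq_sym rn r0.
Qed.

(** A cover set of diameter below [eta] cannot meet both [A] and [B], so a fine cover of the union
    splits into covers of the two parts. *)
Lemma hausdorff_measure_separated s A B (eta : R) : 0 < eta -> 0 <= s ->
  (forall x y, A x -> B y -> eta <= d x y) ->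
  (HM s A + HM s B <=
   HM s (A `|` B))%E.
Proof.
move=> eta0 s0 sep.
have key delta : 0 < delta < eta ->
    (HC s delta A + HC s delta B <=
     HC s delta (A `|` B))%E.
  move=> /andP[d0 de]; apply: le_ereal_inf_tmp => _ [U [ABU Ud] <-].
  apply: (@le_trans _ _ ((\sum_(0 <= i <oo) gauge s (U i `&` A)) +
      \sum_(0 <= i <oo) gauge s (U i `&` B))%E).
    apply: leeD; apply: hausdorff_content_le_cover.
    - by move=> x Ax; have [n _ Ux] := ABU x (or_introl Ax); exists n.
    - by move=> i; rewrite (le_trans _ (Ud i))// diam_sub// => ? [].
    - by move=> x Ax; have [n _ Ux] := ABU x (or_intror Ax); exists n.
    - by move=> i; rewrite (le_trans _ (Ud i))// diam_sub// => ? [].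
  rewrite -nneseriesD//; last 2 first.
    by move=> *; exact: hausdorff_gauge_ge0.
    by move=> *; exact: hausdorff_gauge_ge0.
  apply: lee_nneseries => [i _ _|i _].
    by apply: adde_ge0; exact: hausdorff_gauge_ge0.
  have [->|/set0P[x [Ux Ax]]] := eqVneq (U i `&` A) set0.
    by rewrite hausdorff_gauge0 add0e; apply: hausdorff_gauge_sub => // ? [].
  have [->|/set0P[y [Uy By]]] := eqVneq (U i `&` B) set0.
    by rewrite hausdorff_gauge0 adde0; apply: hausdorff_gauge_sub => // ? [].
  by exfalso; have := diam_leP (Ud i) Ux Uy; have := sep x y Ax By; lra.
have nby C : (HM s C != -oo)%E.
  by rewrite -ltNye (lt_le_trans _ (hausdorff_measure_ge0 s C)).
have [e|n] := eqVneq (HM s (A `|` B)) +oo%E.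
  by rewrite e leey.
have fAB : HM s (A `|` B) \is a fin_num.
  by rewrite ge0_fin_numE ?hausdorff_measure_ge0// ltey.
(* The two suprema are taken one after the other, which requires independent mesh sizes for [A] and
   [B]. *)
have le1 delta delta' : 0 < delta -> 0 < delta' ->
  (HC s delta A + HC s delta' B <=
     HM s (A `|` B))%E.
  move=> d0 d'0; pose m := Num.min (eta / 2) (Num.min delta delta').
  have m0 : 0 < m by rewrite !lt_min d0 d'0 divr_gt0.
  apply: le_trans (hausdorff_content_le_measure s _ m0).
  apply: le_trans (key m _).
    by apply: leeD; apply: hausdorff_content_antitone; rewrite !ge_min lexx ?orbT.
  by rewrite m0 gt_min; apply/orP; left; rewrite ltr_pdivrMr// ltr_pMr// ltr1n.
have le2 delta : 0 < delta ->
  (HM s A + HC s delta B <=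
     HM s (A `|` B))%E.
  move=> d0.
  have fB : HC s delta B \is a fin_num.
    rewrite ge0_fin_numE ?hausdorff_content_ge0//.
    apply: (@le_lt_trans _ _ (HM s (A `|` B))); last by rewrite ltey.
    apply: le_trans (le1 delta delta d0 d0).
    by rewrite -[leLHS]add0e leeD// hausdorff_content_ge0.
  rewrite -leeBrDr//; apply: hausdorff_measure_le => e e0.
  by rewrite leeBrDr// le1.
have fA : HM s A \is a fin_num.
  rewrite ge0_fin_numE ?hausdorff_measure_ge0//.
  apply: (@le_lt_trans _ _ (HM s (A `|` B))); last by rewrite ltey.
  by apply: hausdorff_measure_sub => ? ?; left.
rewrite -leeBrDl//; apply: hausdorff_measure_le => e e0.
by rewrite leeBrDl// le2.
Qed.

End diameter.

Section lipschitz_image.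
Context (R : realType) (T T' : Type) (d : T -> T -> R) (d' : T' -> T' -> R).
Hypothesis d_ge0 : forall x y, 0 <= d x y.
Hypothesis d'_ge0 : forall x y, 0 <= d' x y.

Lemma hausdorff_content_image s (f : T -> T') (A : set T) L delta : 0 <= s -> 0 < L ->
  (forall x y, A x -> A y -> d' (f x) (f y) <= L * d x y) ->
  (hausdorff_content d' s (L * delta) (f @` A) <=
   (L `^ s)%:E * hausdorff_content d s delta A)%E.
Proof.
move=> s0 L0 fL.
have Ls0 : 0 < L `^ s by rewrite powR_gt0.
rewrite -lee_pdivrMl//; apply: le_ereal_inf_tmp => _ [U [AU Ud] <-].
rewrite lee_pdivrMl// -nneseriesZl; last by move=> *; exact: hausdorff_gauge_ge0.
(* The cover sets are cut down to [A], as [f] is Lipschitz there only. *)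
apply: (@le_trans _ _
    (\sum_(0 <= i <oo) hausdorff_gauge d' s (f @` (U i `&` A)))%E).
  apply: hausdorff_content_le_cover => [_ [x Ax <-]|i].
    by have [n _ Ux] := AU x Ax; exists n => //; exists x.
  apply: diam_le => _ _ [x [Ux Ax] <-] [y [Uy Ay] <-].
  by rewrite (le_trans (fL _ _ Ax Ay))// ler_pM2l// (diam_leP (Ud i)).
apply: lee_nneseries => [i _ _|i _]; first exact: hausdorff_gauge_ge0.
have [->|/set0P[_ [x [Ux Ax] _]]] := eqVneq (f @` (U i `&` A)) set0.
  by rewrite hausdorff_gauge0 mule_ge0 ?lee_fin ?powR_ge0 ?hausdorff_gauge_ge0.
rewrite /hausdorff_gauge !ifN; last 2 first.
- by apply/set0P; exists x.
- by apply/set0P; exists (f x); exists x.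
have := Ud i; have : (0 <= diam d (U i))%E by apply: diam_ge0 => //; exists x.
have le := @diam_ub _ _ d (U i).
move: le; case: (diam d (U i)) => [r||]// le; rewrite !lee_fin => r0 _.
rewrite -poweR_EFin -poweRM ?lee_fin//; last exact: ltW.
rewrite -EFinM.
apply: gt0_ler_poweR => //; rewrite ?in_itv/= ?leey ?andbT.
- by apply: diam_ge0 => //; exists (f x); exists x.
- by rewrite lee_fin mulr_ge0// ltW.
- apply: diam_le => _ _ [u [Uu Au] <-] [v [Uv Av] <-].
  by rewrite (le_trans (fL _ _ Au Av))// ler_pM2l// -lee_fin le.
Qed.

Lemma hausdorff_measure_image s (f : T -> T') (A : set T) L : 0 <= s -> 0 < L ->
  (forall x y, A x -> A y -> d' (f x) (f y) <= L * d x y) ->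
  (hausdorff_measure d' s (f @` A) <= (L `^ s)%:E * hausdorff_measure d s A)%E.
Proof.
move=> s0 L0 fL; apply: hausdorff_measure_le => e e0.
rewrite -(divfK (lt0r_neq0 L0) e) mulrC.
apply: le_trans (hausdorff_content_image (e / L) s0 L0 fL) _.
apply: lee_wpmul2l; first by rewrite lee_fin powR_ge0.
by apply: hausdorff_content_le_measure; rewrite divr_gt0.
Qed.

End lipschitz_image.

(** * Estimates on real powers *)

Section real_powers.
Context (R : realType).
Implicit Types (q b c t u e : R).

Lemma expr_lt_eventually q b : 0 <= q < 1 -> 0 < b ->
  exists N, forall n, (N <= n)%N -> q ^+ n < b.
Proof.
move=> /andP[q0 q1] b0.
have /cvgrPdist_lt/(_ b b0)[N _ hN] : GRing.exp q x @[x --> \oo] --> (0 : R).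
  by apply: cvg_expr; rewrite ger0_norm.
exists N => n Nn; have := hN n Nn.
by rewrite /= sub0r normrN ger0_norm// exprn_ge0.
Qed.

(** Some power [q ^+ N.+1] falls below [b]; taking the root of order [N.+1] of both sides gives the
    exponent. *)
Lemma powR_close_to1 b q : 0 < b <= 1 -> 0 <= q < 1 ->
  exists2 h : R, 0 < h <= 1 & q < b `^ h.
Proof.
move=> /andP[b0 b1] q01; have [N hN] := expr_lt_eventually q01 b0.
have h0 : (0 : R) < N.+1%:R^-1 by rewrite invr_gt0.
exists N.+1%:R^-1; first by rewrite h0 invf_le1 ?ler1n.
rewrite ltNge; apply/negP => /(lerXn2r N.+1) h.
have := hN N.+1 (leqnSn N); rewrite ltNge => /negP; apply.
apply: le_trans (h _ _); rewrite ?nnegrE ?powR_ge0//; last by case/andP: q01.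
rewrite -powR_mulrn ?powR_ge0// -powRrM mulVf ?powRr1// ?ltW//.
Qed.

(** Allows the sets of a cover to be fattened to open sets at small cost; [2 * h] is the growth of
    the diameter of an [h]-neighbourhood. *)
Lemma powR_enlarge t u e : 0 < t -> 0 <= u -> 0 < e ->
  exists2 h : R, 0 < h & (u + 2 * h) `^ t <= u `^ t + e.
Proof.
move=> t0 u0 e0; pose v := (u `^ t + e) `^ t^-1.
have tV0 : 0 < t^-1 by rewrite invr_gt0.
have uE : u = (u `^ t) `^ t^-1 by rewrite -powRrM mulfV ?gt_eqF// powRr1.
have uv : u < v.
  rewrite {1}uE; apply: gt0_ltr_powR; rewrite ?nnegrE ?powR_ge0//.
    by rewrite addr_ge0 ?powR_ge0 ?ltW.
  by rewrite ltrDl.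
exists ((v - u) / 2); first by rewrite divr_gt0 ?subr_gt0.
have -> : u + 2 * ((v - u) / 2) = v by field.
by rewrite /v -powRrM mulVf ?gt_eqF// powRr1// addr_ge0 ?powR_ge0 ?ltW.
Qed.

(** Lowering the exponent from 1 to [1 - h / 2] multiplies each term by at most $m^{-h/2}$, where
    [m] is the smaller ratio, and [h] is such that $p_1+p_2<m^h\le m^{h/2}$. Halving [h] keeps the
    exponent positive when [h = 1]. *)
Lemma powR_small_sum (p1 p2 : R) : 0 < p1 -> 0 < p2 -> p1 + p2 < 1 ->
  exists2 t : R, 0 < t < 1 & p1 `^ t + p2 `^ t < 1.
Proof.
move=> p10 p20 ps; pose m := Num.min p1 p2.
have m01 : 0 < m <= 1.
  by rewrite lt_min p10 p20/= ge_min; apply/orP; left; lra.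
have q01 : 0 <= p1 + p2 < 1 by lra.
have [h /andP[h0 h1] qm] := powR_close_to1 m01 q01.
have m0 : 0 < m by case/andP: m01.
have key (p : R) : 0 < p -> m <= p -> p `^ (1 - h / 2) <= p * m `^ (- (h / 2)).
  move=> p0 mp; rewrite powRD ?(gt_eqF p0) ?implybT// powRr1 ?(ltW p0)// ler_pM2l//.
  rewrite !powRN lef_pV2 ?posrE ?powR_gt0//.
  by apply: ge0_ler_powR => //; rewrite ?nnegrE ltW// divr_gt0.
have h20 : 0 < h / 2 by rewrite divr_gt0.
exists (1 - h / 2); first lra.
apply: (@le_lt_trans _ _ ((p1 + p2) * m `^ (- (h / 2)))).
  by rewrite mulrDl lerD// key// ge_min lexx ?orbT.
have qm2 : p1 + p2 < m `^ (h / 2).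
  apply: (lt_le_trans qm); have /andP[_ m1] := m01.
  by apply: ger_powR; rewrite ?m0//; lra.
rewrite powRN; rewrite ltr_pdivrMr ?powR_gt0// mul1r//.
Qed.

End real_powers.

Section vanishing.
Context (R : realType) (T : Type) (d : T -> T -> R).
Hypothesis d_ge0 : forall x y, 0 <= d x y.

(** Iterating the hypothesis from a scale above the diameter, where one set covers [A], gives
    geometric decay at every scale. For the measure itself, $H\le qH$ would leave the value
    $+\infty$ open. *)
Lemma hausdorff_measure_contract (s q rho D : R) (A : set T) : 0 <= s ->
  0 <= q < 1 -> 0 < rho < 1 -> 0 < D -> (forall x y, A x -> A y -> d x y <= D) ->
  (forall delta : R, 0 < delta ->
     (hausdorff_content d s delta A <= q%:E * hausdorff_content d s (delta / rho) A)%E) ->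
  hausdorff_measure d s A = 0%E.
Proof.
move=> s0 q01 /andP[r0 r1] D0 AD hq.
have q0 : 0 <= q by case/andP: q01.
have claim n : forall delta, D * rho ^+ n <= delta ->
    (hausdorff_content d s delta A <= (q ^+ n * D `^ s)%:E)%E.
  elim: n => [|n IH] delta hd.
    rewrite expr0 mul1r; apply: hausdorff_content_le_diam => //.
    by rewrite ltW//= -[leLHS]mulr1.
  have d0 : 0 < delta by apply: lt_le_trans hd; rewrite mulr_gt0 ?exprn_gt0.
  apply: le_trans (hq _ d0) _; rewrite exprS -mulrA EFinM.
  apply: lee_wpmul2l; first by rewrite lee_fin.
  by apply: IH; rewrite ler_pdivlMr// -mulrA -exprSr.
apply/eqP; rewrite eq_le hausdorff_measure_ge0// andbT.
apply: hausdorff_measure_le => delta d0.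
apply/lee_addgt0Pr => e e0; rewrite add0e.
have [N1 hN1] : exists N, forall n, (N <= n)%N -> rho ^+ n < delta / D.
  by apply: expr_lt_eventually; rewrite ?divr_gt0// (ltW r0) r1.
have Ds : 0 < D `^ s by rewrite powR_gt0.
have [N2 hN2] : exists N, forall n, (N <= n)%N -> q ^+ n < e / D `^ s.
  by apply: expr_lt_eventually => //; rewrite divr_gt0.
pose n := maxn N1 N2.
apply: le_trans (claim n _ _) _.
  by rewrite mulrC -ler_pdivlMr// ltW// hN1// leq_maxl.
by rewrite lee_fin -ler_pdivlMr// ltW// hN2// leq_maxr.
Qed.

End vanishing.

(** * Lower bounds from separated copies *)

Section separated_copies.
Context (R : realType) (T : Type) (d : T -> T -> R) (F : set T) (n : nat)
  (g : 'I_n -> T -> T) (rho : 'I_n -> R) (delta t : R).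
Hypothesis F0 : F !=set0.
Hypothesis rho_gt0 : forall i, 0 < rho i.
Hypothesis g_expand : forall i x y, F x -> F y -> rho i * d x y <= d (g i x) (g i y).
Hypothesis gF : forall i x, F x -> F (g i x).
Hypothesis g_sep : forall i j x y, i != j -> F x -> F y -> delta <= d (g i x) (g j y).
Hypothesis t_gt0 : 0 < t.
Hypothesis delta_gt0 : 0 < delta.
Hypothesis n_gt1 : (1 < n)%N.
Hypothesis rho_sum : 1 <= \sum_i rho i `^ t.

(* Unless some member of the cover is as large as the gap [delta], the members
   meeting different copies of [F] are different; pulling them back by the
   copying maps gives covers of [F] with fewer members. *)
Lemma finite_cover_sum_lower (I : finType) (J : {set I}) (U : I -> set T) (u : I -> R) :
  (forall j, 0 <= u j) -> (forall j x y, U j x -> U j y -> d x y <= u j) ->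
  (forall x, F x -> exists2 j, j \in J & U j x) ->
  delta `^ t <= \sum_(j in J) u j `^ t.
Proof.
move: {2}(#|J|) (leqnn #|J|) => k; elim: k => [|k IH] in J U u *.
  rewrite leqn0 cards_eq0 => /eqP -> _ _ cov.
  by have [x /cov[j]] := F0; rewrite inE.
move=> Jk u0 uU cov.
have [[j [jJ uj]]|small] := pselect (exists j, j \in J /\ delta <= u j).
  rewrite (bigD1 j)//=; apply: (@le_trans _ _ (u j `^ t)).
    by apply: ge0_ler_powR => //; rewrite ?nnegrE// ltW.
  by rewrite lerDl sumr_ge0// => i _; apply: powR_ge0.
have {}small j : j \in J -> u j < delta.
  by move=> jJ; rewrite ltNge; apply/negP => h; apply: small; exists j.
pose Jc i := [set j in J | `[< exists2 x, F x & U j (g i x) >]].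
have Jdisj i i' j : j \in Jc i -> j \in Jc i' -> i = i'.
  rewrite !inE => /andP[jJ /asboolP[x Fx Ux]] /andP[_ /asboolP[y Fy Uy]].
  apply/eqP/negPn/negP => ii'.
  have := small j jJ; rewrite ltNge => /negP; apply.
  exact: le_trans (g_sep ii' Fx Fy) (uU _ _ _ Ux Uy).
have JcJ i j : j \in Jc i -> j \in J by rewrite inE => /andP[].
have Jn0 i : exists j, j \in Jc i.
  have [x Fx] := F0; have [j jJ Uj] := cov _ (gF i Fx).
  by exists j; rewrite inE jJ; apply/asboolP; exists x.
have Jlt i : (#|Jc i| <= k)%N.
  rewrite -ltnS; apply: leq_trans Jk; apply: proper_card; apply/properP; split.
    by apply/fintype.subsetP => j; apply: JcJ.
  (* A second copy exists because [1 < n]; a cover set meeting it misses copy [i], so the cover of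
     copy [i] is strictly smaller. *)
  pose i' : 'I_n := if i == Ordinal n_gt1 then Ordinal (ltnW n_gt1) else Ordinal n_gt1.
  have ii' : i != i'.
    rewrite /i'; case: ifPn => // /eqP ->.
    by apply/eqP => /(congr1 val).
  have [j jc'] := Jn0 i'; exists j; first exact: JcJ jc'.
  by apply/negP => /Jdisj/(_ jc') e; rewrite e eqxx in ii'.
have part i : rho i `^ t * delta `^ t <= \sum_(j in Jc i) u j `^ t.
  have := IH (Jc i) (fun j => [set x | F x /\ U j (g i x)]) (fun j => u j / rho i) (Jlt i).
  move=> /(_ _ _ _)h.
  have {h} : delta `^ t <= \sum_(j in Jc i) (u j / rho i) `^ t.
    apply: h.
    - by move=> j; rewrite divr_ge0// ltW.
    - move=> j x y [Fx Ux] [Fy Uy]; rewrite ler_pdivlMr// mulrC.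
      exact: le_trans (g_expand _ Fx Fy) (uU _ _ _ Ux Uy).
    - move=> x Fx; have [j jJ Uj] := cov _ (gF i Fx).
      by exists j => //; rewrite inE jJ; apply/asboolP; exists x.
  rewrite -(ler_pM2l (_ : 0 < rho i `^ t)) ?powR_gt0// => /le_trans; apply.
  rewrite mulr_sumr ler_sum// => j _.
  have rj := rho_gt0 i; have r0 := ltW rj.
  by rewrite -powRM ?divr_ge0// mulrC divfK// gt_eqF.
apply: (@le_trans _ _ (\sum_i \sum_(j in Jc i) u j `^ t)).
  apply: (@le_trans _ _ (\sum_i rho i `^ t * delta `^ t)); last exact: ler_sum.
  by rewrite -mulr_suml ler_peMl// powR_ge0.
rewrite (exchange_big_dep (mem J))/=; last by move=> i j _; apply: JcJ.
apply: ler_sum => j jJ.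
have [[i ji]|no] := pselect (exists i, j \in Jc i).
  rewrite (bigD1 i)//= big1 ?addr0// => i' /andP[ji' /eqP ii'].
  by case: ii'; apply: Jdisj ji' ji.
by rewrite big_pred0 ?powR_ge0// => i; apply/negP => ji; apply: no; exists i.
Qed.

End separated_copies.

Section lower_bounds.
Context (R : realType).

(** Compactness turns a countable cover of small sum, once fattened, into a finite one, to which
    [finite_cover_sum_lower] applies. *)
Lemma hausdorff_measure_separated_copies (T : ptopologicalType) (d : T -> T -> R)
    (F : set T) n (g : 'I_n -> T -> T) (rho : 'I_n -> R) (delta t : R) :
  (forall x y, 0 <= d x y) -> (forall x, d x x = 0) ->
  (forall x y, d x y = d y x) -> (forall x y z, d x z <= d x y + d y z) ->
  (forall U h, open [set y | exists2 x, U x & d x y < h]) ->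
  compact F -> F !=set0 -> (forall i, 0 < rho i) ->
  (forall i x y, F x -> F y -> rho i * d x y <= d (g i x) (g i y)) ->
  (forall i x, F x -> F (g i x)) ->
  (forall i j x y, i != j -> F x -> F y -> delta <= d (g i x) (g j y)) ->
  0 < t -> 0 < delta -> (1 < n)%N -> 1 <= \sum_i rho i `^ t ->
  hausdorff_measure d t F <> 0%E.
Proof.
move=> d0 dxx dC dtri dopen cF F0 rho0 gexp gF gsep t0 de0 n1 rs H.
(* A quarter of the lower bound: the cover costs less than [e] and the fattening at most another
   [e], which leaves a margin. *)
pose e := delta `^ t / 4.
have e0 : 0 < e by rewrite divr_gt0// powR_gt0.
have : (hausdorff_content d t 1 F < e%:E)%E.
  by apply: le_lt_trans (hausdorff_content_le_measure _ _ _ _) _; rewrite ?H ?lte_fin.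
move=> /hausdorff_content_cover[U [FU Ud Us]].
have /choice[u /all_and3[u0 udx gE]] := fun i => hausdorff_gauge_radius d0 t0 (Ud i).
have /choice[h hP] : forall i : nat, exists h : R,
    0 < h /\ (u i + 2 * h) `^ t <= u i `^ t + e / (2 ^ i.+1)%:R.
  move=> i; have ei : 0 < e / (2 ^ i.+1)%:R by rewrite divr_gt0// ltr0n expn_gt0.
  by have [h] := powR_enlarge t0 (u0 i) ei; exists h.
pose V i := [set y | exists2 x, U i x & d x y < h i].
have := cF; rewrite compact_cover => /(_ _ [set: nat] V)[].
- by move=> i _; apply: dopen.
- move=> x Fx; have [i _ Ux] := FU _ Fx; exists i => //.
  by exists x => //; rewrite dxx; case: (hP i).
move=> D _ FD.
pose m := (\max_(i <- enum_fset D) i).+1.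
have Dm i : i \in D -> (i < m)%N.
  by move=> iD; rewrite ltnS; apply: (@leq_bigmax_seq _ _ xpredT id).
have := @finite_cover_sum_lower R T d F n g rho delta t F0 rho0 gexp gF gsep t0 de0 n1 rs
  'I_m [set: 'I_m]%SET (fun i => V i) (fun i => u i + 2 * h i).
move=> /(_ _ _ _) lower.
have : delta `^ t <= \sum_(j in [set: 'I_m]%SET) (u j + 2 * h j) `^ t.
  apply: lower.
  - by move=> j; rewrite addr_ge0// mulr_ge0// ltW; case: (hP j).
  - move=> j x y [x' Ux' dx] [y' Uy' dy].
    have := udx _ _ _ Ux' Uy'; have := dtri x x' y; have := dtri x' y' y.
    rewrite (dC x x'); lra.
  - move=> x Fx; have [i iD Vx] := FD _ Fx.
    by exists (Ordinal (Dm i iD)); rewrite ?inE.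
apply/negP; rewrite -ltNge.
rewrite (eq_bigl xpredT); last by move=> i; rewrite inE.
apply: (@le_lt_trans _ _ (\sum_(i < m) (u i `^ t + e / (2 ^ i.+1)%:R))).
  by apply: ler_sum => i _; case: (hP i).
rewrite big_split/= -lte_fin EFinD.
apply: (@lt_le_trans _ _ (e%:E + e%:E + e%:E)%E); last first.
  by rewrite -!EFinD lee_fin /e; have := powR_ge0 delta t; lra.
rewrite -sumEFin; apply: (@le_lt_trans _ _ (e%:E + e%:E)%E); last first.
  by rewrite -!EFinD lte_fin; lra.
apply: leeD.
  rewrite -(big_mkord xpredT (fun i => (u i `^ t)%:E)).
  apply: le_trans (ltW Us).
  apply: le_trans (nneseries_lim_ge m _); last by move=> *; apply: hausdorff_gauge_ge0.
  by apply: lee_sum => i _; apply: gE.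
rewrite -sumEFin -(big_mkord xpredT (fun i => (e / (2 ^ i.+1)%:R)%:E)).
apply: le_trans (epsilon_trick0 xpredT (ltW e0)).
apply: nneseries_lim_ge => i _ _; rewrite lee_fin divr_ge0// ltW//.
Qed.

(** It suffices to treat exponent 1, by monotonicity. Each cover set lies in an interval of twice
    its diameter, and countable subadditivity of Lebesgue measure bounds the sum from below by
    [r / 2]. *)
Lemma hausdorff_measure_segment (r t : R) : 0 < r -> 0 <= t <= 1 ->
  hausdorff_measure (@real_dist R) t `[0, r] <> 0%E.
Proof.
move=> r0 t01 H; have d0 : forall x y : R, 0 <= real_dist x y by move=> x y; apply: normr_ge0.
have {}H := hausdorff_measure_eq0_le d0 t01 H.
have : (hausdorff_content (@real_dist R) 1 1 `[0%R, r]%classic < (r / 2)%:E)%E.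
  apply: le_lt_trans (hausdorff_content_le_measure _ _ _ _) _; rewrite ?H ?lte_fin//.
  by rewrite divr_gt0.
move=> /hausdorff_content_cover[U [FU Ud Us]].
have /choice[u /all_and3[u0 ud gE]] := fun i => hausdorff_gauge_radius d0 ltr01 (Ud i).
have /choice[x xP] : forall i : nat, exists x : R, U i `<=` `[x - u i, x + u i].
  move=> i; have [->|/set0P[x Ux]] := eqVneq (U i) set0.
    by exists 0; apply: sub0set.
  exists x => y Uy; have := ud i x y Ux Uy; rewrite /real_dist ler_norml /= in_itv/=.
  by move=> /andP[? ?]; lra.
have := @measure_sigma_subadditive _ _ _ (@lebesgue_measure R) `[0, r]%classic
  (fun i => `[x i - u i, x i + u i]%classic).
move=> /(_ (fun i => measurable_itv _) (measurable_itv _) _).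
have cov : `[0, r]%classic `<=` \bigcup_i `[x i - u i, x i + u i]%classic.
  by move=> y /FU[i _ /xP Uy]; exists i.
move=> /(_ cov); apply/negP; rewrite -ltNge. rewrite /= lebesgue_measure_itv/= lte_fin r0 sube0.
apply: (@le_lt_trans _ _ (\sum_(0 <= i <oo) (2%:E * hausdorff_gauge (@real_dist R) 1 (U i))))%E.
  apply: lee_nneseries => [i _ _|i _]; first exact: measure_ge0.
  have u1 : ((u i)%:E <= hausdorff_gauge (@real_dist R) 1 (U i))%E.
    by rewrite -[u i]powRr1.
  apply: (@le_trans _ _ (2%:E * (u i)%:E)%E); last by apply: lee_wpmul2l.
  rewrite lebesgue_measure_itv/=; case: ifP => _; rewrite -?EFinB -EFinM lee_fin.
    by have := u0 i; lra.
  by rewrite mulr_ge0.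
rewrite nneseriesZl; last by move=> *; exact: hausdorff_gauge_ge0.
have -> : r%:E = (2%:E * (r / 2)%:E)%E by rewrite -EFinM mulrC divfK.
by rewrite lte_pmul2l// lte_fin.
Qed.

End lower_bounds.

(** * The Euclidean plane and the construction of arcs *)

Section euclidean_plane.
Context (R : realType).
Implicit Types (x y z : plane R) (A B C K : set (plane R)).
Local Notation d := (@euclidean_dist R).

Lemma euclidean_dist_ge0 x y : 0 <= d x y.
Proof. exact: sqrtr_ge0. Qed.

Lemma euclidean_distxx x : d x x = 0.
Proof. by rewrite /euclidean_dist !subrr expr0n/= addr0 sqrtr0. Qed.

Lemma euclidean_distC x y : d x y = d y x.
Proof. by rewrite /euclidean_dist -(sqrrN (x.1 - _)) -(sqrrN (x.2 - _)) !opprB. Qed.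

Lemma euclidean_dist_sqr x y : d x y ^+ 2 = (x.1 - y.1) ^+ 2 + (x.2 - y.2) ^+ 2.
Proof. by rewrite sqr_sqrtr// addr_ge0 ?sqr_ge0. Qed.

Lemma euclidean_dist_eq0 x y : d x y = 0 -> x = y.
Proof.
move=> h; have := euclidean_dist_sqr x y; rewrite h expr0n/=.
move=> /esym/eqP; rewrite paddr_eq0 ?sqr_ge0// !sqrf_eq0 !subr_eq0.
by case: x y {h} => [a b] [a' b'] /= /andP[/eqP -> /eqP ->].
Qed.

Lemma euclidean_dist_gt0 x y : x <> y -> 0 < d x y.
Proof.
move=> xy; rewrite lt_neqAle euclidean_dist_ge0 andbT eq_sym.
by apply/eqP => /euclidean_dist_eq0.
Qed.

Lemma euclidean_dist_tri x y z : d x z <= d x y + d y z.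
Proof.
have h0 := addr_ge0 (euclidean_dist_ge0 x y) (euclidean_dist_ge0 y z).
rewrite -(ler_pXn2r (_ : (0 < 2)%N)) ?nnegrE ?euclidean_dist_ge0//.
rewrite sqrrD !euclidean_dist_sqr.
pose a := x.1 - y.1; pose b := x.2 - y.2; pose a' := y.1 - z.1; pose b' := y.2 - z.2.
have -> : x.1 - z.1 = a + a' by rewrite /a /a'; ring.
have -> : x.2 - z.2 = b + b' by rewrite /b /b'; ring.
rewrite -/a -/b -/a' -/b'.
suff : a * a' + b * b' <= d x y * d y z.
  by rewrite -mulr_natr; lra.
apply: le_trans (ler_norm _) _.
rewrite -(ler_pXn2r (_ : (0 < 2)%N)) ?nnegrE ?mulr_ge0 ?euclidean_dist_ge0//.
rewrite exprMn !euclidean_dist_sqr -normrX ger0_norm ?sqr_ge0// -/a -/b -/a' -/b'.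
(* Lagrange's identity, hence the Cauchy-Schwarz inequality. *)
by rewrite -subr_ge0 (_ : _ - _ = (a * b' - b * a') ^+ 2) ?sqr_ge0//; ring.
Qed.

Lemma fst_le_euclidean_dist x y : `|x.1 - y.1| <= d x y.
Proof. by rewrite -sqrtr_sqr; apply: ler_wsqrtr; rewrite lerDl sqr_ge0. Qed.

Lemma snd_le_euclidean_dist x y : `|x.2 - y.2| <= d x y.
Proof. by rewrite -sqrtr_sqr; apply: ler_wsqrtr; rewrite lerDr sqr_ge0. Qed.

Lemma euclidean_dist_le x y : d x y <= `|x.1 - y.1| + `|x.2 - y.2|.
Proof.
rewrite -(ler_pXn2r (_ : (0 < 2)%N)) ?nnegrE ?addr_ge0 ?euclidean_dist_ge0//.
rewrite sqrrD euclidean_dist_sqr !real_normK ?num_real//.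
by rewrite lerD2r lerDl mulrn_wge0// mulr_ge0.
Qed.

(** The bridge between the product topology, which comes from the maximum norm, and the Euclidean
    distance. *)
Lemma nbhs_euclidean x A :
  nbhs x A <-> exists2 e : R, 0 < e & forall y, d x y < e -> A y.
Proof.
split.
  move=> /nbhs_ballP[e /= e0 xA]; exists e => // y xy; apply: xA.
  split; rewrite /ball/=.
    exact: le_lt_trans (fst_le_euclidean_dist x y) xy.
  exact: le_lt_trans (snd_le_euclidean_dist x y) xy.
move=> [e e0 xA]; apply/nbhs_ballP; exists (e / 2); first by rewrite /= divr_gt0.
move=> y [/= h1 h2]; apply: xA; apply: le_lt_trans (euclidean_dist_le x y) _.
by rewrite /ball /= in h1 h2; rewrite (splitr e) ltrD.
Qed.

Lemma closed_euclidean A x : closed A ->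
  (forall e : R, 0 < e -> exists2 y, A y & d x y < e) -> A x.
Proof.
move=> cA h; apply: cA => U /nbhs_euclidean[e e0 xU].
by have [y Ay xy] := h e e0; exists y; split => //; apply: xU.
Qed.

Lemma open_euclidean A (h : R) : open [set y | exists2 x, A x & d x y < h].
Proof.
rewrite openE => y [x Ax xy]; apply/nbhs_euclidean; exists (h - d x y); first by rewrite subr_gt0.
move=> z yz; exists x => //; apply: le_lt_trans (euclidean_dist_tri x y z) _.
by rewrite -ltrBrDl.
Qed.

Lemma lipschitz_continuous (f : plane R -> plane R) (L : R) : 0 < L ->
  (forall x y, d (f x) (f y) <= L * d x y) -> continuous f.
Proof.
move=> L0 fL x U /nbhs_euclidean[e e0 xU]; apply/nbhs_euclidean.
exists (e / L); first by rewrite divr_gt0.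
move=> y xy; apply: xU; apply: le_lt_trans (fL x y) _.
by rewrite mulrC -ltr_pdivlMr.
Qed.

Lemma lipschitz_within_real A (f : plane R -> R) (L : R) : 0 < L ->
  (forall x y, A x -> A y -> `|f x - f y| <= L * d x y) -> {within A, continuous f}.
Proof.
move=> L0 fL; apply/subspace_continuousP => x Ax U /nbhs_ballP[e /= e0 xU].
apply/nbhs_euclidean; exists (e / L); first by rewrite divr_gt0.
move=> y xy Ay; apply: xU; apply: le_lt_trans (fL x y Ax Ay) _.
by rewrite mulrC -ltr_pdivlMr.
Qed.

Lemma plane_hausdorff : hausdorff_space (plane R).
Proof. exact: norm_hausdorff. Qed.

Lemma compact_nested K (X : nat -> set (plane R)) : compact K ->
  (forall n, closed (X n)) -> (forall n, X n !=set0) ->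
  (forall n, X n.+1 `<=` X n) -> X 0%N `<=` K -> exists p, forall n, X n p.
Proof.
move=> cK cX X0 XS XK.
have Xle m n : (m <= n)%N -> X n `<=` X m.
  elim: n => [|n IH]; first by rewrite leqn0 => /eqP ->.
  rewrite leq_eqVlt => /orP[/eqP ->//|]; rewrite ltnS => /IH; apply: subset_trans.
  exact: XS.
have [a aX] := choice X0.
have KF : (a n @[n --> \oo]) K.
  by exists 0%N => // n _; apply: XK; apply: Xle (aX n).
have [p [Kp clp]] := cK _ (fmap_proper_filter a eventually_filter) KF.
exists p => n; rewrite (closure_id (X n)).1//; move=> U Up.
apply: clp => //; exists n => // m /= nm; apply: Xle nm _ (aX m).
Qed.

End euclidean_plane.
Arguments plane_hausdorff {R}.

Section connected_sets.
Context (T : topologicalType).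

(** If [P] and [Q] had no common point in [C], the trace of [P] would be open and closed in [C].
    This forces arcs through junctions. *)
Lemma connected_meet (C P Q : set T) : connected C -> closed P -> closed Q ->
  C `<=` P `|` Q -> C `&` P !=set0 -> C `&` Q !=set0 -> C `&` (P `&` Q) !=set0.
Proof.
move=> cC cP cQ CPQ CP CQ; apply: contrapT => no.
have CPE : C `&` P = C `&` ~` Q.
  apply/seteqP; split => x [Cx h]; split => //.
    by move=> Qx; apply: no; exists x.
  by case: (CPQ x Cx).
have CPC : C `&` P = C.
  apply: cC => //; first by exists (~` Q) => //; apply: closed_openC.
  by exists P.
have [x [Cx Qx]] := CQ; apply: no; exists x; split => //; split => //.
by have : C x by []; rewrite -CPC => -[].
Qed.

End connected_sets.

(* An arc is obtained by repeatedly splitting segments [u], with endpoints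
   [lft u] and [rgt u] and contained in [X u], into [L u] and [Q u]; the binary
   digits of the parameter tell which segment to follow. *)
Section splitting.
Context (R : realType) (St : Type) (lft rgt : St -> plane R)
  (X : St -> set (plane R)) (L Q : St -> St) (m : St -> R) (kappa : R).
Local Notation d := (@euclidean_dist R).
Hypothesis kappa01 : 0 <= kappa < 1.
Hypothesis X_compact : forall u, compact (X u).
Hypothesis lft_in : forall u, X u (lft u).
Hypothesis rgt_in : forall u, X u (rgt u).
Hypothesis lft_neq_rgt : forall u, lft u <> rgt u.
Hypothesis X_size : forall u x y, X u x -> X u y -> d x y <= m u.
Hypothesis mL : forall u, m (L u) <= kappa * m u.
Hypothesis mQ : forall u, m (Q u) <= kappa * m u.
Hypothesis lftL : forall u, lft (L u) = lft u.
Hypothesis rgtQ : forall u, rgt (Q u) = rgt u.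
Hypothesis rgtL : forall u, rgt (L u) = lft (Q u).
Hypothesis XL : forall u, X (L u) `<=` X u.
Hypothesis XQ : forall u, X (Q u) `<=` X u.
Hypothesis XLQ : forall u, X (L u) `&` X (Q u) `<=` [set rgt (L u)].
Implicit Types (u : St) (t : R) (n : nat).

Let step (v : St * R) : St * R :=
  if v.2 < 2^-1 then (L v.1, 2 * v.2) else (Q v.1, 2 * v.2 - 1).
Let st n u t := (iter n step (u, t)).1.

Let stS n u t : st n.+1 u t = st n (step (u, t)).1 (step (u, t)).2.
Proof. by rewrite /st iterSr; case: (step (u, t)). Qed.

Let X_st n u t : X (st n.+1 u t) `<=` X (st n u t).
Proof.
rewrite /st iterS; case: (iter n step (u, t)) => v r; rewrite /step /=.
by case: ifP => _ /=; [apply: XL|apply: XQ].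
Qed.

Let m_st n u t : m (st n u t) <= kappa ^+ n * m u.
Proof.
elim: n u t => [|n IH] u t; first by rewrite expr0 mul1r.
rewrite stS; apply: le_trans (IH _ _) _.
rewrite exprSr -mulrA ler_wpM2l//; first by rewrite exprn_ge0//; case/andP: kappa01.
by rewrite /step /=; case: ifP => _ /=; [apply: mL|apply: mQ].
Qed.

Let m_ge0 u : 0 <= m u.
Proof. by rewrite -(euclidean_distxx (lft u)) X_size. Qed.

Let G_exists u t : exists p, forall n, X (st n u t) p.
Proof.
apply: (@compact_nested R (X u)) => // n.
- by apply: compact_closed; [exact: plane_hausdorff|exact: X_compact].
- by exists (lft (st n u t)).
Qed.

Let G u t := xget (lft u) [set p | forall n, X (st n u t) p].

Let GP u t n : X (st n u t) (G u t).
Proof.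
have [p hp] := G_exists u t.
by have /(_ n) := @xgetPex _ (lft u) [set p | forall n, X (st n u t) p] (ex_intro _ p hp).
Qed.

Let G_unique u t p : (forall n, X (st n u t) p) -> G u t = p.
Proof.
move=> h; apply: euclidean_dist_eq0; apply/eqP; rewrite eq_le euclidean_dist_ge0 andbT.
rewrite leNgt; apply/negP => d0.
have h0 : 0 < m u + 1 by have := m_ge0 u; lra.
have [N /(_ N (leqnn N))] := expr_lt_eventually kappa01 (divr_gt0 d0 h0).
rewrite ltr_pdivlMr// => hN.
have := le_trans (X_size (GP u t N) (h N)) (m_st N u t).
rewrite leNgt => /negP; apply; apply: le_lt_trans hN.
by rewrite ler_wpM2l ?exprn_ge0//; [case/andP: kappa01|rewrite lerDl].
Qed.

Let G_lt u t : t < 2^-1 -> G u t = G (L u) (2 * t).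
Proof.
move=> t2; apply: G_unique => -[|n]; first exact: XL (GP (L u) (2 * t) 0).
by rewrite stS /step/= t2 /=; apply: GP.
Qed.

Let G_ge u t : 2^-1 <= t -> G u t = G (Q u) (2 * t - 1).
Proof.
move=> t2; apply: G_unique => -[|n]; first exact: XQ (GP (Q u) (2 * t - 1) 0).
by rewrite stS /step/= ltNge t2 /=; apply: GP.
Qed.

Let G0 u : G u 0 = lft u.
Proof.
apply: G_unique => n; elim: n u => [|n IH] u; first exact: lft_in.
by rewrite stS /step/= invr_gt0 ltr0n /= mulr0 -lftL; apply: IH.
Qed.

Let G1 u : G u 1 = rgt u.
Proof.
apply: G_unique => n; elim: n u => [|n IH] u; first exact: rgt_in.
rewrite stS /step/= ltNge invf_le1 ?ltr0n// ler1n /= mulr1.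
have -> : 2 - 1 = 1 :> R by lra.
by rewrite -rgtQ; apply: IH.
Qed.

Let GX u t : X u (G u t). Proof. exact: (GP u t 0). Qed.

(** Such a parameter begins with [n] binary digits 0, so its point lies in the segment reached by
    [n] left choices, which still starts at [lft u]. *)
Let G_near_lft n u t : 0 <= t -> 2 ^+ n * t < 1 -> d (G u t) (lft u) <= kappa ^+ n * m u.
Proof.
elim: n u t => [|n IH] u t t0 h; first by rewrite expr0 mul1r X_size.
have h2 : (1 : R) <= 2 ^+ n by rewrite exprn_ege1// ler1n.
have h' : 2 ^+ n * (2 * t) < 1 by rewrite mulrA -exprSr.
have t2 : t < 2^-1 by nra.
rewrite G_lt// -lftL; apply: le_trans (IH _ _ _ h') _; first by rewrite mulr_ge0.
by rewrite exprSr -mulrA ler_wpM2l// exprn_ge0//; case/andP: kappa01.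
Qed.

Let G_near_rgt n u t : t <= 1 -> 2 ^+ n * (1 - t) < 1 ->
  d (G u t) (rgt u) <= kappa ^+ n * m u.
Proof.
elim: n u t => [|n IH] u t t1 h; first by rewrite expr0 mul1r X_size.
have h2 : (1 : R) <= 2 ^+ n by rewrite exprn_ege1// ler1n.
have h' : 2 ^+ n * (1 - (2 * t - 1)) < 1.
  by rewrite (_ : 1 - (2 * t - 1) = 2 * (1 - t)); [rewrite mulrA -exprSr|ring].
have t2 : 2^-1 <= t by nra.
rewrite G_ge// -rgtQ; apply: le_trans (IH _ _ _ h') _; first lra.
by rewrite exprSr -mulrA ler_wpM2l// exprn_ge0//; case/andP: kappa01.
Qed.

(** Parameters in the same half are handled by induction. When they first fall into different
    halves, both points are near the common endpoint of these halves; the factor 2 pays for this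
    detour, which occurs once. *)
Let G_modulus n u t t' : 0 <= t -> t <= t' -> t' <= 1 -> 2 ^+ n * (t' - t) < 1 ->
  d (G u t) (G u t') <= 2 * (kappa ^+ n * m u).
Proof.
have k0 : 0 <= kappa by case/andP: kappa01.
elim: n u t t' => [|n IH] u t t' t0 tt t1 h.
  rewrite expr0 mul1r; apply: le_trans (X_size (GX u t) (GX u t')) _.
  by have := m_ge0 u; lra.
have mk v : m v <= kappa * m u -> kappa ^+ n * m v <= kappa ^+ n.+1 * m u.
  by move=> mv; rewrite exprSr -mulrA ler_wpM2l// exprn_ge0.
have mkL := mk _ (mL u); have mkQ := mk _ (mQ u).
have h2 : (1 : R) <= 2 ^+ n by rewrite exprn_ege1// ler1n.
rewrite exprSr in h.
have [t2|t2] := ltP t 2^-1; have [t'2|t'2] := ltP t' 2^-1.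
- rewrite (G_lt _ t2) (G_lt _ t'2); apply: (@le_trans _ _ (2 * (kappa ^+ n * m (L u)))).
    by apply: IH; [lra|lra|lra|rewrite -mulrBr mulrA].
  by rewrite ler_pM2l.
- rewrite (G_lt _ t2) (G_ge _ t'2).
  have h3 : d (G (L u) (2 * t)) (rgt (L u)) <= kappa ^+ n * m (L u).
    by apply: G_near_rgt; [lra|nra].
  have h4 : d (G (Q u) (2 * t' - 1)) (lft (Q u)) <= kappa ^+ n * m (Q u).
    by apply: G_near_lft; [lra|nra].
  rewrite euclidean_distC -rgtL in h4.
  by have := euclidean_dist_tri (G (L u) (2 * t)) (rgt (L u)) (G (Q u) (2 * t' - 1)); lra.
- by exfalso; lra.
- rewrite (G_ge _ t2) (G_ge _ t'2); apply: (@le_trans _ _ (2 * (kappa ^+ n * m (Q u)))).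
    by apply: IH; [lra|lra|lra|nra].
  by rewrite ler_pM2l.
Qed.

Let dyadic_gap t : 0 < t -> exists n, 1 <= 2 ^+ n * t.
Proof.
move=> t0; have h : 0 <= (2^-1 : R) < 1 by rewrite invr_ge0 ler0n invf_lt1 ?ltr1n.
have [N /(_ N (leqnn N))] := expr_lt_eventually h t0.
by rewrite exprVn => hN; exists N; rewrite -ler_pdivrMl ?mulr1 ?ltW// exprn_gt0.
Qed.

Let G_neq_rgt n u t : 0 <= t <= 1 -> 1 <= 2 ^+ n * (1 - t) -> G u t <> rgt u.
Proof.
elim: n u t => [|n IH] u t t01 h.
  have -> : t = 0 by rewrite expr0 in h; lra.
  by rewrite G0.
rewrite exprSr in h; have [t2|t2] := ltP t 2^-1.
  rewrite G_lt// => e; apply: (@lft_neq_rgt (Q u)).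
  rewrite -rgtL rgtQ; apply/esym/XLQ; split.
    by rewrite -e; apply: GX.
  by rewrite -rgtQ; apply: rgt_in.
rewrite G_ge// -rgtQ; apply: IH; first lra.
by rewrite (_ : 1 - (2 * t - 1) = 2 * (1 - t)); [rewrite mulrA|ring].
Qed.

(** The gap doubles at each step until the parameters fall into different halves. Equal points would
    then be the junction, which is the right end of the left half and is reached there at parameter
    1 only, by [G_neq_rgt]. *)
Let G_neq n u t t' : 0 <= t -> t' <= 1 -> 1 <= 2 ^+ n * (t' - t) -> G u t <> G u t'.
Proof.
elim: n u t t' => [|n IH] u t t' t0 t1 h.
  have [-> ->] : t = 0 /\ t' = 1 by rewrite expr0 in h; lra.
  by rewrite G0 G1.
have h2 : (1 : R) <= 2 ^+ n by rewrite exprn_ege1// ler1n.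
rewrite exprSr in h; have tt : t < t' by nra.
have [t2|t2] := ltP t 2^-1; have [t'2|t'2] := ltP t' 2^-1.
- rewrite (G_lt _ t2) (G_lt _ t'2); apply: IH; [lra|lra|by rewrite -mulrBr mulrA].
- rewrite (G_lt _ t2) (G_ge _ t'2) => e.
  have [k hk] := @dyadic_gap (1 - 2 * t) ltac:(lra).
  apply: (G_neq_rgt (u := L u) _ hk); first lra.
  by apply: XLQ; split; [exact: GX|rewrite e; exact: GX].
- by exfalso; lra.
- rewrite (G_ge _ t2) (G_ge _ t'2); apply: IH; [lra|lra|nra].
Qed.

Lemma arc_of_splitting u : exists2 g, is_arc (lft u) (rgt u) g & g `<=` X u.
Proof.
have k0 : 0 <= kappa by case/andP: kappa01.
exists (G u @` `[0, 1]); last by move=> _ [t _ <-]; apply: GX.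
exists (G u); split => //; last first.
  move=> t t'; rewrite !in_itv/= => t01 t'01 e; apply/eqP.
  rewrite eq_le !leNgt; apply/andP; split; apply/negP => tt.
    have [n hn] := @dyadic_gap (t - t') ltac:(lra).
    by apply: (G_neq (u := u) _ _ hn); [lra|lra|].
  have [n hn] := @dyadic_gap (t' - t) ltac:(lra).
  by apply: (G_neq (u := u) _ _ hn); [lra|lra|].
apply/subspace_continuousP => t; rewrite /= in_itv/= => t01 U /nbhs_euclidean[e e0 tU].
have h0 : 0 < 2 * (m u + 1) by have := m_ge0 u; lra.
have [N /(_ N (leqnn N))] := expr_lt_eventually kappa01 (divr_gt0 e0 h0).
rewrite ltr_pdivlMr// => hN.
apply/nbhs_ballP; exists (2 ^- N); first by rewrite /= invr_gt0 exprn_gt0.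
move=> t' /=; rewrite /ball/= => tt'; rewrite /= in_itv/= => t'01; apply: tU.
have hm : 2 * (kappa ^+ N * m u) < e.
  apply: le_lt_trans hN; have := exprn_ge0 N k0; nra.
apply: le_lt_trans hm.
have tN : 2 ^+ N * `|t - t'| < 1.
  by rewrite -ltr_pdivlMl ?mulr1// exprn_gt0.
have [le_tt|lt_tt] := leP t t'.
  apply: G_modulus => //; [lra|lra|].
  by rewrite ler0_norm ?opprB// in tN; lra.
rewrite euclidean_distC; apply: G_modulus; [lra|lra|lra|].
by rewrite ger0_norm// in tN; lra.
Qed.

End splitting.

Inductive idx := i1 | i2 | i3.

Section zoom.
Context (R : realType) (I : Type) (S : I -> plane R -> plane R) (r : I -> R) (rho : R)
  (Q : set (plane R)).
Local Notation d := (@euclidean_dist R).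
Hypothesis r_gt0 : forall i, 0 < r i.
Hypothesis r_le : forall i, r i <= rho.
Hypothesis rho01 : 0 <= rho < 1.
Hypothesis S_scales : forall i, scales_by d (r i) (S i).
Hypothesis Q_diam : forall x y, Q x -> Q y -> d x y <= 1.

(** Pulling two points of a common cell back by its map multiplies their distance by at least the
    inverse of [rho]. As distances in [Q] are at most 1, this stops for distinct points. *)
Lemma zoom_ind (P : plane R -> plane R -> Prop) :
  (forall i a b, Q a -> Q b -> P a b -> P (S i a) (S i b)) ->
  (forall a b, Q a -> Q b -> (forall i, ~ ((S i @` Q) a /\ (S i @` Q) b)) -> P a b) ->
  forall a b, Q a -> Q b -> a <> b -> P a b.
Proof.
move=> PS P0.
have key n : forall a b, Q a -> Q b -> rho ^+ n < d a b -> P a b.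
  elim: n => [|n IH] a b Qa Qb.
    by rewrite expr0 ltNge Q_diam.
  have [[i [[a' Qa' <-] [b' Qb' <-]]]|no] :=
    pselect (exists i, (S i @` Q) a /\ (S i @` Q) b); last first.
    by move=> _; apply: P0 => // i h; apply: no; exists i.
  rewrite (S_scales i) => h; apply: PS => //; apply: IH => //.
  have ri := r_gt0 i; rewrite -(ltr_pM2l ri); apply: le_lt_trans h.
  by rewrite exprS ler_wpM2r// exprn_ge0//; case/andP: rho01.
move=> a b Qa Qb ab.
have [N /(_ N (leqnn N))] := expr_lt_eventually rho01 (euclidean_dist_gt0 ab).
exact: key.
Qed.

End zoom.

Section similarities.
Context (R : realType) (f : plane R -> plane R) (r : R).
Local Notation d := (@euclidean_dist R).
Hypothesis r_gt0 : 0 < r.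
Hypothesis f_scales : scales_by d r f.

Lemma scales_by_inj : injective f.
Proof.
move=> x y e; apply: euclidean_dist_eq0; apply/eqP.
have := f_scales x y; rewrite e euclidean_distxx => /esym/eqP.
by rewrite mulf_eq0 (gt_eqF r_gt0).
Qed.

Lemma scales_by_continuous : continuous f.
Proof. by apply: (lipschitz_continuous r_gt0) => x y; rewrite f_scales. Qed.

Lemma scales_by_compact (A : set (plane R)) : compact A -> compact (f @` A).
Proof.
by apply: continuous_compact; apply: continuous_subspaceT; apply: scales_by_continuous.
Qed.

End similarities.

(** * Arcs and cut points *)

Section arcs.
Context (R : realType).
Implicit Types (a b : plane R) (g C : set (plane R)).

Lemma is_arc_compact a b g : is_arc a b g -> compact g.
Proof. by case=> f [fc _ _ _ ->]; apply: continuous_compact => //; apply: segment_compact. Qed.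

Lemma is_arc_closed a b g : is_arc a b g -> closed g.
Proof. by move=> /is_arc_compact; apply: compact_closed; apply: plane_hausdorff. Qed.

Lemma is_arc_connected a b g : is_arc a b g -> connected g.
Proof. by case=> f [fc _ _ _ ->]; apply: connected_continuous_connected => //; apply: segment_connected. Qed.

Lemma is_arc_left a b g : is_arc a b g -> g a.
Proof. by case=> f [_ _ <- _ ->]; exists 0 => //; rewrite /= in_itv/= lexx ler01. Qed.

Lemma is_arc_right a b g : is_arc a b g -> g b.
Proof. by case=> f [_ _ _ <- ->]; exists 1 => //; rewrite /= in_itv/= lexx ler01. Qed.

Lemma is_arc_neq a b g : is_arc a b g -> a <> b.
Proof.
case=> f [_ fi <- <- _] /fi; rewrite !in_itv/= !lexx ler01 => /(_ isT isT)/esym/eqP.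
by rewrite oner_eq0.
Qed.

Lemma is_arc_image a b g (f : plane R -> plane R) : continuous f -> injective f ->
  is_arc a b g -> is_arc (f a) (f b) (f @` g).
Proof.
move=> fc fi [h [hc hi h0 h1 ->]]; exists (f \o h); split.
- apply/subspace_continuousP => x xI.
  by apply: cvg_comp; [exact: ((subspace_continuousP _ _).1 hc x xI)|exact: fc].
- by move=> x y xI yI /fi; apply: hi.
- by rewrite /= h0.
- by rewrite /= h1.
- by rewrite image_comp.
Qed.

(** [z] is a cut point between [u] and [v]. With closed sides, [connected_meet] shows that a
    connected subset of [K] meeting both sides contains [z]. *)
Definition points_separated (K : set (plane R)) (u v : plane R) :=
  exists (z : plane R) (P Q : set (plane R)),
    [/\ closed P, closed Q, K `<=` P `|` Q, P `&` Q `<=` [set z] &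
      [/\ P u, Q v, u <> z & v <> z]].

(* If a point [z] of the arc were outside [C], the points of the arc
   just before and just after [z] would be separated in [K] by a point of the arc
   between them, which would then separate [a] from [b] in [C]. *)
Lemma arc_min (K : set (plane R)) a b g C :
  (forall u v, K u -> K v -> u <> v -> points_separated K u v) ->
  is_arc a b g -> g `<=` K -> connected C -> closed C -> C `<=` K -> C a -> C b ->
  g `<=` C.
Proof.
move=> sepK [f [fc fi f0 f1 ->]] gK cC clC CK Ca Cb z [t tI <-]; apply: contrapT => nC.
have fcon (t1 t2 : R) : 0 <= t1 -> t2 <= 1 -> connected (f @` `[t1, t2]).
  move=> h1 h2; apply: connected_continuous_connected; first exact: segment_connected.
  apply: continuous_subspaceW fc => x; rewrite /= !in_itv/= => /andP[? ?].
  by apply/andP; split; lra.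
have t01 : 0 <= t <= 1 by move: tI; rewrite /= in_itv.
have oC : nbhs (f t) (~` C) by apply: open_nbhs_nbhs; split => //; apply: closed_openC.
have /nbhs_ballP[e /= e0 te] : within `[0, 1] (nbhs t) (f @^-1` (~` C)).
  exact: ((subspace_continuousP _ _).1 fc t tI _ oC).
have e20 : 0 < e / 2 by rewrite divr_gt0.
have neC (y : R) : 0 <= y <= 1 -> `|t - y| < e -> ~ C (f y).
  by move=> y01 /te/=; apply; rewrite in_itv.
have t0 : t <> 0 by move=> t0; apply: nC; rewrite t0 f0.
have t1 : t <> 1 by move=> t1; apply: nC; rewrite t1 f1.
have tgt0 : 0 < t by rewrite lt_neqAle eq_sym; apply/andP; split; [apply/eqP|lra].
have tlt1 : t < 1 by rewrite lt_neqAle; apply/andP; split; [apply/eqP|lra].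
(* A parameter interval around [t] whose image avoids [C], clamped to the unit interval; half of [e]
   keeps its closed ends inside the ball. *)
pose s1 := Num.max 0 (t - e / 2); pose s2 := Num.min 1 (t + e / 2).
have s1P : [/\ 0 <= s1, s1 < t & t - e / 2 <= s1].
  by rewrite /s1 le_max lexx gt_max tgt0 le_max lexx orbT; split => //; rewrite /=; lra.
have s2P : [/\ s2 <= 1, t < s2 & s2 <= t + e / 2].
  by rewrite /s2 ge_min lexx lt_min tlt1 ge_min lexx orbT; split => //; rewrite /=; lra.
case: s1P s2P => s10 s1t s1e [s21 ts2 s2e].
have fI (x y : R) : 0 <= x <= 1 -> 0 <= y <= 1 -> f x = f y -> x = y.
  by move=> xI yI; apply: fi; rewrite in_itv.
have fK (x : R) : 0 <= x <= 1 -> K (f x) by move=> xI; apply: gK; exists x; rewrite //= in_itv.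
have s12 : f s1 <> f s2 by move=> /fI e12; have := e12 ltac:(lra) ltac:(lra); lra.
have [w [P [Q [cP cQ KPQ PQ [Pu Qv uw vw]]]]] :=
  sepK _ _ (fK s1 ltac:(lra)) (fK s2 ltac:(lra)) s12.
have fKI (x1 x2 : R) : 0 <= x1 -> x2 <= 1 -> f @` `[x1, x2] `<=` P `|` Q.
  move=> h1 h2 y [x /=]; rewrite in_itv/= => xI <-; apply: KPQ; apply: fK.
  by apply/andP; split; lra.
have [y [[s /=]]] : f @` `[s1, s2] `&` (P `&` Q) !=set0.
  apply: connected_meet => //; [by apply: fcon|by apply: fKI| |].
  - by exists (f s1); split => //; exists s1; rewrite //= in_itv/= lexx; lra.
  - by exists (f s2); split => //; exists s2; rewrite //= in_itv/= lexx; lra.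
rewrite in_itv/= => sI <- /PQ fs.
have s1s : s1 <> s by move=> h; apply: uw; rewrite h.
have s2s : s2 <> s by move=> h; apply: vw; rewrite h.
have ss1 : s1 < s by rewrite lt_neqAle; apply/andP; split; [apply/eqP|lra].
have ss2 : s < s2 by rewrite lt_neqAle; apply/andP; split; [apply/eqP/nesym|lra].
have wC : ~ C w by rewrite -fs; apply: neC; rewrite ?ltr_norml; lra.
(* Otherwise the part of the arc before [f s1] would run from [Q] to [P] and pass through [w] a
   second time, against injectivity. *)
have Pa : P a.
  apply: contrapT => nPa; have Qa : Q a by case: (KPQ a (CK _ Ca)).
  have [y' [[x /=]]] : f @` `[0, s1] `&` (P `&` Q) !=set0.
    apply: connected_meet => //; [by apply: fcon; lra|by apply: fKI; lra| |].
    - by exists (f s1); split => //; exists s1; rewrite //= in_itv/= lexx; lra.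
    - by exists a; split => //; exists 0; rewrite //= in_itv/= lexx; lra.
  rewrite in_itv/= => xI <- /PQ; rewrite /= -fs => /fI xs.
  by have := xs ltac:(lra) ltac:(lra); lra.
have Qb : Q b.
  apply: contrapT => nQb; have Pb : P b by case: (KPQ b (CK _ Cb)).
  have [y' [[x /=]]] : f @` `[s2, 1] `&` (P `&` Q) !=set0.
    apply: connected_meet => //; [by apply: fcon; lra|by apply: fKI; lra| |].
    - by exists b; split => //; exists 1; rewrite //= in_itv/= lexx; lra.
    - by exists (f s2); split => //; exists s2; rewrite //= in_itv/= lexx; lra.
  rewrite in_itv/= => xI <- /PQ; rewrite /= -fs => /fI xs.
  by have := xs ltac:(lra) ltac:(lra); lra.
have [x [Cx /PQ xw]] : C `&` (P `&` Q) !=set0.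
  apply: connected_meet => //; [by move=> x /CK/KPQ|by exists a|by exists b].
by apply: wC; rewrite -xw.
Qed.

End arcs.

(** * Dendrites *)

Section dendrite.
Context (R : realType) (K : set (plane R)) (S : option idx -> plane R -> plane R)
  (r : option idx -> R) (rho : R) (A C : idx -> plane R).
Local Notation d := (@euclidean_dist R).
Hypothesis K_compact : compact K.
Hypothesis K_diam : forall x y, K x -> K y -> d x y <= 1.
Hypothesis r_gt0 : forall c, 0 < r c.
Hypothesis r_le : forall c, r c <= rho.
Hypothesis rho01 : 0 < rho < 1.
Hypothesis S_scales : forall c, scales_by d (r c) (S c).
Hypothesis SK : forall c x, K x -> K (S c x).
Hypothesis K_cover : forall x, K x -> exists c, (S c @` K) x.
Hypothesis AK : forall i, K (A i).
Hypothesis CK : forall i, K (C i).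
Hypothesis SC : forall i, S (Some i) (C i) = S None (A i).
Hypothesis cells_disjoint : forall i j x y, K x -> K y ->
  S (Some i) x = S (Some j) y -> i = j.
Hypothesis cell_center : forall i x y, K x -> K y ->
  S None x = S (Some i) y -> x = A i.

Let cell c := S c @` K.
Let rest i := [set x | exists2 c, c <> Some i & cell c x].
Let B i := S None (A i).

Let S_inj c : injective (S c).
Proof. exact: scales_by_inj (S_scales c). Qed.

Let cell_compact c : compact (cell c).
Proof. exact: (scales_by_compact (r_gt0 c) (S_scales c)). Qed.

Let closedK (X : set (plane R)) : compact X -> closed X.
Proof. by apply: compact_closed; apply: plane_hausdorff. Qed.

Let closed_S c (X : set (plane R)) : closed X -> X `<=` K -> closed (S c @` X).
Proof.
move=> cX XK; apply: closedK; apply: (scales_by_compact (r_gt0 c) (S_scales c)).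
by rewrite -(setIidr XK); apply: compact_closedI.
Qed.

Let gather_closed (p : option idx -> Prop) :
  closed [set x | exists2 c, p c & cell c x].
Proof.
have one c : closed [set x | p c /\ cell c x].
  have [pc|pc] := pselect (p c).
    rewrite (_ : [set x | _] = cell c); first by (apply: closedK; apply: cell_compact).
    by apply/seteqP; split => x; [case|move=> cx; split].
  rewrite (_ : [set x | _] = set0); first exact: closed0.
  by apply/seteqP; split => x; case.
rewrite (_ : [set x | _] = [set x | p None /\ cell None x] `|`
  ([set x | p (Some i1) /\ cell (Some i1) x] `|`
  ([set x | p (Some i2) /\ cell (Some i2) x] `|` [set x | p (Some i3) /\ cell (Some i3) x]))).
  by do 3 (apply: closedU; first exact: one); exact: one.
apply/seteqP; split => x.
  by case=> [[[]|]] pc cx; [right; left|right; right; left|right; right; right|left].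
by case=> [|[|[]]] [pc cx]; [exists None|exists (Some i1)|exists (Some i2)|exists (Some i3)].
Qed.

Let rest_closed i : closed (rest i). Proof. exact: gather_closed. Qed.

Let cellK c : cell c `<=` K. Proof. by move=> _ [x Kx <-]; apply: SK. Qed.

Let cell_B i : cell (Some i) (B i). Proof. by exists (C i). Qed.

Let center_B i : cell None (B i). Proof. by exists (A i). Qed.


Let K_cell_rest i : K `<=` cell (Some i) `|` rest i.
Proof.
move=> x /K_cover[c cx]; have [ci|nc] := pselect (c = Some i).
  by left; rewrite -ci.
by right; exists c.
Qed.

Let cell_rest i : cell (Some i) `&` rest i `<=` [set B i].
Proof.
move=> x [[y Ky <-] [[j|] ni [y' Ky' e]]].
  by case: ni; rewrite (cells_disjoint Ky' Ky e).
by rewrite -e (cell_center Ky' Ky e).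
Qed.

Let no_common a b := forall c, ~ (cell c a /\ cell c b).

(** The base cases of the zoom. A junction lies in two cells, the centre and a corner; an endpoint
    equal to a junction next to the other endpoint would share a cell with it, whence the
    inequalities. *)
Let no_common_cases a b : K a -> K b -> no_common a b ->
  (exists2 i, cell (Some i) a /\ cell None b & a <> B i /\ b <> B i) \/
  (exists2 j, cell None a /\ cell (Some j) b & a <> B j /\ b <> B j) \/
  (exists i j, [/\ i <> j, cell (Some i) a, cell (Some j) b &
     [/\ a <> B i, b <> B i, a <> B j & b <> B j]]).
Proof.
move=> /K_cover[ca cea] /K_cover[cb ceb] no.
have aB : ~ cell None a -> forall i, a <> B i by move=> n i h; apply: n; rewrite h.
have bB : ~ cell None b -> forall i, b <> B i by move=> n i h; apply: n; rewrite h.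
have aS i : ~ cell (Some i) a -> a <> B i by move=> n h; apply: n; rewrite h.
have bS i : ~ cell (Some i) b -> b <> B i by move=> n h; apply: n; rewrite h.
have [a0|a0] := pselect (cell None a).
  have b0 : ~ cell None b by move=> b0; apply: (no None).
  case: cb ceb => // j bj; right; left; exists j => //; split; last exact: bB.
  by apply: aS => aj; apply: (no (Some j)).
case: ca cea => // i ai.
have bi : ~ cell (Some i) b by move=> bi; apply: (no (Some i)).
have [b0|b0] := pselect (cell None b).
  by left; exists i => //; split; [exact: aB|exact: bS].
case: cb ceb => // j bj; right; right; exists i, j; split => //.
  by move=> ij; apply: bi; rewrite ij.
by split; [exact: aB|exact: bS|exact: aB|exact: bB].
Qed.

Let sep_sym u v : points_separated K u v -> points_separated K v u.
Proof.
case=> z [P [Q [cP cQ KPQ PQ [Pu Qv uz vz]]]]; exists z, Q, P; split => //.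
  by rewrite setUC.
by rewrite setIC.
Qed.

(* To separate two points of [S c @` K] in [K], separate their preimages and
   add the other cells to the side to which they are attached. *)
Let sep_scale c u v : K u -> K v -> points_separated K u v ->
  points_separated K (S c u) (S c v).
Proof.
move=> Ku Kv [z [P0 [Q0 [cP0 cQ0 KPQ0 PQ0 [Pu0 Qv0 uz vz]]]]].
pose P := P0 `&` K; pose Q := Q0 `&` K.
have cP : closed P by apply: closedI => //; apply: closedK.
have cQ : closed Q by apply: closedI => //; apply: closedK.
have PK : P `<=` K by move=> x [].
have QK : Q `<=` K by move=> x [].
have KPQ : K `<=` P `|` Q by move=> x Kx; case: (KPQ0 x Kx); [left|right].
have PQ : P `&` Q `<=` [set z] by move=> x [[? _] [? _]]; apply: PQ0.
have Pu : P u by []. have Qv : Q v by [].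
have Suz : S c u <> S c z by move/S_inj.
have Svz : S c v <> S c z by move/S_inj.
have SPQ x : (S c @` P) x -> (S c @` Q) x -> x = S c z.
  by move=> [y Py <-] [y' Qy' /S_inj yy]; congr (S c _); apply: PQ; split => //; rewrite -yy.
(* A corner cell hangs on the rest of [K] by the single point [B i], so the rest joins the side that
   contains [C i]. *)
have attach i P' Q' : c = Some i -> closed P' -> closed Q' -> P' `<=` K -> Q' `<=` K ->
    K `<=` P' `|` Q' ->
    (forall x, (S c @` P') x -> (S c @` Q') x -> x = S c z) -> P' (C i) ->
    forall u v, P' u -> Q' v -> S c u <> S c z -> S c v <> S c z ->
    points_separated K (S c u) (S c v).
  move=> ci cP' cQ' P'K Q'K KP'Q' SP'Q' P'C u' v' P'u Q'v u'z v'z.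
  exists (S c z), (S c @` P' `|` rest i), (S c @` Q'); split.
  - by apply: closedU => //; apply: closed_S.
  - exact: closed_S.
  - move=> x /(@K_cell_rest i)[|]; last by left; right.
    by rewrite /cell -ci => -[y /KP'Q'[] hy <-]; [left; left|right]; exists y.
  - move=> x [[xP|xr] xQ]; first exact: SP'Q'.
    apply: SP'Q' => //; have -> : x = B i.
      by apply: cell_rest; split => //; rewrite /cell -ci; case: xQ => y /Q'K Ky <-; exists y.
    by rewrite /B -SC -ci; exists (C i).
  - by split => //; left; exists u'.
case: c Suz Svz SPQ attach => [i|] Suz Svz SPQ attach.
  case: (KPQ (C i) (CK i)) => h; first exact: (attach i P Q).
  apply: sep_sym; apply: (attach i Q P) => //; first by rewrite setUC.
  by move=> x hq hp; apply: SPQ.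
(* For the central cell, each corner cell [k] joins the side containing [A k], and the side [P] if
   both do; in that case [A k] is the separating point itself. *)
exists (S None z),
  (S None @` P `|` [set x | exists2 c, (exists2 k, c = Some k & P (A k)) & cell c x]),
  (S None @` Q `|` [set x | exists2 c, (exists2 k, c = Some k & ~ P (A k)) & cell c x]).
have junction k x y : K x -> K y -> S None x = S (Some k) y -> S None x = B k.
  by move=> Kx Ky e; rewrite (cell_center Kx Ky e).
split.
- by apply: closedU; [apply: closed_S|apply: gather_closed].
- by apply: closedU; [apply: closed_S|apply: gather_closed].
- move=> x /K_cover[[k|]] cx; last first.
    by case: cx => y /KPQ[] hy <-; [left; left|right; left]; exists y.
  have [h|h] := pselect (P (A k)); [left|right]; right; exists (Some k) => //; by exists k.
- move=> x [[xP|[_ [k -> Pk] [y Ky xE]]] [xQ|[_ [l -> Pl] [y' Ky' xE']]]].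
  + exact: SPQ.
  + case: xP => p Pp px; case: Pl.
    by rewrite -(cell_center (PK _ Pp) Ky')// px.
  + case: xQ => q Qq qx.
    have qA : q = A k by apply: (cell_center (QK _ Qq) Ky); rewrite qx.
    by apply: SPQ; rewrite -qx; exists q => //; rewrite qA.
  + by case: Pl; have <- := @cells_disjoint k l _ _ Ky Ky' (etrans xE (esym xE')).
- by split => //; left; [exists u|exists v].
Qed.

(** Zooming reduces to points without a common cell, and a junction [B i] separates these. *)
Lemma dendrite_separated u v : K u -> K v -> u <> v -> points_separated K u v.
Proof.
move=> Ku Kv uv; have rho0 : 0 <= rho < 1 by case/andP: rho01 => /ltW -> ->.
apply: (zoom_ind r_gt0 r_le rho0 S_scales K_diam (P := points_separated K)) => //.
move=> {Ku Kv uv} {}u {}v Ku Kv no.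
have base i a b : cell (Some i) a -> rest i b -> a <> B i -> b <> B i ->
    points_separated K a b.
  move=> ai bi aB bB; exists (B i), (cell (Some i)), (rest i); split => //.
  by apply: closedK; apply: cell_compact.
have [[i [ui v0] [uB vB]]|[[j [u0 vj] [uB vB]]|[i [j [ij ui vj [uB vB _ _]]]]]] :=
  no_common_cases Ku Kv no.
- by apply: (base i) => //; exists None.
- by apply: sep_sym; apply: (base j) => //; exists None.
- by apply: (base i) => //; exists (Some j) => // -[] /esym.
Qed.

Let word (w : seq (option idx)) : plane R -> plane R := foldr (fun c f => S c \o f) id w.
Let ratio (w : seq (option idx)) : R := foldr (fun c x => r c * x) 1 w.

Let word_cat w v x : word (w ++ v) x = word w (word v x).
Proof. by elim: w => //= c w ->. Qed.

Let ratio_cat w v : ratio (w ++ v) = ratio w * ratio v.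
Proof. by elim: w => [|c w /= ->]; rewrite ?mul1r ?mulrA. Qed.

Let ratio_gt0 w : 0 < ratio w.
Proof. by elim: w => //= c w IH; rewrite mulr_gt0. Qed.

Let ratio_le1 w : ratio w <= 1.
Proof.
elim: w => //= c w IH; apply: mulr_ile1 => //; [exact/ltW|exact: ltW (ratio_gt0 w)|].
by apply: le_trans (r_le c) _; case/andP: rho01 => _ /ltW.
Qed.

Let word_scales w : scales_by d (ratio w) (word w).
Proof.
elim: w => [|c w IH] x y /=; first by rewrite mul1r.
by rewrite S_scales IH mulrA.
Qed.

Let word_inj w : injective (word w).
Proof. exact: scales_by_inj (ratio_gt0 w) (@word_scales w). Qed.

Let word_compact w (X : set (plane R)) : compact X -> compact (word w @` X).
Proof. exact: (scales_by_compact (ratio_gt0 w) (@word_scales w)). Qed.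

Let wordK w x : K x -> K (word w x).
Proof. by move=> Kx; elim: w => //= c w IH; apply: SK. Qed.

Let zoom_word a b : K a -> K b -> a <> b -> exists w a' b',
  [/\ K a', K b', no_common a' b', a = word w a' & b = word w b'].
Proof.
move=> Ka Kb ab; have rho0 : 0 <= rho < 1 by case/andP: rho01 => /ltW -> ->.
move: a b Ka Kb ab; apply: (zoom_ind r_gt0 r_le rho0 S_scales K_diam).
  move=> c a b Ka Kb [w [a' [b' [? ? ? -> ->]]]].
  by exists (c :: w), a', b'.
by move=> a b Ka Kb no; exists [::], a, b.
Qed.

Let kappa := Num.sqrt rho.

Let kappa2 : kappa * kappa = rho.
Proof. by rewrite -expr2 sqr_sqrtr//; case/andP: rho01 => /ltW. Qed.

Let kappa01 : 0 < kappa < 1.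
Proof.
have [rho0 rho1] := andP rho01; have k0 : 0 < kappa by rewrite sqrtr_gt0.
by rewrite k0 /=; have := kappa2; nra.
Qed.

(* [m] bounds the diameter; by the factor [kappa^-1] in the first
   case, two successive subdivisions shrink it by [kappa ^+ 2 = rho]. *)
Let good (a b : plane R) (X : set (plane R)) (m : R) :=
  (exists w u v, [/\ K u, K v & u <> v] /\
     [/\ a = word w u, b = word w v, X = word w @` K & m = ratio w / kappa]) \/
  (exists w j u v, [/\ cell None u, cell (Some j) v, u <> B j & v <> B j] /\
     [/\ a = word w u, b = word w v, X = word w @` (cell None `|` cell (Some j)) & m = ratio w]).

Let good_cell w c u v : cell c u -> cell c v -> u <> v ->
  good (word w u) (word w v) (word w @` cell c) (ratio w * r c / kappa).
Proof.
move=> [u' Ku' <-] [v' Kv' <-] uv; left; exists (w ++ [:: c]), u', v'; split.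
  by split => // e; apply: uv; rewrite e.
split; rewrite ?word_cat ?ratio_cat//= ?mulr1//.
by rewrite /cell image_comp; apply: eq_imagel => x _ /=; rewrite word_cat.
Qed.

Let good_props a b X m : good a b X m ->
  [/\ compact X, X a, X b, a <> b & forall x y, X x -> X y -> d x y <= m].
Proof.
case=> [[w [u [v [[Ku Kv uv] [-> -> -> ->]]]]]|[w [j [u [v [[u0 vj uB vB] [-> -> -> ->]]]]]]].
  split; [exact: word_compact|by exists u|by exists v|by move/word_inj|].
  move=> _ _ [x Kx <-] [y Ky <-]; rewrite word_scales ler_wpM2l ?(ltW (ratio_gt0 _))//.
  apply: le_trans (K_diam Kx Ky) _; rewrite invf_ge1; have := kappa01; lra.
split.
- by apply: word_compact; apply: compactU.
- by exists u => //; left.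
- by exists v => //; right.
- move/word_inj => e; apply: uB; apply: cell_rest; split; first by rewrite e.
  by exists None.
- move=> _ _ [x Kx <-] [y Ky <-]; rewrite word_scales ler_piMr ?(ltW (ratio_gt0 _))// K_diam//.
    by case: Kx => /cellK.
  by case: Ky => /cellK.
Qed.

(** A segment of the first kind is cut at a junction between the cells that zooming assigns to its
    ends. For ends in two corner cells the cut is at [B i], and the remainder, which crosses the
    centre, is a segment of the second kind, to be cut at [B j]. *)
Let split_good a b X m : good a b X m -> exists c Y Z m1 m2,
  [/\ good a c Y m1, good c b Z m2,
      [/\ Y `<=` X, Z `<=` X & Y `&` Z `<=` [set c]],
      m1 <= kappa * m & m2 <= kappa * m].
Proof.
have k0 : 0 < kappa by case/andP: kappa01.
have bnd w c : ratio w * r c / kappa <= kappa * ratio w.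
  rewrite ler_pdivrMr// mulrAC kappa2 mulrC ler_wpM2r//.
  exact: ltW.
have bnd1 w : ratio w <= kappa * (ratio w / kappa).
  by rewrite mulrC divfK ?gt_eqF.
have bnd2 w : ratio w <= ratio w / kappa.
  rewrite ler_pdivlMr// ler_piMr ?(ltW (ratio_gt0 _))//; by case/andP: kappa01 => _ /ltW.
have bnd' w c : ratio w * r c / kappa <= kappa * (ratio w / kappa).
  by apply: le_trans (bnd w c) _; rewrite ler_pM2l.
have ratio_cat_le w v : ratio (w ++ v) <= ratio w.
  by rewrite ratio_cat ler_piMr ?(ltW (ratio_gt0 _)).
have word_sub w (X1 X2 : set (plane R)) : X1 `<=` X2 -> word w @` X1 `<=` word w @` X2.
  exact: image_subset.
have word_cap w X1 X2 c : X1 `&` X2 `<=` [set c] ->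
    word w @` X1 `&` word w @` X2 `<=` [set word w c].
  by move=> h x [[y X1y <-] [y' X2y' /word_inj yy]]; congr (word w _); apply: h; split => //; rewrite -yy.
have cell0 j : cell None `&` cell (Some j) `<=` [set B j].
  by move=> x [h0 hj]; apply: cell_rest; split => //; exists None.
case=> [[w0 [u0 [v0 [[Ku0 Kv0 uv0] [-> -> -> ->]]]]]|[w [j [u [v [[u0 vj uB vB] [-> -> -> ->]]]]]]].
  have [w1 [u [v [Ku Kv no -> ->]]]] := zoom_word Ku0 Kv0 uv0.
  rewrite -!word_cat; set w := w0 ++ w1.
  have wle : ratio w <= ratio w0 by exact: ratio_cat_le.
  have mw : kappa * (ratio w / kappa) <= kappa * (ratio w0 / kappa).
    by rewrite ler_pM2l// ler_pM2r ?invr_gt0.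
  have wK (X1 : set (plane R)) : X1 `<=` K -> word w @` X1 `<=` word w0 @` K.
    move=> XK _ [x /XK Kx <-]; rewrite /w word_cat; exists (word w1 x) => //; exact: wordK.
  have [[i [ui v0'] [uB vB]]|[[j [u0' vj] [uB vB]]|[i [j [ij ui vj [uB vB uBj vBj]]]]]] :=
    no_common_cases Ku Kv no.
  - exists (word w (B i)), (word w @` cell (Some i)), (word w @` cell None).
    exists (ratio w * r (Some i) / kappa), (ratio w * r None / kappa); split.
    + exact: good_cell.
    + by apply: good_cell => //; apply: nesym.
    + by split; [exact/wK/cellK|exact/wK/cellK|apply: word_cap; rewrite setIC].
    + exact: le_trans mw.
    + exact: le_trans mw.
  - exists (word w (B j)), (word w @` cell None), (word w @` cell (Some j)).
    exists (ratio w * r None / kappa), (ratio w * r (Some j) / kappa); split.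
    + exact: good_cell.
    + by apply: good_cell => //; apply: nesym.
    + by split; [exact/wK/cellK|exact/wK/cellK|apply: word_cap].
    + exact: le_trans mw.
    + exact: le_trans mw.
  - exists (word w (B i)), (word w @` cell (Some i)),
      (word w @` (cell None `|` cell (Some j))).
    exists (ratio w * r (Some i) / kappa), (ratio w); split.
    + exact: good_cell.
    + right; exists w, j, (B i), v; split => //; split => //.
      move=> e; apply: ij; have := @cells_disjoint i j _ _ (CK i) (CK j).
      by rewrite !SC; apply.
    + split; [exact/wK/cellK|apply: wK => x []; exact: cellK|apply: word_cap].
      move=> x [hx hx']; apply: cell_rest; split => //.
      by case: hx' => h; [exists None|exists (Some j) => // -[] /esym].
    + exact: le_trans mw.
    + exact: le_trans mw.
exists (word w (B j)), (word w @` cell None), (word w @` cell (Some j)).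
exists (ratio w * r None / kappa), (ratio w * r (Some j) / kappa); split => //.
+ exact: good_cell.
+ by apply: good_cell => //; apply: nesym.
+ split; [by apply: word_sub => x; left|by apply: word_sub => x; right|].
  exact: word_cap.
Qed.

Lemma dendrite_arc a b : K a -> K b -> a <> b -> exists2 g, is_arc a b g & g `<=` K.
Proof.
move=> Ka Kb ab.
(* The states of the splitting: endpoints, container and size of a good segment. *)
pose St := {x : plane R * plane R * set (plane R) * R | good x.1.1.1 x.1.1.2 x.1.2 x.2}.
have /choice[f fP] : forall x : St, exists yz : St * St,
    [/\ (sval yz.1).1.1.1 = (sval x).1.1.1, (sval yz.2).1.1.2 = (sval x).1.1.2,
        (sval yz.1).1.1.2 = (sval yz.2).1.1.1,
        [/\ (sval yz.1).1.2 `<=` (sval x).1.2, (sval yz.2).1.2 `<=` (sval x).1.2 &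
            (sval yz.1).1.2 `&` (sval yz.2).1.2 `<=` [set (sval yz.1).1.1.2]] &
        (sval yz.1).2 <= kappa * (sval x).2 /\ (sval yz.2).2 <= kappa * (sval x).2].
  move=> [[[[a' b'] X] m] /= g].
  have [c [Y [Z [m1 [m2 [g1 g2 YZ h1 h2]]]]]] := split_good g.
  by exists (exist _ (a', c, Y, m1) g1, exist _ (c, b', Z, m2) g2).
have kap : 0 <= kappa < 1 by case/andP: kappa01 => /ltW -> ->.
have g0 : good a b K (1 / kappa).
  left; exists [::], a, b; split => //; split => //.
  by rewrite (_ : word [::] = id)// image_id.
apply: (@arc_of_splitting R St (fun x => (sval x).1.1.1)
  (fun x => (sval x).1.1.2) (fun x => (sval x).1.2) (fun x => (f x).1) (fun x => (f x).2)
  (fun x => (sval x).2) kappa kap _ _ _ _ _ _ _ _ _ _ _ _ _ (exist _ (a, b, K, 1 / kappa) g0)).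
all: try by case=> x gx; have [] := good_props gx.
all: by move=> x; have [? ? ? [? ? ?] [? ?]] := fP x.
Qed.

End dendrite.

(* [S None] is the map $S_0$ and [S (Some i)] the corner map fixing the vertex
   [A i]; [C i] is the preimage of $B_i = S_0(A_i)$ under this corner map. *)
Record dendrite_system (R : realType) (K : set (plane R))
    (S : option idx -> plane R -> plane R) (r : option idx -> R) (rho : R)
    (A C : idx -> plane R) : Prop := DendriteSystem {
  ds_compact : compact K;
  ds_diam : forall x y, K x -> K y -> euclidean_dist x y <= 1;
  ds_gt0 : forall c, 0 < r c;
  ds_le : forall c, r c <= rho;
  ds_rho : 0 < rho < 1;
  ds_scales : forall c, scales_by (@euclidean_dist R) (r c) (S c);
  ds_stable : forall c x, K x -> K (S c x);
  ds_cover : forall x, K x -> exists c, (S c @` K) x;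
  ds_A : forall i, K (A i);
  ds_C : forall i, K (C i);
  ds_SC : forall i, S (Some i) (C i) = S None (A i);
  ds_disjoint : forall i j x y, K x -> K y -> S (Some i) x = S (Some j) y -> i = j;
  ds_center : forall i x y, K x -> K y -> S None x = S (Some i) y -> x = A i }.

Lemma ds_rho_ge0 (R : realType) K S r (rho : R) A C :
  dendrite_system K S r rho A C -> 0 <= rho < 1.
Proof. by move/ds_rho/andP => [/ltW -> ->]. Qed.

(** * Unique arcs in a dendrite *)

Section arc_in_dendrite.
Context (R : realType) (K : set (plane R)) (S : option idx -> plane R -> plane R)
  (r : option idx -> R) (rho : R) (A C : idx -> plane R).
Hypothesis sys : dendrite_system K S r rho A C.
Local Notation d := (@euclidean_dist R).
Implicit Types (a b x y z : plane R) (X : set (plane R)).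

(** No arc has equal endpoints, so [xget] returns its default. *)
Lemma arc_inxx a : arc_in K a a = [set a].
Proof.
rewrite /arc_in; case: xgetP => // g _ [/is_arc_neq].
by move=> /(_ erefl).
Qed.

Lemma arc_inP a b : K a -> K b -> a <> b ->
  is_arc a b (arc_in K a b) /\ arc_in K a b `<=` K.
Proof.
case: sys => ? ? ? ? ? ? ? ? ? ? ? ? ? Ka Kb ab.
have [g ag gK] : exists2 g, is_arc a b g & g `<=` K by apply: (@dendrite_arc R K S r rho A C).
by have := @xgetPex _ [set a] [set g | is_arc a b g /\ g `<=` K] (ex_intro _ g (conj ag gK)).
Qed.

Lemma arc_in_props a b : K a -> K b ->
  [/\ compact (arc_in K a b), connected (arc_in K a b), arc_in K a b `<=` K,
      arc_in K a b a & arc_in K a b b].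
Proof.
move=> Ka Kb; have [<-|ab] := pselect (a = b).
  rewrite arc_inxx; split => //; [exact: compact_set1|exact: connected1|by move=> _ ->].
have [h hK] := arc_inP Ka Kb ab; split => //.
- exact: is_arc_compact h.
- exact: is_arc_connected h.
- exact: is_arc_left h.
- exact: is_arc_right h.
Qed.

Lemma arc_in_sub a b : K a -> K b -> arc_in K a b `<=` K.
Proof. by move=> Ka Kb; case: (arc_in_props Ka Kb). Qed.

Lemma arc_in_compact a b : K a -> K b -> compact (arc_in K a b).
Proof. by move=> Ka Kb; case: (arc_in_props Ka Kb). Qed.

Lemma arc_in_closed a b : K a -> K b -> closed (arc_in K a b).
Proof.
move=> Ka Kb; apply: compact_closed; [exact: plane_hausdorff|exact: arc_in_compact].
Qed.

Lemma arc_in_connected a b : K a -> K b -> connected (arc_in K a b).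
Proof. by move=> Ka Kb; case: (arc_in_props Ka Kb). Qed.

Lemma arc_in_left a b : K a -> K b -> arc_in K a b a.
Proof. by move=> Ka Kb; case: (arc_in_props Ka Kb). Qed.

Lemma arc_in_right a b : K a -> K b -> arc_in K a b b.
Proof. by move=> Ka Kb; case: (arc_in_props Ka Kb). Qed.

Lemma is_arc_min a b g X : is_arc a b g -> g `<=` K ->
  connected X -> closed X -> X `<=` K -> X a -> X b -> g `<=` X.
Proof.
case: sys => ? ? ? ? ? ? ? ? ? ? ? ? ? ag gK cX clX XK Xa Xb.
by apply: (arc_min _ ag gK cX) => // u v Ku Kv uv; apply: (@dendrite_separated R K S r rho A C).
Qed.

(** This minimality replaces uniqueness of arcs: symmetry, splitting and scaling of [arc_in] are
    inclusions obtained from it. *)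
Lemma arc_in_min a b X : K a -> K b -> connected X -> closed X -> X `<=` K ->
  X a -> X b -> arc_in K a b `<=` X.
Proof.
move=> Ka Kb cX clX XK Xa Xb; have [<-|ab] := pselect (a = b).
  by rewrite arc_inxx => _ ->.
by have [h hK] := arc_inP Ka Kb ab; apply: (is_arc_min h hK).
Qed.

Lemma arc_in_sub_arc_in a b x y : K a -> K b -> arc_in K a b x -> arc_in K a b y ->
  arc_in K x y `<=` arc_in K a b.
Proof.
move=> Ka Kb hx hy; have h := arc_in_sub Ka Kb.
apply: arc_in_min => //; [exact: h|exact: h|exact: arc_in_connected|exact: arc_in_closed].
Qed.

Lemma arc_inC a b : K a -> K b -> arc_in K a b = arc_in K b a.
Proof.
by move=> Ka Kb; apply/seteqP; split; apply: arc_in_sub_arc_in => //;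
  (exact: arc_in_left || exact: arc_in_right).
Qed.

Lemma arc_in_tri a b (c : plane R) : K a -> K b -> K c ->
  arc_in K a b `<=` arc_in K a c `|` arc_in K c b.
Proof.
move=> Ka Kb Kc; apply: arc_in_min => //.
- apply: connectedU; [|exact: arc_in_connected|exact: arc_in_connected].
  by exists c; split; [exact: arc_in_right|exact: arc_in_left].
- by apply: closedU; apply: arc_in_closed.
- by move=> x []; apply: arc_in_sub.
- by left; apply: arc_in_left.
- by right; apply: arc_in_right.
Qed.

Lemma arc_in_split a b z : K a -> K b -> arc_in K a b z ->
  arc_in K a b = arc_in K a z `|` arc_in K z b.
Proof.
move=> Ka Kb hz; have Kz := arc_in_sub Ka Kb hz.
apply/seteqP; split; first exact: arc_in_tri.
have ha := arc_in_left Ka Kb; have hb := arc_in_right Ka Kb.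
by move=> x [|]; apply: arc_in_sub_arc_in.
Qed.

(** By minimality the two subarcs lie in the images of the parameter intervals before and after [t],
    and injectivity leaves the common parameter [t] only. *)
Lemma arc_in_splitI a b z : K a -> K b -> arc_in K a b z ->
  arc_in K a z `&` arc_in K z b `<=` [set z].
Proof.
move=> Ka Kb hz; have Kz := arc_in_sub Ka Kb hz.
have [ab|ab] := pselect (a = b).
  move: hz; rewrite -ab arc_inxx => ->; rewrite arc_inxx.
  by move=> x [].
have [[f [fc fi f0 f1 fE]] fK] := arc_inP Ka Kb ab.
have [t tI ft] : exists2 t, t \in `[0, 1] & f t = z.
  by move: hz; rewrite fE => -[t tI <-]; exists t.
have t01 : 0 <= t <= 1 by move: tI; rewrite in_itv.
have sub01 t1 t2 : 0 <= t1 -> t2 <= 1 -> `[t1, t2] `<=` (`[0, 1] : set R).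
  by move=> h1 h2 x; rewrite /= !in_itv/= => /andP[? ?]; apply/andP; split; lra.
have piece t1 t2 : 0 <= t1 -> t1 <= t2 -> t2 <= 1 ->
    arc_in K (f t1) (f t2) `<=` f @` `[t1, t2].
  move=> h0 h12 h1; have fcI := continuous_subspaceW (sub01 _ _ h0 h1) fc.
  have subK : f @` `[t1, t2] `<=` K.
    by move=> _ [x /(sub01 _ _ h0 h1) xI <-]; apply: fK; rewrite fE; exists x.
  have f1I : (f @` `[t1, t2]) (f t1) by exists t1; rewrite //= in_itv/= lexx.
  have f2I : (f @` `[t1, t2]) (f t2) by exists t2; rewrite //= in_itv/= lexx h12.
  apply: arc_in_min => //; [exact: subK|exact: subK| |].
  - by apply: connected_continuous_connected => //; apply: segment_connected.
  - apply: compact_closed; first exact: plane_hausdorff.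
    by apply: continuous_compact => //; apply: segment_compact.
rewrite -f0 -f1 -ft => x [].
move=> /(piece 0 t (lexx _) (proj1 (andP t01)) (proj2 (andP t01)))[u uI <-].
move=> /(piece t 1 (proj1 (andP t01)) (proj2 (andP t01)) (lexx _))[v vI].
move: uI vI; rewrite /= !in_itv/= => uI vI /fi e.
suff -> : u = t by [].
have := e _ _; rewrite !in_itv/= => {}e.
have vu : v = u by apply: e; apply/andP; split; lra.
by apply/eqP; rewrite eq_le; apply/andP; split; lra.
Qed.

Lemma arc_in_scale (c : option idx) a b : K a -> K b ->
  arc_in K (S c a) (S c b) = S c @` arc_in K a b.
Proof.
move=> Ka Kb; have SK := ds_stable sys; have inj := scales_by_inj (ds_gt0 sys c) (ds_scales sys c).
have [<-|ab] := pselect (a = b); first by rewrite !arc_inxx image_set1.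
have [h hK] := arc_inP Ka Kb ab.
have h' : is_arc (S c a) (S c b) (S c @` arc_in K a b).
  apply: is_arc_image => //; exact: scales_by_continuous (ds_gt0 sys c) (ds_scales sys c).
have hK' : S c @` arc_in K a b `<=` K by move=> _ [x /hK Kx <-]; apply: SK.
apply/seteqP; split.
  apply: arc_in_min => //; [exact: SK|exact: SK|exact: is_arc_connected h'|exact: is_arc_closed h'| |].
  - by exists a => //; exact: arc_in_left.
  - by exists b => //; exact: arc_in_right.
have SKa := SK c a Ka; have SKb := SK c b Kb.
by apply: (is_arc_min h' hK'); [exact: arc_in_connected|exact: arc_in_closed|
  exact: arc_in_sub|exact: arc_in_left|exact: arc_in_right].
Qed.

(** The arc leaves the cell of [i], so by connectedness it contains a point common to this cell and
    the union of the others, and the junction is the only such point. *)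
Lemma arc_in_junction i a b : K a -> K b -> ~ (S (Some i) @` K) b ->
  arc_in K (S (Some i) a) b (S None (A i)).
Proof.
case: sys => cK dK r0 rl rho01 Ssc SK Kcov AK CK SC disj cent Ka Kb bi.
have cellc c : closed (S c @` K).
  apply: compact_closed; first exact: plane_hausdorff.
  exact: (scales_by_compact (r0 c) (Ssc c)).
pose rest := \bigcup_(c in [set c | c <> Some i]) (S c @` K).
have restE : rest = (S None @` K) `|` ((if pselect (i = i1) then set0 else S (Some i1) @` K)
  `|` ((if pselect (i = i2) then set0 else S (Some i2) @` K)
  `|` (if pselect (i = i3) then set0 else S (Some i3) @` K))).
  apply/seteqP; split => x.
    move=> [[[]|] /= ni cx]; [right; left|right; right; left|right; right; right|by left];
      by case: pselect => // ii; case: ni; rewrite ii.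
  case=> [h|]; first by exists None.
  case=> [|[|]]; case: pselect => // ii h;
    [exists (Some i1)|exists (Some i2)|exists (Some i3)] => //=; by case=> /esym.
have crest : closed rest.
  have one (p : Prop) (X : set (plane R)) : closed X ->
      closed (if pselect p then set0 else X).
    by move=> cX; case: pselect => // ?; exact: closed0.
  by rewrite restE; do 3?[apply: closedU => //]; apply: one.
have SKa := SK (Some i) a Ka.
have [x [hx [[y Ky yx] [[k|] /= ni [y' Ky' yx']]]]] : arc_in K (S (Some i) a) b `&`
    (S (Some i) @` K `&` rest) !=set0.
  apply: connected_meet => //; first exact: arc_in_connected.
  - move=> x /(arc_in_sub SKa Kb)/Kcov[c cx].
    have [ci|ci] := pselect (c = Some i); first by left; rewrite -ci.
    by right; exists c.
  - by exists (S (Some i) a); split; [exact: arc_in_left|exists a].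
  - exists b; split; first exact: arc_in_right.
    have [c cb] := Kcov b Kb; exists c => //= ci; apply: bi.
    by rewrite -ci.
  by case: ni; rewrite (disj _ _ _ _ Ky' Ky (etrans yx' (esym yx))).
by rewrite -(cent _ _ _ Ky' Ky (etrans yx' (esym yx))) yx'.
Qed.

End arc_in_dendrite.

(** * Arcs between points of the attractor of the corner maps *)

Definition next_idx (i : idx) : idx :=
  match i with i1 => i2 | i2 => i3 | i3 => i1 end.

(* [Q] stands for the attractor of the three corner maps, [O] for the fixed
   point of $S_0$. *)
Record arc_system (R : realType) (K Q : set (plane R))
    (S : option idx -> plane R -> plane R) (r : option idx -> R) (rho eps : R)
    (A C : idx -> plane R) (O : plane R) : Prop := ArcSystem {
  as_ds :> dendrite_system K S r rho A C;
  as_QK : Q `<=` K;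
  as_QS : forall i x, Q x -> Q (S (Some i) x);
  as_Qcover : forall x, Q x -> exists i, (S (Some i) @` Q) x;
  as_QA : forall i, Q (A i);
  as_QC : forall i, Q (C i);
  as_Afix : forall i, S (Some i) (A i) = A i;
  as_Cnext : forall i, (S (Some (next_idx i)) @` Q) (C i);
  as_A_center : forall i x, K x -> S None x <> A i;
  as_sum : r (Some i1) + r (Some i2) + r (Some i3) < 1;
  as_eps : 0 < eps;
  as_gap : forall i j x y, i <> j -> K x -> K y ->
    eps <= euclidean_dist (S (Some i) x) (S (Some j) y);
  as_KO : K O;
  as_O : S None O = O }.

Section copies.
Context (R : realType).
Implicit Types (X Y Z : set (plane R)) (c : R).

(** [c] is a lower bound for the ratio, so that one constant can serve several pairs of sets. *)
Definition has_copy c X Y := exists g sigma,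
  [/\ 0 < sigma, c <= sigma, scales_by (@euclidean_dist R) sigma g & g @` Y `<=` X].

Lemma has_copy_trans c c' X Y Z : 0 <= c -> 0 <= c' ->
  has_copy c X Y -> has_copy c' Y Z -> has_copy (c * c') X Z.
Proof.
move=> c0 c'0 [g [s [s0 cs gs gX]]] [g' [s' [s'0 cs' gs' gY]]].
exists (g \o g'), (s * s'); split.
- exact: mulr_gt0.
- exact: ler_pM.
- by move=> x y /=; rewrite gs gs' mulrA.
- by move=> _ [z Zz <-]; apply: gX; exists (g' z) => //; apply: gY; exists z.
Qed.

Lemma has_copy_le c c' X Y : c' <= c -> has_copy c X Y -> has_copy c' X Y.
Proof. by move=> cc [g [s [s0 cs gs gX]]]; exists g, s; split => //; exact: le_trans cs. Qed.

Lemma idx_lower_bound (P : idx -> R -> Prop) :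
  (forall i c c', c' <= c -> P i c -> P i c') ->
  (forall i, exists2 c, 0 < c & P i c) -> exists2 c, 0 < c & forall i, P i c.
Proof.
move=> Ple h; have [[c1 c10 h1] [c2 c20 h2] [c3 c30 h3]] := And3 (h i1) (h i2) (h i3).
exists (Num.min c1 (Num.min c2 c3)); first by rewrite !lt_min c10 c20.
case; [apply: Ple h1|apply: Ple h2|apply: Ple h3]; by rewrite !ge_min lexx ?orbT.
Qed.

End copies.

Section arcs_of_system.
Context (R : realType) (K Q : set (plane R)) (S : option idx -> plane R -> plane R)
  (r : option idx -> R) (rho eps : R) (A C : idx -> plane R) (O : plane R).
Hypothesis sys : arc_system K Q S r rho eps A C O.
Local Notation d := (@euclidean_dist R).
Local Notation gam := (arc_in K).
Local Notation Sc i := (S (Some i)).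
Local Notation S0 := (S None).
Implicit Types (a b x y z u v : plane R) (i j k l : idx).

Lemma next_idx_neq i : next_idx i <> i. Proof. by case: i. Qed.

Lemma as_KS c x : K x -> K (S c x). Proof. exact: (ds_stable sys). Qed.

Lemma as_S_inj c : injective (S c).
Proof. exact: scales_by_inj (ds_gt0 sys c) (ds_scales sys c). Qed.

Lemma cell_notin_cell i j x : i <> j -> K x -> ~ (Sc j @` K) (Sc i x).
Proof. by move=> ij Kx [y Ky e]; apply: ij; apply: (ds_disjoint sys Kx Ky). Qed.

Lemma C_notin_cell i : ~ (Sc i @` K) (C i).
Proof.
have [y /(as_QK sys) Ky <-] := as_Cnext sys i.
by apply: cell_notin_cell => //; apply: next_idx_neq.
Qed.

Lemma B_notin_cell i j : i <> j -> ~ (Sc j @` K) (S0 (A i)).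
Proof. by move=> ij; rewrite -(ds_SC sys i); apply: cell_notin_cell => //; apply: (ds_C sys). Qed.

Lemma arc_junctions i j a b : i <> j -> K a -> K b ->
  gam (Sc i a) (Sc j b) (S0 (A i)) /\ gam (Sc i a) (Sc j b) (S0 (A j)).
Proof.
move=> ij Ka Kb; have Ka' := as_KS (Some i) Ka; have Kb' := as_KS (Some j) Kb.
split; first by apply: (arc_in_junction sys) => //; apply: cell_notin_cell => //; apply: nesym.
rewrite (arc_inC sys)//; apply: (arc_in_junction sys) => //.
exact: cell_notin_cell.
Qed.

Lemma arc_decompose i j a b : i <> j -> K a -> K b ->
  gam (Sc i a) (Sc j b) =
  Sc i @` gam a (C i) `|` (S0 @` gam (A i) (A j) `|` Sc j @` gam (C j) b).
Proof.
move=> ij Ka Kb; have [hi hj] := arc_junctions ij Ka Kb.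
have KA k := ds_A sys k; have KC k := ds_C sys k.
have Ka' := as_KS (Some i) Ka; have Kb' := as_KS (Some j) Kb.
have KBi := as_KS None (KA i); have KBj := as_KS None (KA j).
rewrite (arc_in_split sys Ka' Kb' hi) -{1}(ds_SC sys i) (arc_in_scale sys)//.
congr (_ `|` _).
have h : gam (S0 (A i)) (Sc j b) (S0 (A j)).
  rewrite (arc_inC sys)//; apply: (arc_in_junction sys) => //.
  exact: B_notin_cell.
rewrite (arc_in_split sys KBi Kb' h) (arc_in_scale sys)//.
by rewrite -{1}(ds_SC sys j) (arc_in_scale sys).
Qed.

Lemma arc_decompose_A i j : i <> j ->
  gam (A i) (A j) =
  Sc i @` gam (A i) (C i) `|` (S0 @` gam (A i) (A j) `|` Sc j @` gam (C j) (A j)).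
Proof.
move=> ij; rewrite -{1}(as_Afix sys i) -{1}(as_Afix sys j).
by apply: arc_decompose => //; apply: (ds_A sys).
Qed.

(** [C i] lies in the cell of the next vertex, so this arc crosses the centre and contains a copy of
    the arc between [A i] and [A (next_idx i)]. *)
Lemma arc_decompose_AC i : exists2 y, K y & gam (A i) (C i) =
  Sc i @` gam (A i) (C i) `|`
    (S0 @` gam (A i) (A (next_idx i)) `|` Sc (next_idx i) @` gam (C (next_idx i)) y).
Proof.
have [y /(as_QK sys) Ky yC] := as_Cnext sys i; exists y => //.
rewrite -{1}(as_Afix sys i) -{1}yC.
by apply: arc_decompose => //; [exact: nesym (@next_idx_neq i)|exact: (ds_A sys)].
Qed.

(** The arc between two vertices contains its image under [S0], hence all iterates of [A i], which
    converge to [O]. An arc between two corner cells contains the image of such an arc under [S0],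
    and [S0] fixes [O]. *)
Lemma arc_through_O i j a b : i <> j -> K a -> K b -> gam (Sc i a) (Sc j b) O.
Proof.
move=> ij Ka Kb; have KA k := ds_A sys k.
have AA : gam (A i) (A j) O.
  have hn n : gam (A i) (A j) (iter n S0 (A i)).
    elim: n => [|n IH] /=; first exact: (arc_in_left sys).
    by rewrite arc_decompose_A//; right; left; exists (iter n S0 (A i)).
  apply: closed_euclidean; first exact: (arc_in_closed sys).
  move=> e e0.
  have rho01 := ds_rho_ge0 sys.
  have [N /(_ N (leqnn N)) hN] := expr_lt_eventually rho01 e0.
  exists (iter N S0 (A i)) => //; apply: le_lt_trans hN.
  elim: N => [|n IH] /=; first by rewrite expr0 (ds_diam sys)//; exact: (as_KO sys).
  rewrite -{1}(as_O sys) (ds_scales sys) exprS.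
  by apply: ler_pM => //; [exact: ltW (ds_gt0 sys _)|exact: euclidean_dist_ge0|exact: (ds_le sys)].
by rewrite arc_decompose//; right; left; exists O => //; apply: (as_O sys).
Qed.

(** Inside the cell of [i] the arc from [A i] runs to the preimage [C i] of the junction, and this
    piece turns towards the next vertex whatever [j] is. Following the cyclic order, every side arc
    contains copies of the others. *)
Lemma has_copy_next i j : i <> j ->
  exists2 c, 0 < c & has_copy c (gam (A i) (A j)) (gam (A i) (A (next_idx i))).
Proof.
move=> ij; exists (r (Some i) * r None); first by rewrite mulr_gt0// (ds_gt0 sys).
exists (Sc i \o S0), (r (Some i) * r None); split.
- by rewrite mulr_gt0// (ds_gt0 sys).
- exact: lexx.
- by move=> x y /=; rewrite !(ds_scales sys) mulrA.
- move=> _ [x hx <-] /=; rewrite arc_decompose_A//; left; exists (S0 x) => //.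
  by have [y Ky ->] := arc_decompose_AC i; right; left; exists x.
Qed.

Lemma has_copy_next2 i :
  exists2 c, 0 < c & has_copy c (gam (A i) (A (next_idx i)))
    (gam (A (next_idx i)) (A (next_idx (next_idx i)))).
Proof.
have [c c0 h] := @has_copy_next (next_idx i) i (@next_idx_neq i).
have KA k := ds_A sys k.
by exists c => //; rewrite (arc_inC sys (KA i) (KA _)).
Qed.

Lemma has_copy_trans_ex X Y Z : (exists2 c : R, 0 < c & has_copy c X Y) ->
  (exists2 c : R, 0 < c & has_copy c Y Z) -> exists2 c : R, 0 < c & has_copy c X Z.
Proof.
move=> [c c0 h] [c' c'0 h']; exists (c * c'); first exact: mulr_gt0.
by apply: has_copy_trans h h'; exact: ltW.
Qed.

Lemma has_copy_from_side i j : i <> j ->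
  exists2 c, 0 < c & has_copy c (gam (A i) (A j)) (gam (A i1) (A i2)).
Proof.
move=> /has_copy_next h; apply: has_copy_trans_ex h _.
have refl X : exists2 c : R, 0 < c & has_copy c X X.
  exists 1 => //; exists id, 1; split => //; first by move=> x y; rewrite mul1r.
  by move=> _ [x Xx <-].
case: i {j} => /=; first exact: refl.
  by apply: has_copy_trans_ex (has_copy_next2 i2) _; exact: (has_copy_next2 i3).
exact: (has_copy_next2 i3).
Qed.

Lemma has_copy_of_side i j : i <> j ->
  exists2 c, 0 < c & has_copy c (gam (A i1) (A i2)) (gam (A i) (A j)).
Proof.
have KA k := ds_A sys k.
have h12 : exists2 c, 0 < c & has_copy c (gam (A i1) (A i2)) (gam (A i1) (A i2)).
  exact: has_copy_from_side.
have h23 := has_copy_next2 i1.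
have h31 := has_copy_trans_ex h23 (has_copy_next2 i2).
have sw k l := arc_inC sys (KA k) (KA l).
case: i; case: j => ij; try by case: ij.
- exact: h12.
- by rewrite (sw i1 i3); exact: h31.
- by rewrite (sw i2 i1); exact: h12.
- exact: h23.
- exact: h31.
- by rewrite (sw i3 i2); exact: h23.
Qed.

Lemma has_copy_from_side_uniform :
  exists2 c, 0 < c & forall i j, i <> j -> has_copy c (gam (A i) (A j)) (gam (A i1) (A i2)).
Proof.
apply: (@idx_lower_bound R (fun i c => forall j, i <> j ->
  has_copy c (gam (A i) (A j)) (gam (A i1) (A i2)))).
  by move=> i c c' cc h j ij; apply: has_copy_le cc (h j ij).
move=> i; apply: (@idx_lower_bound R (fun j c => i <> j ->
  has_copy c (gam (A i) (A j)) (gam (A i1) (A i2)))).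
  by move=> j c c' cc h ij; apply: has_copy_le cc (h ij).
move=> j; have [ij|ij] := pselect (i = j); first by exists 1.
by have [c c0 h] := has_copy_from_side ij; exists c.
Qed.

Lemma ratio_lower_bound : exists2 p : R, 0 < p <= 1 & forall c, p <= r c.
Proof.
have [p p0 hp] := @idx_lower_bound R (fun i c => c <= r (Some i))
  (fun i c c' => @le_trans _ _ c c' (r (Some i))) (fun i => ex_intro2 _ _ (r (Some i)) (ds_gt0 sys _) (lexx _)).
exists (Num.min p (r None)).
  rewrite lt_min p0 (ds_gt0 sys) /= ge_min (le_trans (ds_le sys None)) ?orbT//.
  by case/andP: (ds_rho sys) => _ /ltW.
by case=> [i|]; rewrite ge_min ?hp// lexx orbT.
Qed.

(** [f] is a composition of corner maps, onto a cell in which [a] and [b] first fall into different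
    subcells. *)
Lemma zoom_arc a b : Q a -> Q b -> a <> b -> exists f lambda i j u v,
  [/\ [/\ 0 < lambda <= 1, scales_by d lambda f, forall x, K x -> K (f x) &
          forall x y, K x -> K y -> gam (f x) (f y) = f @` gam x y],
      i <> j, Q u, Q v & a = f (Sc i u) /\ b = f (Sc j v)].
Proof.
have rho0 := ds_rho_ge0 sys.
have dQ x y : Q x -> Q y -> d x y <= 1 by move=> Qx Qy; apply: (ds_diam sys); apply: (as_QK sys).
move: a b; apply: (@zoom_ind R idx (fun i => Sc i) (fun i => r (Some i)) rho Q
  (fun i => ds_gt0 sys _) (fun i => ds_le sys _) rho0 (fun i => ds_scales sys _) dQ).
  move=> i a b Qa Qb [f [lam [k [l [u [v [[/andP[l0 l1] fs fK fg] kl Qu Qv [-> ->]]]]]]]].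
  exists (Sc i \o f), (r (Some i) * lam), k, l, u, v; split => //; split.
  - rewrite mulr_gt0 ?(ds_gt0 sys)//= mulr_ile1//; [exact: ltW (ds_gt0 sys _)|exact: ltW|].
    by apply: le_trans (ds_le sys _) _; case/andP: rho0 => _ /ltW.
  - by move=> x y /=; rewrite (ds_scales sys) fs mulrA.
  - by move=> x Kx; apply: as_KS; apply: fK.
  - move=> x y Kx Ky /=; rewrite (arc_in_scale sys); [|exact: fK|exact: fK].
    by rewrite fg// image_comp.
move=> a b Qa Qb no.
have [i [u Qu ua]] := as_Qcover sys Qa; have [j [v Qv vb]] := as_Qcover sys Qb.
exists id, 1, i, j, u, v; split => //.
- rewrite lexx ltr01; split => //; first by move=> x y; rewrite mul1r.
  by move=> x y _ _; rewrite image_id.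
- move=> ij; apply: (no i); split; first by exists u.
  by rewrite ij; exists v.
Qed.

(** The copied arc may join any two vertices; [has_copy_from_side_uniform] reduces to a single pair
    at the end. *)
Definition copy_near (alpha : R) a b x (h : R) := exists k l g sigma,
  [/\ k <> l, 0 < sigma, alpha * h <= sigma, scales_by d sigma g &
    g @` gam (A k) (A l) `<=` gam a b `&` [set y | d x y <= h]].

Lemma copy_near_scale (alpha lambda h : R) f a b a' b' x : 0 < lambda ->
  scales_by d lambda f -> f @` gam a b `<=` gam a' b' ->
  copy_near alpha a b x (h / lambda) -> copy_near alpha a' b' (f x) h.
Proof.
move=> l0 fs fg [k [l [g [t [kl t0 ht gs gX]]]]].
exists k, l, (f \o g), (lambda * t); split => //.
- exact: mulr_gt0.
- rewrite -(ler_pM2l l0) in ht; apply: le_trans ht.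
  by rewrite [leRHS]mulrCA [X in _ <= alpha * X]mulrC divfK// gt_eqF.
- by move=> y y' /=; rewrite fs gs mulrA.
- move=> _ [y hy <-] /=; have [gy1 gy2] := gX _ (imageP g hy).
  split; first by apply: fg; exists (g y).
  by rewrite /= fs mulrC -ler_pdivlMr.
Qed.

(** Powers of the map fixing [A i] carry a copy of a side arc towards [A i]. The least power of size
    at most [h] costs one factor [p], and the map [S0] the other. *)
Lemma copy_near_vertex (p : R) i j (h : R) : 0 < p <= 1 -> (forall c, p <= r c) ->
  i <> j -> 0 < h <= 1 -> copy_near (p * p) (A i) (A j) (A i) h.
Proof.
move=> /andP[p0 p1] pr ij /andP[h0 h1].
pose q := r (Some i).
have q0 : 0 < q := ds_gt0 sys _.
have q01 : 0 <= q < 1.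
  by rewrite ltW//=; apply: le_lt_trans (ds_le sys _) _; case/andP: (ds_rho sys).
have exk : exists k : nat, q ^+ k.+1 <= h.
  have [N /(_ N.+1 (leqnSn N)) hN] := expr_lt_eventually q01 h0.
  by exists N; exact: ltW.
have [k hk kmin] := ex_minnP exk.
have qk : q * h <= q ^+ k.+1.
  case: k hk kmin => [|k] hk kmin; first by rewrite expr1 ler_piMr// ltW.
  rewrite exprS ler_pM2l// leNgt; apply/negP => /ltW/kmin.
  by rewrite ltnn.
exists i, (next_idx i), (iter k.+1 (Sc i) \o S0), (q ^+ k.+1 * r None).
have it_s n : scales_by d (q ^+ n) (iter n (Sc i)).
  elim: n => [|n IH] x y /=; first by rewrite expr0 mul1r.
  by rewrite (ds_scales sys) IH exprS mulrA.
split.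
- exact: nesym (@next_idx_neq i).
- by rewrite mulr_gt0 ?exprn_gt0// (ds_gt0 sys).
- have := pr (Some i); have := pr None; rewrite -/q => pr0 prq.
  have : p * p * h <= q * r None * h by rewrite ler_wpM2r ?(ltW h0)// ler_pM ?(ltW p0).
  by move=> /le_trans; apply; rewrite mulrAC ler_wpM2r// (ltW (ds_gt0 sys _)).
- by move=> x y /=; rewrite (ds_scales sys) it_s (ds_scales sys) exprS !mulrA.
- move=> _ [x hx <-].
  have KA n := ds_A sys n.
  have Kx := arc_in_sub sys (KA _) (KA _) hx.
  have AC n : gam (A i) (C i) (iter n (Sc i) (S0 x)).
    elim: n => [|n IH] /=.
      by have [y Ky ->] := arc_decompose_AC i; right; left; exists x.
    by have [y Ky ->] := arc_decompose_AC i; left; exists (iter n (Sc i) (S0 x)).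
  split; first by rewrite arc_decompose_A//; left; exists (iter k (Sc i) (S0 x)).
  have iA n : iter n (Sc i) (A i) = A i by elim: n => //= n ->; apply: (as_Afix sys).
  rewrite /= -{1}(iA k.+1) it_s; apply: le_trans hk.
  rewrite ler_piMr ?exprn_ge0 ?(ltW q0)// (ds_diam sys)//.
  exact: as_KS.
Qed.

(* A ball centred on an arc either is small compared with the subarc of the
   decomposition [arc_decompose] containing its centre, and induction applies,
   or it reaches the middle subarc near a vertex. *)
Lemma copy_near_arc (p : R) : 0 < p <= 1 -> (forall c, p <= r c) ->
  forall n i j a b x (h : R), i <> j -> Q a -> Q b -> gam (Sc i a) (Sc j b) x ->
  2 * rho ^+ n < h -> h <= 2 -> copy_near (p * p * p / 2) (Sc i a) (Sc j b) x h.
Proof.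
move=> p01 pr; have /andP[p0 p1] := p01.
have KA k := ds_A sys k; have KC k := ds_C sys k; have QK := as_QK sys.
have rho0 : 0 < rho by case/andP: (ds_rho sys).
(* [copy_near_vertex] gives [p * p], transport by [S0] to a junction the third [p], and the half
   comes from the radius [h / 2] around that junction. *)
pose alpha := p * p * p / 2.
have pp : p * p <= p by rewrite ler_piMr// ltW.
have ppp : p * p * p <= p by apply: le_trans pp; rewrite ler_piMr// mulr_ge0// ltW.
elim=> [|n IH] i j a b x h ij Qa Qb hx h0 h2; first by rewrite expr0 in h0; lra.
have h_gt0 : 0 < h by apply: le_lt_trans h0; rewrite mulr_ge0// exprn_ge0 ?ltW.
have rest (m : R) : 0 < m -> m <= rho -> 2 * rho ^+ n < h / m.
  move=> m0 mr; rewrite ltr_pdivlMr//; apply: le_lt_trans h0.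
  by rewrite exprSr mulrA ler_wpM2l// mulr_ge0// exprn_ge0// ltW.
have Kab i' j' a' b' : i' <> j' -> Q a' -> Q b' ->
    S0 @` gam (A i') (A j') `<=` gam (Sc i' a') (Sc j' b').
  by move=> ij' /QK Ka /QK Kb y hy; rewrite arc_decompose//; right; left.
have side i' j' a' b' x' : i' <> j' -> Q a' -> Q b' -> (Sc i' @` gam a' (C i')) x' ->
    copy_near alpha (Sc i' a') (Sc j' b') x' h.
  move=> ij' Qa' Qb' [z hz zx].
  have near : d x' (S0 (A i')) <= h / 2 -> copy_near alpha (Sc i' a') (Sc j' b') x' h.
    move=> hd.
    have h21 : 0 < h / 2 <= 1 by rewrite divr_gt0//= ler_pdivrMr// mul1r.
    have [k [l [g [s [kl s0 hs gs gX]]]]] := copy_near_vertex p01 pr ij' h21.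
    exists k, l, (S0 \o g), (r None * s); split => //.
    - by rewrite mulr_gt0// (ds_gt0 sys).
    - have -> : alpha * h = p * (p * p * (h / 2)) by rewrite /alpha; field.
      by apply: ler_pM => //; rewrite ?mulr_ge0 ?invr_ge0 ?(ltW p0) ?(ltW h_gt0).
    - by move=> y y' /=; rewrite (ds_scales sys) gs mulrA.
    - move=> _ [y hy <-] /=.
      have [gy1 gy2] : (gam (A i') (A j') `&` [set y | d (A i') y <= h / 2]) (g y).
        by apply: gX; exists y.
      split; first by apply: Kab => //; exists (g y).
      apply: le_trans (euclidean_dist_tri x' (S0 (A i')) (S0 (g y))) _.
      rewrite (ds_scales sys) (splitr h) lerD//.
      apply: le_trans gy2; rewrite ler_piMl ?euclidean_dist_ge0//.
      by apply: le_trans (ds_le sys _) _; case/andP: (ds_rho sys) => _ /ltW.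
  have [aC|aC] := pselect (a' = C i').
    apply: near; rewrite -(ds_SC sys) -zx.
    by move: hz; rewrite aC arc_inxx => ->; rewrite euclidean_distxx divr_ge0// ltW.
  have [f [lam [k [l [u [v [[/andP[l0 l1] fs fK fg] kl Qu Qv [au Cv]]]]]]]] :=
    zoom_arc Qa' (as_QC sys i') aC.
  have Kku := as_KS (Some k) (QK _ Qu); have Klv := as_KS (Some l) (QK _ Qv).
  have [w hw wz] : (f @` gam (Sc k u) (Sc l v)) z by rewrite -fg// -au -Cv.
  have ri0 : 0 < r (Some i') := ds_gt0 sys _.
  have lr0 : 0 < r (Some i') * lam by rewrite mulr_gt0.
  have [hbig|hsmall] := ltP (2 * (r (Some i') * lam)) h.
    apply: near; rewrite -zx -wz -(ds_SC sys) Cv (ds_scales sys) fs mulrA.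
    have : r (Some i') * lam * d w (Sc l v) <= r (Some i') * lam.
      rewrite ler_piMr ?(ltW lr0)// (ds_diam sys)//.
      by apply: (arc_in_sub sys) hw.
    lra.
  rewrite -zx -wz; apply: (@copy_near_scale alpha (r (Some i') * lam) h (Sc i' \o f) (Sc k u) (Sc l v)) => //.
  - by move=> y y' /=; rewrite (ds_scales sys) fs mulrA.
  - move=> _ [y hy <-] /=; rewrite arc_decompose//; [|exact: QK|exact: QK].
    by left; exists (f y) => //; rewrite au Cv fg//; exists y.
  - apply: IH; rewrite ?ler_pdivrMr//; apply: rest => //.
    by rewrite -[leRHS]mulr1; apply: ler_pM; rewrite ?(ltW ri0) ?(ltW l0)//; exact: (ds_le sys).
have Ka := QK _ Qa; have Kb := QK _ Qb.
move: hx; rewrite arc_decompose// => -[hx|[hx|hx]]; first exact: side.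
  case: hx => z hz zx.
  have r0 : 0 < r None := ds_gt0 sys _.
  have [hbig|hsmall] := ltP (2 * r None) h.
    exists i, j, S0, (r None); split => //.
    - apply: (@le_trans _ _ (p * p * p)); last exact: le_trans ppp (pr _).
      have : 0 < p * p * p by rewrite !mulr_gt0.
      by nra.
    - exact: (ds_scales sys).
    - move=> _ [y hy <-]; split; first by apply: Kab => //; exists y.
      rewrite /= -zx (ds_scales sys).
      have : r None * d z y <= r None.
        by rewrite ler_piMr ?(ltW r0)// (ds_diam sys)//; apply: (arc_in_sub sys) hz || apply: (arc_in_sub sys) hy.
      lra.
  have hz' : gam (Sc i (A i)) (Sc j (A j)) z by rewrite !(as_Afix sys).
  rewrite -zx; apply: (@copy_near_scale alpha (r None) h S0 (A i) (A j) _ _ z r0).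
  - exact: (ds_scales sys).
  - exact: Kab.
  - rewrite -(as_Afix sys i) -(as_Afix sys j); apply: IH; rewrite ?ler_pdivrMr//.
    + exact: (as_QA sys).
    + exact: (as_QA sys).
    + by apply: rest => //; exact: (ds_le sys).
(* Reversing the arc makes its last piece a first piece. *)
rewrite /copy_near (arc_inC sys); [|exact: as_KS|exact: as_KS].
apply: (side j i) => //; first exact: nesym.
by rewrite (arc_inC sys) ?KC.
Qed.

Lemma copies_everywhere : exists2 alpha : R, 0 < alpha &
  forall x h, gam (A i1) (A i2) x -> 0 < h <= 2 -> exists g sigma,
  [/\ 0 < sigma, alpha * h <= sigma, scales_by d sigma g,
    g @` gam (A i1) (A i2) `<=` gam (A i1) (A i2) &
    forall y, gam (A i1) (A i2) y -> d x (g y) <= h].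
Proof.
have [p p01 pr] := ratio_lower_bound; have /andP[p0 p1] := p01.
have [c c0 hc] := has_copy_from_side_uniform.
have rho0 := ds_rho_ge0 sys.
exists (p * p * p / 2 * c); first by rewrite mulr_gt0// divr_gt0// !mulr_gt0.
move=> x h hx /andP[h0 h2].
have [N /(_ N (leqnn N)) hN] := expr_lt_eventually rho0 (divr_gt0 h0 (ltr0n R 2)).
have := @copy_near_arc p p01 pr N i1 i2 (A i1) (A i2) x h.
rewrite !(as_Afix sys) => H.
have ne : i1 <> i2 by [].
have hN' : 2 * rho ^+ N < h by rewrite mulrC -ltr_pdivlMr.
have [k [l [g [s [kl s0 hs gs gX]]]]] := H ne (as_QA sys _) (as_QA sys _) hx hN' h2.
have [g' [s' [s'0 cs' gs' gX']]] := hc k l kl.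
exists (g \o g'), (s * s'); split.
- exact: mulr_gt0.
- by rewrite mulrAC; apply: ler_pM => //; rewrite ?mulr_ge0 ?invr_ge0 ?(ltW p0) ?(ltW c0) ?(ltW h0).
- by move=> y y' /=; rewrite gs gs' mulrA.
- move=> _ [y hy <-]; apply: (fun z hz => proj1 (gX z hz)).
  by exists (g' y) => //; apply: gX'; exists y.
- move=> y hy; apply: (fun z hz => proj2 (gX z hz)).
  by exists (g' y) => //; apply: gX'; exists y.
Qed.

End arcs_of_system.

(** * Finiteness and additivity of length *)

Lemma compact_disjoint_gap (R : realType) (X Y : set (plane R)) :
  compact X -> closed Y -> X `&` Y `<=` set0 ->
  exists2 eta : R, 0 < eta & forall x y, X x -> Y y -> eta <= euclidean_dist x y.
Proof.
move=> cX cY XY; apply: contrapT => no.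
have /choice[a aP] : forall n : nat, exists x : plane R,
    X x /\ exists2 y, Y y & euclidean_dist x y < (2^-1) ^+ n.
  move=> n; apply: contrapT => h; apply: no; exists ((2^-1) ^+ n).
    by rewrite exprn_gt0// invr_gt0.
  move=> x y Xx Yy; rewrite leNgt; apply/negP => xy; apply: h.
  by exists x; split => //; exists y.
have XF : (a n @[n --> \oo]) X by exists 0%N => // n _; case: (aP n).
have [p [Xp clp]] := cX _ (fmap_proper_filter a eventually_filter) XF.
apply: (XY p); split => //; apply: closed_euclidean => // e e0.
have h : 0 <= (2^-1 : R) < 1 by rewrite invr_ge0 ler0n invf_lt1 ?ltr1n.
have e20 : 0 < e / 2 by rewrite divr_gt0.
have [N hN] := expr_lt_eventually h e20.
have nb : nbhs p [set z | euclidean_dist p z < e / 2].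
  by apply/nbhs_euclidean; exists (e / 2).
have tail : (a n @[n --> \oo]) [set a n | n in [set n | (N <= n)%N]].
  by exists N => // n /= Nn; exists n.
have [_ [[n /= Nn <-] pn]] := clp _ _ tail nb.
have [_ [y Yy ny]] := aP n; exists y => //.
apply: le_lt_trans (euclidean_dist_tri p (a n) y) _.
by rewrite (splitr e) ltrD// (lt_trans ny)// hN.
Qed.

Section scaling.
Context (R : realType).
Local Notation d := (@euclidean_dist R).
Local Notation HM := (hausdorff_measure d).

Lemma hausdorff_measure_scales (s c : R) (g : plane R -> plane R) (X : set (plane R)) :
  0 <= s -> 0 < c -> scales_by d c g -> (HM s (g @` X) = (c `^ s)%:E * HM s X)%E.
Proof.
move=> s0 c0 gc; have d0 := @euclidean_dist_ge0 R.
have cs : 0 < c `^ s by rewrite powR_gt0.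
apply/eqP; rewrite eq_le; apply/andP; split.
  by apply: hausdorff_measure_image => // x y _ _; rewrite gc.
pose f x := xget (0 : plane R) [set y | g y = x].
have fK y : f (g y) = y.
  apply: (scales_by_inj c0 gc).
  by have := @xgetPex _ (0 : plane R) [set z | g z = g y] (ex_intro _ y erefl).
rewrite -lee_pdivlMl// -powRN -[(- s)]mulN1r powRrM powR_inv1 ?(ltW c0)//.
have {1}-> : X = f @` (g @` X).
  by rewrite image_comp -[LHS]image_id; apply: eq_imagel => x _ /=; rewrite fK.
apply: hausdorff_measure_image => //; first by rewrite invr_gt0.
by move=> _ _ [x _ <-] [y _ <-]; rewrite !fK gc mulKf// gt_eqF.
Qed.

Lemma has_copy_measure_finite (s c : R) (X Y : set (plane R)) : 0 <= s ->
  has_copy c X Y -> (HM s X < +oo)%E -> (HM s Y < +oo)%E.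
Proof.
move=> s0 [g [sigma [sg0 _ gs gX]]] hX.
have sgs : 0 < sigma `^ s by rewrite powR_gt0.
have : (HM s (g @` Y) < +oo)%E.
  by apply: le_lt_trans hX; apply: hausdorff_measure_sub.
rewrite (hausdorff_measure_scales _ s0 sg0 gs).
have [->|n _] := eqVneq (HM s Y) +oo%E; last by rewrite ltey.
by rewrite gt0_muley ?lte_fin.
Qed.

End scaling.

Section finite_measure.
Context (R : realType) (F : set (plane R)) (alpha s : R).
Local Notation d := (@euclidean_dist R).
Local Notation HM := (hausdorff_measure d).
Hypothesis F_compact : compact F.
Hypothesis F0 : F !=set0.
Hypothesis alpha_gt0 : 0 < alpha.
Hypothesis s_gt0 : 0 < s.
Hypothesis s_dim : forall t, s < t -> HM t F = 0%E.
Hypothesis copies : forall x h, F x -> 0 < h <= 1 -> exists g sigma,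
  [/\ 0 < sigma, alpha * h <= sigma, scales_by d sigma g, g @` F `<=` F &
    forall y, F y -> d x (g y) <= h].

(* More than [(beta * h) ^ (- s)] disjoint balls of radius [h] around points of
   [F] would each contain a copy of [F] of ratio [beta * h], so that [F] would
   contain a self-similar set of dimension larger than [s]. *)
Let packing_le (beta h : R) n (x : 'I_n -> plane R) : 0 < beta <= 1 -> beta <= alpha ->
  0 < h <= 1 -> (1 < n)%N -> (forall i, F (x i)) ->
  (forall i j, i != j -> 3 * h < d (x i) (x j)) ->
  n%:R * (beta * h) `^ s <= 1.
Proof.
move=> /andP[b0 b1] ba /andP[h0 h1] n1 Fx sepx; rewrite leNgt; apply/negP => y1.
set b := beta * h in y1; set y := _ * _ in y1.
have b0' : 0 < b by rewrite mulr_gt0.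
have b01 : 0 < b <= 1 by rewrite b0' mulr_ile1// ltW.
have y0 : 0 < y by apply: lt_trans y1.
have q01 : 0 <= y^-1 < 1 by rewrite invr_ge0 (ltW y0) invf_lt1.
(* The excess of [y] over 1 leaves room for a larger exponent: with this [e], the ratios to the
   power [s + e] still sum to at least 1. *)
have [e /andP[e0 e1] he] := powR_close_to1 b01 q01.
have /choice[g gP] : forall i, exists g : (plane R -> plane R) * R,
    [/\ 0 < g.2, alpha * h <= g.2, scales_by d g.2 g.1, g.1 @` F `<=` F &
      forall y, F y -> d (x i) (g.1 y) <= h].
  move=> i; have h01 : 0 < h <= 1 by rewrite h0.
  by have [g [sigma H]] := copies (Fx i) h01; exists (g, sigma).
have st : s < s + e by rewrite ltrDl.
have := s_dim st.
(* Centres more than [3 * h] apart with copies within [h] of them leave gaps of at least [h]. *)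
apply: (@hausdorff_measure_separated_copies R (plane R) d F n (fun i => (g i).1)
  (fun i => (g i).2) h (s + e)) => //.
- exact: euclidean_dist_ge0.
- exact: euclidean_distxx.
- exact: euclidean_distC.
- exact: euclidean_dist_tri.
- by move=> U k; apply: open_euclidean.
- by move=> i; case: (gP i).
- by move=> i u v _ _; have [_ _ ->] := gP i.
- by move=> i u Fu; have [_ _ _ gF _] := gP i; apply: gF; exists u.
- move=> i j u v ij Fu Fv.
  have [_ _ _ _ /(_ u Fu) hu] := gP i; have [_ _ _ _ /(_ v Fv) hv] := gP j.
  have := euclidean_dist_tri (x i) ((g i).1 u) (x j).
  have := euclidean_dist_tri ((g i).1 u) ((g j).1 v) (x j).
  have := sepx i j ij; rewrite (euclidean_distC ((g j).1 v)); lra.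
- by rewrite addr_gt0.
- apply: (@le_trans _ _ (\sum_(i < n) b `^ (s + e))).
    rewrite sumr_const card_ord -[leRHS]mulr_natl powRD ?(gt_eqF b0') ?implybT//.
    by rewrite mulrA -/y -ler_pdivrMl// mulr1 ltW.
  apply: ler_sum => i _; have [g0 hg _ _ _] := gP i.
  apply: ge0_ler_powR; rewrite ?nnegrE ?(ltW b0') ?(ltW g0)//.
    by rewrite addr_ge0// ltW.
  by apply: le_trans hg; rewrite ler_wpM2r// ltW.
Qed.

(** A maximal set of points with mutual distances above [3 * h] covers [F] by balls of radius
    [3 * h], whose number [packing_le] bounds. *)
Lemma hausdorff_measure_finite : (HM s F < +oo)%E.
Proof.
pose beta := Num.min alpha 1.
have b01 : 0 < beta <= 1 by rewrite lt_min alpha_gt0 ltr01 ge_min lexx orbT.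
have ba : beta <= alpha by rewrite ge_min lexx.
have b0 : 0 < beta by case/andP: b01.
(* The first summand covers the case of one ball, to which [packing_le] does not apply, the second
   the case of several. *)
pose c := 6 `^ s + (6 / beta) `^ s.
suff H h : 0 < h <= 1 -> (hausdorff_content d s (6 * h) F <= c%:E)%E.
  apply: (@le_lt_trans _ _ c%:E); last by rewrite ltry.
  apply: hausdorff_measure_le => delta de0.
  have h0 : 0 < Num.min (delta / 6) 1 <= 1.
    by rewrite lt_min ltr01 divr_gt0//= ge_min lexx orbT.
  apply: le_trans (H _ h0); apply: hausdorff_content_antitone.
  by rewrite mulrC -ler_pdivlMr// ge_min lexx.
move=> h01; have /andP[h0 h1] := h01.
pose pack n := `[< exists x : 'I_n -> plane R, (forall i, F (x i)) /\
  forall i j, i != j -> 3 * h < d (x i) (x j) >].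
have bh0 : 0 < beta * h by rewrite mulr_gt0.
have bhs : 0 < (beta * h) `^ s by rewrite powR_gt0.
have pack0 : exists n, pack n.
  by exists 0%N; apply/asboolP; exists (fun=> 0); split; case.
have [m hm] : exists m, forall n, pack n -> (n <= m)%N.
  exists (Num.bound ((beta * h) `^ s)^-1).+1 => n /asboolP[x [Fx sx]].
  have [n1|n1] := leqP n 1; first exact: leq_trans n1 _.
  have := packing_le b01 ba h01 n1 Fx sx; rewrite -ler_pdivlMr// mul1r => le.
  apply: leqW; apply: ltnW; rewrite -(ltr_nat R); apply: le_lt_trans le _.
  by apply: archi_boundP; rewrite invr_ge0 ltW.
have [n /asboolP[x [Fx sx]] nmax] := ex_maxnP pack0 hm.
have cov y : F y -> exists i, d (x i) y <= 3 * h.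
  move=> Fy; apply: contrapT => no.
  have far i : 3 * h < d (x i) y.
    by rewrite ltNge; apply/negP => hi; apply: no; exists i.
  have : pack n.+1.
    apply/asboolP; exists (fun i => if unlift ord_max i is Some j then x j else y).
    split; first by move=> i; case: unliftP.
    move=> i j; case: unliftP => [i' ->|->]; case: unliftP => [j' ->|->] //.
    - by rewrite (inj_eq lift_inj) => /sx.
    - by move=> _; rewrite euclidean_distC.
    - by rewrite eqxx.
  by move=> /nmax; rewrite ltnn.
have n0 : (0 < n)%N.
  have [y Fy] := F0; have [i _] := cov y Fy.
  by apply: leq_ltn_trans (ltn_ord i).
pose U k := [set y | F y /\ exists2 i : 'I_n, nat_of_ord i = k & d (x i) y <= 3 * h].
have Ud k : (diam d (U k) <= (6 * h)%:E)%E.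
  apply: diam_le => y z [_ [i ik hy]] [_ [j jk hz]].
  have ij : i = j by apply: val_inj; rewrite /= ik jk.
  rewrite -ij in hz.
  have := euclidean_dist_tri y (x i) z; rewrite (euclidean_distC y (x i)); lra.
have d0 := @euclidean_dist_ge0 R.
have h60 : 0 <= 6 * h by rewrite mulr_ge0// ltW.
apply: (@le_trans _ _ (\sum_(0 <= i <oo) hausdorff_gauge d s (U i))%E).
  apply: hausdorff_content_le_cover => // y Fy.
  by have [i hi] := cov y Fy; exists i => //; split => //; exists i.
rewrite (@nneseries_split _ _ 0 n); last by move=> *; apply: hausdorff_gauge_ge0.
rewrite add0n [X in (_ + X)%E]eseries0 ?adde0; last first.
  move=> k nk _; rewrite (_ : U k = set0) ?hausdorff_gauge0//.
  apply/seteqP; split => // y [_ [i ik _]].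
  by have := ltn_ord i; rewrite ik ltnNge nk.
apply: (@le_trans _ _ (\sum_(0 <= i < n) ((6 * h) `^ s)%:E)%E).
  by apply: lee_sum => i _; apply: hausdorff_gauge_le => //; exact: ltW.
rewrite sumEFin lee_fin sumr_const_nat subn0 -[leLHS]mulr_natl.
have [n1|n1] := leqP n 1.
  have -> : n = 1%N by apply/eqP; rewrite eqn_leq n1.
  rewrite mul1r /c powRM ?(ltW h0)//; apply: (@le_trans _ _ (6 `^ s)); last first.
    by rewrite lerDl powR_ge0.
  rewrite ler_piMr ?powR_ge0//.
  have -> : 1 = 1 `^ s :> R by rewrite powR1.
  by apply: ge0_ler_powR; rewrite ?nnegrE ?(ltW h0) ?(ltW s_gt0).
have := packing_le b01 ba h01 n1 Fx sx => le.
have -> : 6 * h = 6 / beta * (beta * h) by rewrite mulrA divfK// gt_eqF.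
have b60 : 0 <= 6 / beta by rewrite divr_ge0// ltW.
rewrite powRM ?(ltW bh0)// mulrCA; apply: (@le_trans _ _ ((6 / beta) `^ s)).
  by rewrite ler_piMr// powR_ge0.
by rewrite /c lerDr powR_ge0.
Qed.

End finite_measure.

(** * Lengths of arcs between points of [Q] *)

Section arc_lengths.
Context (R : realType) (K Q : set (plane R)) (S : option idx -> plane R -> plane R)
  (r : option idx -> R) (rho eps : R) (A C : idx -> plane R) (O : plane R) (s : R).
Hypothesis sys : arc_system K Q S r rho eps A C O.
Local Notation d := (@euclidean_dist R).
Local Notation gam := (arc_in K).
Local Notation Sc i := (S (Some i)).
Local Notation S0 := (S None).
Local Notation HM := (hausdorff_measure d s).
Hypothesis s_ge1 : 1 <= s.
Hypothesis side_dim : forall t, s < t -> hausdorff_measure d t (gam (A i1) (A i2)) = 0%E.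
Implicit Types (a b x y z u v : plane R) (i j k l : idx).

Let d0 : forall x y : plane R, 0 <= d x y := @euclidean_dist_ge0 R.
Let s_gt0 : 0 < s. Proof. exact: lt_le_trans s_ge1. Qed.
Let s_ge0 : 0 <= s. Proof. exact: ltW. Qed.
Let KA i : K (A i). Proof. exact: (ds_A sys). Qed.
Let KC i : K (C i). Proof. exact: (ds_C sys). Qed.
Let KO : K O. Proof. exact: (as_KO sys). Qed.
Let KS c x : K x -> K (S c x). Proof. exact: (ds_stable sys). Qed.
Let QK : Q `<=` K. Proof. exact: (as_QK sys). Qed.
Let r0 c : 0 < r c. Proof. exact: (ds_gt0 sys). Qed.
Let r1 c : r c < 1.
Proof. by apply: le_lt_trans (ds_le sys c) _; case/andP: (ds_rho sys). Qed.

Let rs c : r c `^ s <= r c.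
Proof.
rewrite -[leRHS]powRr1 ?(ltW (r0 c))//.
by apply: ger_powR => //; rewrite r0 (ltW (r1 c)).
Qed.

Let rs0 c : 0 <= r c `^ s. Proof. exact: powR_ge0. Qed.

Let HM_S c X : (HM (S c @` X) = (r c `^ s)%:E * HM X)%E.
Proof. exact: (hausdorff_measure_scales _ s_ge0 (r0 c) (ds_scales sys c)). Qed.

Let HM_pt x : HM [set x] = 0%E.
Proof. by apply: hausdorff_measure_set1 => //; apply: euclidean_distxx. Qed.

Let HM_side_finite i j : (HM (gam (A i) (A j)) < +oo)%E.
Proof.
have [->|ij] := pselect (i = j); first by rewrite arc_inxx HM_pt.
have [c c0 h] := has_copy_of_side sys ij.
apply: has_copy_measure_finite h _ => //.
have [alpha al0 hal] := copies_everywhere sys.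
apply: (@hausdorff_measure_finite R (gam (A i1) (A i2)) alpha s) => //.
- exact: (arc_in_compact sys).
- by exists (A i1); apply: (arc_in_left sys).
- move=> x h' hx /andP[h0 h1]; have h2 : 0 < h' <= 2 by rewrite h0; lra.
  by have [g [sg [? ? ? ? ?]]] := hal x h' hx h2; exists g, sg.
Qed.

Let HM_side_bound : exists2 c : R, 0 <= c & forall i j, (HM (gam (A i) (A j)) <= c%:E)%E.
Proof.
(* The bound is written as an inverse so that [idx_lower_bound] yields a common upper bound. *)
pose P i j (e : R) := 0 < e -> (HM (gam (A i) (A j)) <= e^-1%:E)%E.
have Ple i j (e e' : R) : e' <= e -> P i j e -> P i j e'.
  move=> ee h e'0; apply: le_trans (h (lt_le_trans e'0 ee)) _.
  by rewrite lee_fin lef_pV2 ?posrE// (lt_le_trans e'0).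
have one i j : exists2 e, 0 < e & P i j e.
  have c0 : 0 <= fine (HM (gam (A i) (A j))) by rewrite fine_ge0// hausdorff_measure_ge0.
  exists (fine (HM (gam (A i) (A j))) + 1)^-1; first by rewrite invr_gt0 ltr_wpDl.
  move=> _; rewrite invrK -[leLHS]fineK ?lee_fin ?lerDl//.
  by rewrite ge0_fin_numE ?HM_side_finite// hausdorff_measure_ge0.
have [e e0 he] := @idx_lower_bound R (fun i e => forall j, P i j e)
  (fun i e e' ee h j => Ple i j e e' ee (h j))
  (fun i => @idx_lower_bound R (P i) (Ple i) (one i)).
exists e^-1; first by rewrite invr_ge0 ltW.
by move=> i j; apply: he.
Qed.

Let q := r (Some i1) + r (Some i2) + r (Some i3).

Let q01 : 0 <= q < 1.
Proof. by rewrite /q (as_sum sys) !addr_ge0 ?(ltW (r0 _)). Qed.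

Let r_le_q i : r (Some i) <= q.
Proof.
have h1 := r0 (Some i1); have h2 := r0 (Some i2); have h3 := r0 (Some i3).
by rewrite /q; case: i; lra.
Qed.

Let r_le_q2 i j : i <> j -> r (Some i) + r (Some j) <= q.
Proof.
have h1 := r0 (Some i1); have h2 := r0 (Some i2); have h3 := r0 (Some i3).
by rewrite /q; case: i; case: j => //; lra.
Qed.

(* As [s >= 1], the factors [r (Some i) `^ s] of the two outer pieces of
   [arc_decompose] have sum at most [q < 1], so these pieces contribute a
   convergent geometric series. *)
Lemma arc_length_bounded : exists2 c : R, 0 <= c &
  forall a b, Q a -> Q b -> (HM (gam a b) <= c%:E)%E.
Proof.
have [c0 c00 hc0] := HM_side_bound.
have /andP[q0 q1] := q01.
have q10 : 0 < 1 - q by rewrite subr_gt0.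
(* The fixed point of [c |-> q * c + c0]: two outer pieces with ratios of sum at most [q], and a
   central one of length at most [c0]. *)
pose c1 := c0 / (1 - q).
have c10 : 0 <= c1 by rewrite divr_ge0// ltW.
have c1E : q * c1 + c0 = c1.
  by rewrite /c1; field; rewrite gt_eqF.
have part c (X : set (plane R)) (delta m : R) : 0 <= m ->
    (hausdorff_content d s (delta / r c) X <= m%:E)%E ->
    (hausdorff_content d s delta (S c @` X) <= (r c * m)%:E)%E.
  move=> m0 h; have -> : delta = r c * (delta / r c) by rewrite mulrC divfK// gt_eqF.
  apply: le_trans (@hausdorff_content_image _ _ _ d d d0 d0 s (S c) X (r c) _ s_ge0 (r0 c) _) _.
    by move=> x y _ _; rewrite (ds_scales sys).
  rewrite EFinM; apply: (@le_trans _ _ ((r c `^ s)%:E * m%:E)%E).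
    by apply: lee_wpmul2l => //; rewrite lee_fin.
  by rewrite -!EFinM lee_fin ler_wpM2r.
(* The diameter bound 1 at scale 1 decays to an error [q ^+ n] at scale [rho ^+ n]. *)
have claim n : forall a b delta, Q a -> Q b -> rho ^+ n <= delta ->
    (hausdorff_content d s delta (gam a b) <= (c1 + q ^+ n)%:E)%E.
  elim: n => [|n IH] a b delta Qa Qb hd.
    rewrite expr0 in hd *.
    apply: (@le_trans _ _ (1 `^ s)%:E).
      apply: hausdorff_content_le_diam => //; first by rewrite ler01.
      move=> x y hx hy; apply: (ds_diam sys); [move: hx|move: hy];
        by apply: (arc_in_sub sys); apply: QK.
    by rewrite powR1 lee_fin lerDr.
  have m0 : 0 <= c1 + q ^+ n by rewrite addr_ge0// exprn_ge0.
  have rho0 : 0 < rho by case/andP: (ds_rho sys).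
  have de0 : 0 < delta by apply: lt_le_trans hd; rewrite exprn_gt0.
  have IH' i a' b' : Q a' -> Q b' ->
      (hausdorff_content d s delta (Sc i @` gam a' b') <= (r (Some i) * (c1 + q ^+ n))%:E)%E.
    move=> Qa' Qb'; apply: part => //; apply: IH => //.
    rewrite ler_pdivlMr//; apply: le_trans hd; rewrite exprSr ler_wpM2l//.
      by rewrite exprn_ge0// ltW.
    exact: (ds_le sys).
  have [i [a' Qa' <-]] := as_Qcover sys Qa; have [j [b' Qb' <-]] := as_Qcover sys Qb.
  have [<-|ij] := pselect (i = j).
    rewrite (arc_in_scale sys); [|exact: QK|exact: QK].
    apply: le_trans (IH' _ _ _ Qa' Qb') _; rewrite lee_fin.
    apply: (@le_trans _ _ (q * (c1 + q ^+ n))); first by rewrite ler_wpM2r.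
    by rewrite mulrDr exprS lerD2r -{2}c1E lerDl.
  rewrite (arc_decompose sys ij); [|exact: QK|exact: QK].
  apply: (@le_trans _ _ ((r (Some i) * (c1 + q ^+ n))%:E + (c0%:E + (r (Some j) * (c1 + q ^+ n))%:E))%E).
    apply: le_trans (hausdorff_content_setU _ _ _ _ _) _ => //.
    apply: leeD; first by apply: IH' => //; exact: (as_QC sys).
    apply: le_trans (hausdorff_content_setU _ _ _ _ _) _ => //.
    apply: leeD; last by apply: IH' => //; exact: (as_QC sys).
    apply: le_trans (hausdorff_content_le_measure _ _ _ de0) _.
    rewrite HM_S; apply: le_trans (hc0 i j).
    rewrite -[leRHS]mul1e; apply: lee_wpmul2r; first exact: hausdorff_measure_ge0.
    by rewrite lee_fin (le_trans (rs None))// ltW.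
  rewrite -!EFinD lee_fin exprS -c1E.
  have := r_le_q2 ij; have := r_le_q i; nra.
exists (c1 + 1); first by rewrite addr_ge0.
move=> a b Qa Qb; apply: hausdorff_measure_le => delta de0.
have rho01 := ds_rho_ge0 sys.
have [N /(_ N (leqnn N)) hN] := expr_lt_eventually rho01 de0.
apply: le_trans (claim N a b delta Qa Qb (ltW hN)) _.
by rewrite lee_fin lerD2l exprn_ile1// ltW.
Qed.

(** Zoomed to different cells, the endpoints are at least [eps] apart while the length is at most
    [c]. Zooming back multiplies the distance by [lam] and the length by $\lambda^s\le\lambda$, as
    $s\ge1$. *)
Lemma arc_length_lipschitz : exists2 L : R, 0 < L &
  forall a b, Q a -> Q b -> (HM (gam a b) <= (L * d a b)%:E)%E.
Proof.
have [c c0 hc] := arc_length_bounded; have e0 := as_eps sys.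
exists ((c + 1) / eps); first by rewrite divr_gt0// ltr_wpDl.
move=> a b Qa Qb; have [<-|ab] := pselect (a = b).
  by rewrite arc_inxx HM_pt lee_fin mulr_ge0// divr_ge0 ?ltW// ltr_wpDl.
have [f [lam [i [j [u [v [[/andP[l0 l1] fs fK fg] ij Qu Qv [-> ->]]]]]]]] := zoom_arc sys Qa Qb ab.
have Ku := KS (Some i) (QK Qu); have Kv := KS (Some j) (QK Qv).
rewrite fg// (hausdorff_measure_scales _ s_ge0 l0 fs) fs.
apply: (@le_trans _ _ (lam%:E * c%:E)%E).
  apply: lee_pmul => //; rewrite ?lee_fin ?powR_ge0 ?hausdorff_measure_ge0//.
    by rewrite -[leRHS]powRr1 ?(ltW l0)//; apply: ger_powR => //; rewrite l0.
  by apply: hc; apply: (as_QS sys).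
rewrite -EFinM lee_fin mulrCA ler_pM2l// mulrAC ler_pdivlMr//.
have := as_gap sys ij (QK Qu) (QK Qv) => hgap.
apply: ler_pM => //; [exact: ltW|by rewrite lerDl].
Qed.

(* This makes lengths add up at the junction [c]: the arc from [a] to [c]
   contains arcs avoiding [c], hence at positive distance from whatever
   follows [c], of almost the same length. *)
Definition approached (a c : plane R) := forall e : R, 0 < e ->
  exists x, [/\ gam a c x, x <> c & (HM (gam x c) <= e%:E)%E].

Let approached_sub a c x : K a -> K c -> gam a c x -> approached x c -> approached a c.
Proof.
move=> Ka Kc hx ap e e0; have [y [hy yc he]] := ap e e0; exists y; split => //.
by apply: (arc_in_sub_arc_in sys) hy => //; exact: (arc_in_right sys).
Qed.

Let approached_scale t a c : K a -> K c -> approached a c -> approached (S t a) (S t c).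
Proof.
move=> Ka Kc ap e e0; have [x [hx xc he]] := ap e e0; have Kx := arc_in_sub sys Ka Kc hx.
exists (S t x); split.
- by rewrite (arc_in_scale sys)//; exists x.
- by move/(as_S_inj sys).
- rewrite (arc_in_scale sys)// HM_S; apply: le_trans he.
  rewrite -[leRHS]mul1e; apply: lee_wpmul2r; first exact: hausdorff_measure_ge0.
  by rewrite lee_fin (le_trans (rs _))// ltW.
Qed.

Let iterK c n x : K x -> K (iter n (S c) x).
Proof. by move=> Kx; elim: n => //= n; apply: KS. Qed.

Let iter_inj c n : injective (iter n (S c)).
Proof. by elim: n => [//|n IH] x y /= /(as_S_inj sys)/IH. Qed.

Let iter_arc c n x y : K x -> K y ->
  gam (iter n (S c) x) (iter n (S c) y) = iter n (S c) @` gam x y.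
Proof.
move=> Kx Ky; elim: n => [|n IH]; first by rewrite image_id.
by rewrite !iterS (arc_in_scale sys) ?IH ?image_comp//; apply: iterK.
Qed.

Let iter_scales c n : scales_by d (r c ^+ n) (iter n (S c)).
Proof.
elim: n => [|n IH] x y; first by rewrite expr0 mul1r.
by rewrite /= (ds_scales sys) IH exprS mulrA.
Qed.

(** The tail from the [n]th iterate of [x] to the fixed point [y] is the image of the whole arc
    under the iterated map, so its length decays geometrically. *)
Let approached_iter c x y : K x -> K y -> x <> y -> S c y = y ->
  (forall n, gam x y (iter n (S c) x)) -> (HM (gam x y) < +oo)%E -> approached x y.
Proof.
move=> Kx Ky xy Sy hn fin e e0.
have yn n : iter n (S c) y = y by elim: n => //= n ->.
pose m := fine (HM (gam x y)).
have mE : HM (gam x y) = m%:E by rewrite fineK// ge0_fin_numE ?hausdorff_measure_ge0.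
have m0 : 0 <= m by rewrite fine_ge0// hausdorff_measure_ge0.
have rc01 : 0 <= r c `^ s < 1 by rewrite powR_ge0 (le_lt_trans (rs c)).
have m1 : 0 < m + 1 by rewrite ltr_wpDl.
have [N /(_ N (leqnn N))] := expr_lt_eventually rc01 (divr_gt0 e0 m1).
rewrite ltr_pdivlMr// => hN.
exists (iter N (S c) x); split => //.
  by rewrite -{1}(yn N) => /iter_inj.
rewrite -{1}(yn N) iter_arc// (hausdorff_measure_scales _ s_ge0 _ (@iter_scales c N)).
  have -> : (r c ^+ N) `^ s = (r c `^ s) ^+ N.
    by rewrite -!powR_mulrn ?powR_ge0 ?(ltW (r0 c))// -!powRrM mulrC.
  rewrite mE -EFinM lee_fin; apply: le_trans (ltW hN); rewrite ler_wpM2l ?exprn_ge0//.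
  by rewrite lerDl.
by rewrite exprn_gt0.
Qed.

(** The way to [A i] ends with the image of the arc from [C i] to [A i], which contains all iterates
    of [C i] under the map fixing [A i]. *)
Let approached_vertex i z : K z -> ~ (Sc i @` K) z -> approached z (A i).
Proof.
move=> Kz zi.
have Cn n : gam (A i) (C i) (iter n (Sc i) (C i)).
  elim: n => [|n IH] /=; first exact: (arc_in_right sys).
  by have [y Ky ->] := arc_decompose_AC sys i; left; exists (iter n (Sc i) (C i)).
have CA : C i <> A i.
  move=> e; apply: (@C_notin_cell _ _ _ _ _ _ _ _ _ _ sys i).
  by rewrite e -(as_Afix sys i); exists (A i).
have fin : (HM (gam (C i) (A i)) < +oo)%E.
  have [c c0 hc] := arc_length_bounded.
  by apply: le_lt_trans (hc _ _ (as_QC sys i) (as_QA sys i)) _; rewrite ltry.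
have ap : approached (C i) (A i).
  apply: (@approached_iter (Some i)) => //; first exact: (as_Afix sys).
  by move=> n; rewrite (arc_inC sys).
have hB : gam z (A i) (Sc i (C i)).
  rewrite (arc_inC sys)// (ds_SC sys) -{1}(as_Afix sys i).
  exact: (arc_in_junction sys).
apply: (approached_sub _ _ hB) => //.
by rewrite -{1}(as_Afix sys i); apply: approached_scale.
Qed.

Let O_notin_cell i : ~ (Sc i @` K) O.
Proof.
move=> [y Ky yO]; have OA := ds_center sys KO Ky (etrans (as_O sys) (esym yO)).
by apply: (as_A_center sys (i := i) KO); rewrite -[RHS]OA (as_O sys).
Qed.

Let other i : exists j, i <> j.
Proof. by exists (next_idx i) => /esym; apply: next_idx_neq. Qed.

Let O_in_side i j : i <> j -> gam (A i) (A j) O.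
Proof.
move=> ij; rewrite -(as_Afix sys i) -(as_Afix sys j).
exact: (arc_through_O sys).
Qed.

Let HM_OA_finite i : (HM (gam (A i) O) < +oo)%E.
Proof.
have [j ij] := other i; apply: le_lt_trans (HM_side_finite i j).
apply: hausdorff_measure_sub; apply: (arc_in_sub_arc_in sys) => //; last exact: O_in_side.
exact: (arc_in_left sys).
Qed.

Let approached_AO i : approached (A i) O.
Proof.
have AO : A i <> O.
  by move=> AO; apply: (@O_notin_cell i); rewrite -AO -(as_Afix sys i); exists (A i).
apply: (@approached_iter None) => //; first exact: (as_O sys).
elim=> [|n IH]; first exact: (arc_in_left sys).
have h : gam (A i) O (S0 (A i)).
  rewrite -{1}(as_Afix sys i); exact: (arc_in_junction sys).
apply: (arc_in_sub_arc_in sys (KA i) KO h (arc_in_right sys (KA i) KO)).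
rewrite -{1}(as_O sys) (arc_in_scale sys)//.
by exists (iter n S0 (A i)).
Qed.

Let approached_O i a : K a -> approached (Sc i a) O.
Proof.
move=> Ka; have Ka' := KS (Some i) Ka.
apply: (@approached_sub _ _ (S0 (A i))) => //.
  exact: (arc_in_junction sys).
by rewrite -(as_O sys); apply: approached_scale.
Qed.

Let arc_additive a b c : K a -> K b -> gam a b c -> approached a c ->
  HM (gam a b) = (HM (gam a c) + HM (gam c b))%E.
Proof.
move=> Ka Kb hc ap; have Kc := arc_in_sub sys Ka Kb hc.
apply/eqP; rewrite eq_le; apply/andP; split.
  by rewrite (arc_in_split sys Ka Kb hc); apply: hausdorff_measure_setU.
apply/lee_addgt0Pr => e e0.
have [x [hx xc he]] := ap e e0; have Kx := arc_in_sub sys Ka Kc hx.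
have sub1 : gam a x `<=` gam a c.
  by apply: (arc_in_sub_arc_in sys) => //; exact: (arc_in_left sys).
have disj : gam a x `&` gam c b `<=` set0.
  move=> y [h1 h2]; have yc : y = c by apply: (arc_in_splitI sys Ka Kb hc); split => //; exact: sub1.
  apply: xc; apply/esym; apply: (arc_in_splitI sys Ka Kc hx); split; first by rewrite -yc.
  exact: (arc_in_right sys).
have [eta eta0 gap] := compact_disjoint_gap (arc_in_compact sys Ka Kx) (arc_in_closed sys Kc Kb) disj.
have le1 : (HM (gam a c) <= HM (gam a x) + e%:E)%E.
  rewrite (arc_in_split sys Ka Kc hx).
  by apply: le_trans (hausdorff_measure_setU d _ _ _) _; rewrite leeD2l.
apply: (@le_trans _ _ ((HM (gam a x) + HM (gam c b)) + e%:E)%E).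
  by rewrite -addeA (addeC (HM (gam c b))) addeA leeD2r.
rewrite leeD2r//.
apply: le_trans (hausdorff_measure_separated d0 eta0 s_ge0 gap) _.
apply: hausdorff_measure_sub; rewrite (arc_in_split sys Ka Kb hc).
by move=> y [/sub1|]; [left|right].
Qed.

(** [fine] would turn an infinite length into 0; [lenE_Q] and [lenE_O] exclude this for the
    endpoints considered. *)
Definition len a b : R := fine (HM (gam a b)).

Let fin_len a b : (HM (gam a b) < +oo)%E -> HM (gam a b) = (len a b)%:E.
Proof. by move=> h; rewrite /len fineK// ge0_fin_numE ?hausdorff_measure_ge0. Qed.

Lemma lenE_Q a b : Q a -> Q b -> HM (gam a b) = (len a b)%:E.
Proof.
move=> Qa Qb; have [c _ hc] := arc_length_bounded; apply: fin_len.
by apply: le_lt_trans (hc _ _ Qa Qb) _; rewrite ltry.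
Qed.

Lemma lenE_O x : Q x -> HM (gam O x) = (len O x)%:E.
Proof.
move=> Qx; apply: fin_len; apply: (@le_lt_trans _ _ (HM (gam O (A i1)) + HM (gam (A i1) x))%E).
  apply: le_trans (hausdorff_measure_setU d _ _ _); apply: hausdorff_measure_sub.
  by apply: (arc_in_tri sys) => //; exact: QK.
rewrite (arc_inC sys KO (KA i1)) lte_add_pinfty//.
by rewrite lenE_Q ?ltry//; exact: (as_QA sys).
Qed.

Lemma lenC a b : K a -> K b -> len a b = len b a.
Proof. by move=> Ka Kb; rewrite /len (arc_inC sys). Qed.

(** The arc enters the cell through $B_i$, which is $S_0(A_i)$ seen from $O=S_0(O)$ and $S_i(C_i)$
    seen from the cell. *)
Lemma len_cell i x : Q x ->
  len O (Sc i x) = r None `^ s * len O (A i) + r (Some i) `^ s * len (C i) x.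
Proof.
move=> Qx; have Kx := QK Qx; have Kx' := KS (Some i) Kx.
have hB : gam (Sc i x) O (S0 (A i)) by apply: (arc_in_junction sys).
have hB' : gam O (Sc i x) (S0 (A i)) by rewrite (arc_inC sys).
have ap : approached O (S0 (A i)).
  by rewrite -{1}(as_O sys); apply: approached_scale => //; apply: approached_vertex.
have E : ((len O (Sc i x))%:E =
    (r None `^ s * len O (A i) + r (Some i) `^ s * len (C i) x)%:E)%E.
  rewrite -lenE_O; last exact: (as_QS sys).
  rewrite (arc_additive _ _ hB')// -{1}(as_O sys) (arc_in_scale sys)// HM_S.
  rewrite -(ds_SC sys) (arc_in_scale sys)// HM_S lenE_O; last exact: (as_QA sys).
  by rewrite lenE_Q//; exact: (as_QC sys).
by case: E.
Qed.

Lemma len_through_O i j u v : i <> j -> Q u -> Q v ->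
  len (Sc i u) (Sc j v) = len (Sc i u) O + len O (Sc j v).
Proof.
move=> ij Qu Qv; have Ku := KS (Some i) (QK Qu); have Kv := KS (Some j) (QK Qv).
have Qu' := as_QS sys i Qu; have Qv' := as_QS sys j Qv.
have hO : gam (Sc i u) (Sc j v) O by apply: (arc_through_O sys) => //; exact: QK.
have ap : approached (Sc i u) O by apply: approached_O; exact: QK.
have E : ((len (Sc i u) (Sc j v))%:E = (len (Sc i u) O + len O (Sc j v))%:E)%E.
  rewrite -lenE_Q// (arc_additive _ _ hO)// lenE_O// (lenC Ku KO) (arc_inC sys Ku KO).
  by rewrite lenE_O.
by case: E.
Qed.

Lemma len_scale i u v : Q u -> Q v ->
  len (Sc i u) (Sc i v) = r (Some i) `^ s * len u v.
Proof.
move=> Qu Qv; have Ku := QK Qu; have Kv := QK Qv.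
have E : ((len (Sc i u) (Sc i v))%:E = (r (Some i) `^ s * len u v)%:E)%E.
  rewrite -lenE_Q; [|exact: (as_QS sys)|exact: (as_QS sys)].
  by rewrite (arc_in_scale sys)// HM_S lenE_Q.
by case: E.
Qed.

Lemma len_lipschitz : exists2 L : R, 0 < L & forall c, c = O \/ Q c ->
  forall x y, Q x -> Q y -> `|len c x - len c y| <= L * d x y.
Proof.
have [L L0 hL] := arc_length_lipschitz; exists L => // c hc.
have Kc : K c by case: hc => [->//|/QK].
have cE x : Q x -> HM (gam c x) = (len c x)%:E.
  by case: hc => [->|Qc]; [exact: lenE_O|exact: lenE_Q].
have le x y : Q x -> Q y -> len c x - len c y <= L * d x y.
  move=> Qx Qy; rewrite lerBlDr addrC -lee_fin EFinD -!cE//.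
  apply: (@le_trans _ _ (HM (gam c y) + HM (gam y x))%E).
    apply: le_trans (hausdorff_measure_setU d _ _ _); apply: hausdorff_measure_sub.
    by apply: (arc_in_tri sys) => //; exact: QK.
  by rewrite leeD2l// euclidean_distC hL.
move=> x y Qx Qy; rewrite ler_norml lerNl opprB le//.
by rewrite euclidean_distC le.
Qed.

End arc_lengths.

(** * The triangle in barycentric coordinates *)

(** A point of [X] is pulled back [n] times inside [X], approximated by [a], and pushed forward
    inside [D], with error [rho ^+ n * M]. Applied to singletons, this puts fixed points into
    attractors. *)
Lemma invariant_subset (R : realType) (I : Type) (S : I -> plane R -> plane R)
    (r : I -> R) (rho : R) (X D : set (plane R)) :
  0 < rho < 1 -> (forall c, 0 < r c) -> (forall c, r c <= rho) ->
  (forall c, scales_by (@euclidean_dist R) (r c) (S c)) -> compact X ->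
  (forall x, X x -> exists c, (S c @` X) x) -> closed D -> D !=set0 ->
  (forall c x, D x -> D (S c x)) -> X `<=` D.
Proof.
move=> /andP[rho0 rho1] r0 rle Ssc cX cov cD [a Da] SD x Xx.
have [M M0 XM] : exists2 M : R, 0 < M & forall y, X y -> euclidean_dist y a <= M.
  have [M [_ hM]] := compact_bounded cX.
  have M1 : M < `|M| + 1 by rewrite ltr_pwDr// ler_norm.
  have {}hM y : X y -> `|y| <= `|M| + 1 by move=> Xy; apply: (hM _ M1).
  have n1 (z : plane R) : `|z.1| <= `|z| by rewrite [leRHS]prod_normE le_max lexx.
  have n2 (z : plane R) : `|z.2| <= `|z| by rewrite [leRHS]prod_normE le_max lexx orbT.
  exists (2 * (`|M| + 1 + `|a|)); first by rewrite mulr_gt0// ltr_pwDl// ltr_pwDr.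
  move=> y Xy; apply: le_trans (euclidean_dist_le y a) _.
  have := ler_normB y.1 a.1; have := ler_normB y.2 a.2.
  have := n1 y; have := n2 y; have := n1 a; have := n2 a; have := hM y Xy; lra.
have rho01 : 0 <= rho < 1 by rewrite ltW.
have near n : forall y, X y -> exists2 z, D z & euclidean_dist y z <= rho ^+ n * M.
  elim: n => [|n IH] y Xy; first by exists a => //; rewrite mul1r XM.
  have [c [y' Xy' <-]] := cov y Xy; have [z Dz hz] := IH y' Xy'.
  exists (S c z); first exact: SD.
  rewrite Ssc exprS -mulrA; apply: ler_pM => //; [exact: ltW|exact: euclidean_dist_ge0].
apply: closed_euclidean => // e e0.
have [N /(_ N (leqnn N))] := expr_lt_eventually rho01 (divr_gt0 e0 M0).
rewrite ltr_pdivlMr// => hN; have [z Dz hz] := near N x Xx.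
by exists z => //; apply: le_lt_trans hN.
Qed.

Section barycentric.
Context (R : realType).
Implicit Types (x y z w : plane R) (p : R) (i j k : idx).
Local Notation d := (@euclidean_dist R).
Let q := Num.sqrt (3 : R).

Definition vtx i : plane R := match i with i1 => A1 R | i2 => A2 R | i3 => A3 R end.

(** Barycentric coordinates in the triangle: coordinate [i] is 1 at vertex [i] and 0 on the opposite
    side. *)
Definition bary i z : R := match i with
  | i1 => 1 - z.1 - z.2 / Num.sqrt 3
  | i2 => z.1 - z.2 / Num.sqrt 3
  | i3 => 2 * (z.2 / Num.sqrt 3)
  end.

Definition corner i p z : plane R := match i with
  | i1 => S1 p z | i2 => S2 p z | i3 => S3 p z end.

Let q_gt0 : 0 < q. Proof. by rewrite sqrtr_gt0. Qed.
Let qV : q * q^-1 = 1. Proof. by rewrite mulfV// gt_eqF. Qed.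
Let qq : q * q = 3. Proof. by rewrite -expr2 sqr_sqrtr. Qed.
Let qE : q = 3 * q^-1. Proof. by rewrite -qq -mulrA qV mulr1. Qed.
Let qVV : q^-1 * q^-1 = 3^-1.
Proof. by rewrite -invfM qq. Qed.

Lemma bary_sum z : bary i1 z + bary i2 z + bary i3 z = 1.
Proof. by rewrite /bary; ring. Qed.

Lemma bary_vtx i j : i <> j -> bary i (vtx j) = 0.
Proof.
by case: i; case: j => // _; rewrite /bary /=; move: qE qV; rewrite -/q => e v; 
  rewrite ?mul0r; try lra; rewrite mulrAC -/q v; lra.
Qed.

Lemma bary_vtxx i : bary i (vtx i) = 1.
Proof.
have := bary_sum (vtx i); case: i.
- by rewrite (@bary_vtx i2 i1)// (@bary_vtx i3 i1)// !addr0.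
- by rewrite (@bary_vtx i1 i2)// (@bary_vtx i3 i2)// addr0 add0r.
- by rewrite (@bary_vtx i1 i3)// (@bary_vtx i2 i3)// !add0r.
Qed.

Lemma bary_inj z w : (forall i, bary i z = bary i w) -> z = w.
Proof.
move=> h; have := h i3; have := h i2; rewrite /bary -/q => h2 h3.
have e2 : z.2 = w.2.
  have : z.2 / q = w.2 / q by lra.
  by move/(mulIf (lt0r_neq0 (_ : 0 < q^-1))) => -> //; rewrite invr_gt0.
have e1 : z.1 = w.1 by rewrite e2 in h2; lra.
by case: z w e1 e2 {h h2 h3} => [a b] [a' b'] /= -> ->.
Qed.

Lemma bary_eq1 i z : (forall k, 0 <= bary k z) -> 1 <= bary i z -> z = vtx i.
Proof.
move=> h0 h1; have hs := bary_sum z; apply: bary_inj => k.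
have h01 := h0 i1; have h02 := h0 i2; have h03 := h0 i3.
have [ki|ki] := pselect (k = i).
  by rewrite ki bary_vtxx; case: i h1 {ki} => h1; lra.
by rewrite bary_vtx//; case: i h1 ki => h1; case: k => // _; lra.
Qed.

(** The Gram form of the two unit sides at the third vertex, which enclose an angle of $\pi/3$. *)
Lemma euclidean_dist_bary z w :
  d z w ^+ 2 = (bary i1 z - bary i1 w) ^+ 2 +
    (bary i1 z - bary i1 w) * (bary i2 z - bary i2 w) + (bary i2 z - bary i2 w) ^+ 2.
Proof.
rewrite euclidean_dist_sqr /bary -/q.
set x := z.1; set y := z.2; set x' := w.1; set y' := w.2.
transitivity ((x - x') ^+ 2 + 3 * (q^-1 * q^-1) * (y - y') ^+ 2); last by ring.
by rewrite qVV mulfV ?mul1r// pnatr_eq0.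
Qed.

(** The best constant is $2/\sqrt3$; 2 keeps the computation rational. *)
Lemma bary_le_dist i z w : bary i z - bary i w <= 2 * d z w.
Proof.
have h := euclidean_dist_bary z w; have d0 := euclidean_dist_ge0 z w.
have sz := bary_sum z; have sw := bary_sum w.
rewrite leNgt; apply/negP => lt.
have : d z w ^+ 2 * 4 < (bary i z - bary i w) ^+ 2.
  have -> : d z w ^+ 2 * 4 = (2 * d z w) ^+ 2 by ring.
  by rewrite ltr_pXn2r ?nnegrE ?mulr_ge0// ltW// (le_lt_trans _ lt)// mulr_ge0.
rewrite h; set u := bary i1 z - bary i1 w; set v := bary i2 z - bary i2 w.
have e3 : bary i3 z - bary i3 w = - (u + v) by rewrite /u /v; lra.
case: i {lt} => /=; rewrite -?/u -?/v ?e3 => lt.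
- have := sqr_ge0 (u + 2 * v); have := sqr_ge0 u; have := sqr_ge0 v; nra.
- have := sqr_ge0 (v + 2 * u); have := sqr_ge0 u; have := sqr_ge0 v; nra.
- have := sqr_ge0 (u - v); have := sqr_ge0 u; have := sqr_ge0 v; nra.
Qed.

Lemma triangle_diam z w : (forall k, 0 <= bary k z) -> (forall k, 0 <= bary k w) ->
  d z w <= 1.
Proof.
move=> hz hw; have h := euclidean_dist_bary z w; have d0 := euclidean_dist_ge0 z w.
have sz := bary_sum z; have sw := bary_sum w.
have z1 := hz i1; have z2 := hz i2; have z3 := hz i3.
have w1 := hw i1; have w2 := hw i2; have w3 := hw i3.
rewrite -(ler_pXn2r (_ : (0 < 2)%N)) ?nnegrE// expr1n h.
set u := bary i1 z - bary i1 w; set v := bary i2 z - bary i2 w.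
have hu : -1 <= u <= 1 by rewrite /u; lra.
have hv : -1 <= v <= 1 by rewrite /v; lra.
have huv : -1 <= u + v <= 1 by rewrite /u /v; lra.
have [u0|u0] := leP 0 u; have [v0|v0] := leP 0 v; nra.
Qed.

Lemma bary_corner i k p z :
  bary k (corner i p z) = p * bary k z + (if pselect (k = i) then 1 - p else 0).
Proof.
have e : corner i p z = p *: z - p *: vtx i + vtx i.
  case: i => //=; rewrite /S1 (_ : A1 R = 0)//.
  by rewrite scaler0 subr0 addr0.
have -> : bary k (corner i p z) = p * bary k z - p * bary k (vtx i) + bary k (vtx i).
  rewrite e; case: z {e} => a b; case: (vtx i) => a' b'.
  by case: k; rewrite /bary /= /GRing.scale /=; ring.
by case: pselect => ki /=; [rewrite ki bary_vtxx|rewrite bary_vtx//]; ring.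
Qed.

Lemma corner_scales i p : 0 < p -> scales_by d p (corner i p).
Proof.
move=> p0 x y; apply/eqP; rewrite -(@eqrXn2 _ 2%N) ?mulr_ge0 ?euclidean_dist_ge0 ?ltW//.
apply/eqP; rewrite exprMn !euclidean_dist_bary !bary_corner; ring.
Qed.

Lemma corner_vtx i p : corner i p (vtx i) = vtx i.
Proof.
apply: bary_inj => k; rewrite bary_corner; case: pselect => ki /=.
  by rewrite ki bary_vtxx; ring.
by rewrite bary_vtx//; ring.
Qed.

Lemma bary_segment a b z : plane_segment a b z -> exists2 t : R, 0 <= t <= 1 &
  forall k, bary k z = (1 - t) * bary k a + t * bary k b.
Proof.
move=> [t]; rewrite /= in_itv/= => t01 <-; exists t => // k'.
by case: k'; case: a b => [a a'] [b b']; rewrite /bary /= /GRing.scale /=; ring.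
Qed.

Lemma dist_vtx i j : i <> j -> d (vtx i) (vtx j) = 1.
Proof.
move=> ij; apply/eqP; rewrite -(@eqrXn2 _ 2%N) ?euclidean_dist_ge0// expr1n.
apply/eqP; rewrite euclidean_dist_bary.
by case: i ij; case: j => // _; rewrite ?bary_vtxx ?bary_vtx//; ring.
Qed.

(* A similarity is determined by the images of the three vertices, because a
   point is determined by its distances to three points in general position. *)
Lemma bary_similarity (f : plane R -> plane R) (r : R) : 0 < r -> scales_by d r f ->
  forall k z, bary k (f z) = bary i1 z * bary k (f (vtx i1)) +
    bary i2 z * bary k (f (vtx i2)) + bary i3 z * bary k (f (vtx i3)).
Proof.
move=> r0 fr k z.
have dd i : (f z).1 ^+ 2 - 2 * (f z).1 * (f (vtx i)).1 + (f (vtx i)).1 ^+ 2 +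
   ((f z).2 ^+ 2 - 2 * (f z).2 * (f (vtx i)).2 + (f (vtx i)).2 ^+ 2) = r ^+ 2 * d z (vtx i) ^+ 2.
  rewrite -exprMn -fr euclidean_dist_sqr; ring.
have dv i j : i <> j -> ((f (vtx i)).1 - (f (vtx j)).1) ^+ 2 +
    ((f (vtx i)).2 - (f (vtx j)).2) ^+ 2 = r ^+ 2.
  by move=> ij; rewrite -euclidean_dist_sqr fr dist_vtx// mulr1.
have D1 := dd i1; have D2 := dd i2; have D3 := dd i3.
have E12 := @dv i1 i2 ltac:(by []); have E13 := @dv i1 i3 ltac:(by []).
have E23 := @dv i2 i3 ltac:(by []).
rewrite !euclidean_dist_bary ?bary_vtxx ?bary_vtx// in D1 D2 D3.
have sz : bary i3 z = 1 - bary i1 z - bary i2 z by have := bary_sum z; lra.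
move: D1 D2 D3 E12 E13 E23; rewrite sz; clear sz dd dv.
move: (bary i1 z) (bary i2 z) => l1 l2.
case: (f z) => w1 w2; case: (f (vtx i1)) => a1 a2; case: (f (vtx i2)) => b1 b2.
case: (f (vtx i3)) => c1 c2 /= D1 D2 D3 E12 E13 E23.
set l3 := 1 - l1 - l2.
pose U1 := b1 - a1; pose U2 := b2 - a2; pose V1 := c1 - a1; pose V2 := c2 - a2.
have UU : U1 ^+ 2 + U2 ^+ 2 = r ^+ 2 by rewrite -E12 /U1 /U2; ring.
have VV : V1 ^+ 2 + V2 ^+ 2 = r ^+ 2 by rewrite -E13 /V1 /V2; ring.
have UV : 2 * (U1 * V1 + U2 * V2) = r ^+ 2.
  have : (U1 - V1) ^+ 2 + (U2 - V2) ^+ 2 = r ^+ 2 by rewrite -E23 /U1 /U2 /V1 /V2; ring.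
  move=> h; transitivity ((U1 ^+ 2 + U2 ^+ 2) + (V1 ^+ 2 + V2 ^+ 2) -
    ((U1 - V1) ^+ 2 + (U2 - V2) ^+ 2)); first by ring.
  by rewrite h UU VV; ring.
(* [X] is the difference of [f z] and the affine combination of the images. It is orthogonal to the
   edges [U] and [V], whose determinant [D] is not zero. *)
pose X1 := w1 - (l1 * a1 + l2 * b1 + l3 * c1).
pose X2 := w2 - (l1 * a2 + l2 * b2 + l3 * c2).
have XU : X1 * U1 + X2 * U2 = 0.
  have WU : (w1 - a1) * U1 + (w2 - a2) * U2 = r ^+ 2 * (l2 + l3 / 2).
    by move: UU; rewrite /U1 /U2 /l3; lra.
  transitivity ((w1 - a1) * U1 + (w2 - a2) * U2 - l2 * (U1 ^+ 2 + U2 ^+ 2) -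
      l3 / 2 * (2 * (U1 * V1 + U2 * V2))); last by rewrite WU UU UV; ring.
  by rewrite /X1 /X2 /U1 /U2 /V1 /V2 /l3; field.
have XV : X1 * V1 + X2 * V2 = 0.
  have WV : (w1 - a1) * V1 + (w2 - a2) * V2 = r ^+ 2 * (l3 + l2 / 2).
    by move: VV; rewrite /V1 /V2 /l3; lra.
  transitivity ((w1 - a1) * V1 + (w2 - a2) * V2 - l3 * (V1 ^+ 2 + V2 ^+ 2) -
      l2 / 2 * (2 * (U1 * V1 + U2 * V2))); last by rewrite WV VV UV; ring.
  by rewrite /X1 /X2 /U1 /U2 /V1 /V2 /l3; field.
pose D := U1 * V2 - U2 * V1.
have DD : 4 * D ^+ 2 = 3 * (r ^+ 2) ^+ 2.
  have : 4 * D ^+ 2 = 4 * (U1 ^+ 2 + U2 ^+ 2) * (V1 ^+ 2 + V2 ^+ 2) - (2 * (U1 * V1 + U2 * V2)) ^+ 2 by rewrite /D; ring.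
  by rewrite UU VV UV => ->; ring.
have D0 : D != 0.
  apply/eqP => h; move: DD; rewrite h expr0n/= mulr0 => /esym/eqP.
  by rewrite mulf_eq0 pnatr_eq0/= !expf_eq0/= (gt_eqF r0).
have X10 : X1 = 0.
  apply: (mulIf D0); rewrite mul0r.
  have : X1 * D = V2 * (X1 * U1 + X2 * U2) - U2 * (X1 * V1 + X2 * V2) by rewrite /D; ring.
  by rewrite XU XV !mulr0 subr0.
have X20 : X2 = 0.
  apply: (mulIf D0); rewrite mul0r.
  have : X2 * D = U1 * (X1 * V1 + X2 * V2) - V1 * (X1 * U1 + X2 * U2) by rewrite /D; ring.
  by rewrite XU XV !mulr0 subr0.
have -> : w1 = l1 * a1 + l2 * b1 + l3 * c1 by apply/eqP; rewrite -subr_eq0; apply/eqP.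
have -> : w2 = l1 * a2 + l2 * b2 + l3 * c2 by apply/eqP; rewrite -subr_eq0; apply/eqP.
by case: k; rewrite /bary /= /l3; ring.
Qed.

Lemma closed_triangle : closed [set z | forall k, 0 <= bary k z].
Proof.
move=> z hz k; rewrite leNgt; apply/negP => lt.
have e0 : 0 < - bary k z / 2 by rewrite divr_gt0// oppr_gt0.
have nb : nbhs z [set w | d z w < - bary k z / 2].
  by apply/nbhs_euclidean; exists (- bary k z / 2).
have [w [hw /= zw]] := hz _ nb.
have := bary_le_dist k w z; rewrite (euclidean_distC w z).
by have := hw k; lra.
Qed.

End barycentric.
Arguments bary {R} i z : simpl never.

(** * The attractors in the triangle *)

Section admissible_system.
Context (R : realType) (p1 p2 p3 : R) (B1 B2 B3 : plane R)
    (K' K : set (plane R)) (S0 : plane R -> plane R) (O : plane R).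
Hypothesis hK' : is_attractor [:: S1 p1; S2 p2; S3 p3] K'.
Hypothesis hadm : admissible K' p1 p2 p3 B1 B2 B3.
Hypothesis hS0 : similarity (@euclidean_dist R) S0.
Hypothesis hS01 : S0 (A1 R) = B1.
Hypothesis hS02 : S0 (A2 R) = B2.
Hypothesis hS03 : S0 (A3 R) = B3.
Hypothesis hK : is_attractor [:: S0; S1 p1; S2 p2; S3 p3] K.
Hypothesis hO : S0 O = O.
Local Notation d := (@euclidean_dist R).
Implicit Types (x y z u : plane R) (i j k : idx).

Definition ratio3 i : R := match i with i1 => p1 | i2 => p2 | i3 => p3 end.

Definition maps4 (c : option idx) : plane R -> plane R :=
  if c is Some i then corner i (ratio3 i) else S0.

(** The ratio of [S0], since the sides of the triangle have length 1. *)
Let r0 := d (S0 (vtx R i1)) (S0 (vtx R i2)).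

Definition ratio4 (c : option idx) : R := if c is Some i then ratio3 i else r0.

Let Delta : set (plane R) := [set z | forall k, 0 <= bary k z].

Let P0 i : 0 < ratio3 i.
Proof. by case: hadm => -[? ? ? _] _ _ _ _; case: i. Qed.

Let Psum : ratio3 i1 + ratio3 i2 + ratio3 i3 < 1.
Proof. by case: hadm => -[? ? ? ?] _ _ _ _. Qed.

Let P2 i j : i <> j -> ratio3 i + ratio3 j < 1.
Proof.
have := Psum; have h1 := P0 i1; have h2 := P0 i2; have h3 := P0 i3.
by case: i; case: j => // h _; lra.
Qed.

Let P1 i : ratio3 i < 1.
Proof.
have h := P2 (nesym (@next_idx_neq i)); have := P0 (next_idx i); lra.
Qed.

Lemma attractor4E x : K x <-> exists c, (maps4 c @` K) x.
Proof.
have [_ _ KE] := hK; rewrite {1}KE !big_cons big_nil setU0; split.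
  move=> [h|[h|[h|h]]]; [exists None|exists (Some i1)|exists (Some i2)|exists (Some i3)] => //.
by move=> [[[]|]]; [right; left|right; right; left|right; right; right|left].
Qed.

Lemma attractor3E x : K' x <-> exists i, (maps4 (Some i) @` K') x.
Proof.
have [_ _ KE] := hK'; rewrite {1}KE !big_cons big_nil setU0; split.
  move=> [h|[h|h]]; [exists i1|exists i2|exists i3] => //.
by move=> [[]]; [left|right; left|right; right].
Qed.

Let bary_cell i k z : bary k (maps4 (Some i) z) =
  ratio3 i * bary k z + (if pselect (k = i) then 1 - ratio3 i else 0).
Proof. exact: bary_corner. Qed.

Let bary_cellxx i z : bary i (maps4 (Some i) z) = ratio3 i * bary i z + (1 - ratio3 i).
Proof. by rewrite bary_cell; case: pselect. Qed.

Let bary_cell_neq i k z : k <> i -> bary k (maps4 (Some i) z) = ratio3 i * bary k z.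
Proof. by move=> ki; rewrite bary_cell; case: pselect => // ?; rewrite addr0. Qed.

Let bary_le1 k z : Delta z -> bary k z <= 1.
Proof.
move=> h; have := bary_sum z; have h1 := h i1; have h2 := h i2; have h3 := h i3.
by case: k; lra.
Qed.

(** The conditions on $B_1,B_2,B_3$ become one under the cyclic order: each names the side opposite
    to vertex [i], where coordinate [i] vanishes. *)
Let junction i : exists u, [/\ Delta u, bary i u = 0, K' (S0 (vtx R i)) &
  S0 (vtx R i) = maps4 (Some i) (maps4 (Some (next_idx i)) u)].
Proof.
have seg (j k : idx) (z : plane R) : i <> j -> i <> k ->
    plane_segment (vtx R j) (vtx R k) z -> Delta z /\ bary i z = 0.
  move=> ij ik /bary_segment[t t01 h]; split; last by rewrite h !bary_vtx// !mulr0 addr0.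
  move=> l; rewrite h; have v n : 0 <= bary l (vtx R n).
    by have [->|ln] := pselect (l = n); rewrite ?bary_vtxx ?bary_vtx.
  by rewrite addr_ge0// mulr_ge0//; lra.
case: hadm => _ _ [K1 [u1 s1 e1]] [K2 [u2 s2 e2]] [K3 [u3 s3 e3]].
case: i seg => seg /=.
- by have [] := seg i2 i3 u1 => // ? ?; exists u1; rewrite hS01.
- by have [] := seg i1 i3 u2 => // ? ?; exists u2; rewrite hS02.
- by have [] := seg i1 i2 u3 => // ? ?; exists u3; rewrite hS03.
Qed.

Let U i : set (plane R) := [set u | [/\ Delta u, bary i u = 0, K' (S0 (vtx R i)) &
  S0 (vtx R i) = maps4 (Some i) (maps4 (Some (next_idx i)) u)]].

Let u_ i := xget (vtx R i1) (U i).

Definition junction_pre i : plane R := maps4 (Some (next_idx i)) (u_ i).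

Let u_P i : [/\ Delta (u_ i), bary i (u_ i) = 0, K' (S0 (vtx R i)) &
  S0 (vtx R i) = maps4 (Some i) (junction_pre i)].
Proof.
have [u hu] := junction i.
exact: (@xgetPex _ (vtx R i1) (U i) (ex_intro _ u hu)).
Qed.

Let C := junction_pre.

Let Delta_cell i z : Delta z -> Delta (maps4 (Some i) z).
Proof.
move=> h k; rewrite bary_cell; have := P0 i; have := P1 i; have := h k.
by case: pselect => _ /= *; nra.
Qed.

Let bary_C i : bary i (C i) = 0.
Proof.
have [_ h _ _] := u_P i; rewrite /C /junction_pre bary_cell_neq ?h ?mulr0//.
exact: nesym (@next_idx_neq i).
Qed.

Let Delta_C i : Delta (C i).
Proof. by apply: Delta_cell; have [] := u_P i. Qed.

Let bary_Bxx i : bary i (S0 (vtx R i)) = 1 - ratio3 i.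
Proof. by have [_ _ _ ->] := u_P i; rewrite bary_cellxx bary_C mulr0 add0r. Qed.

Let bary_B_neq i k : k <> i -> bary k (S0 (vtx R i)) = ratio3 i * bary k (C i).
Proof. by move=> ki; have [_ _ _ ->] := u_P i; rewrite bary_cell_neq. Qed.

Let bary_B_bound i k : k <> i -> 0 <= bary k (S0 (vtx R i)) <= ratio3 i.
Proof.
move=> ki; rewrite bary_B_neq//; have := P0 i; have := Delta_C i k.
by have := bary_le1 k (Delta_C i); nra.
Qed.

Let bary_S0 k z : bary k (S0 z) = bary i1 z * bary k (S0 (vtx R i1)) +
    bary i2 z * bary k (S0 (vtx R i2)) + bary i3 z * bary k (S0 (vtx R i3)).
Proof. by have [r rr0 hr] := hS0; apply: (bary_similarity rr0 hr). Qed.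

Let bary_B_ge0 i k : 0 <= bary k (S0 (vtx R i)).
Proof.
have [->|ki] := pselect (k = i); first by rewrite bary_Bxx; have := P1 i; lra.
by case/andP: (bary_B_bound ki).
Qed.

Let Delta_S0 z : Delta z -> Delta (S0 z).
Proof. by move=> h k; rewrite bary_S0 !addr_ge0// mulr_ge0. Qed.

Let Delta_maps4 c z : Delta z -> Delta (maps4 c z).
Proof. by case: c => [i|]; [exact: Delta_cell|exact: Delta_S0]. Qed.

Let bary_S0_le i z : Delta z -> bary i (S0 z) <= 1 - ratio3 i.
Proof.
move=> h; rewrite bary_S0; have s := bary_sum z.
have h1 := h i1; have h2 := h i2; have h3 := h i3.
have b j : bary i (S0 (vtx R j)) <= 1 - ratio3 i.
  have [<-|ij] := pselect (i = j); first by rewrite bary_Bxx.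
  by have := bary_B_bound ij; have := P2 ij; lra.
by have := b i1; have := b i2; have := b i3; nra.
Qed.

(** Coordinate [i] is $1-p_i$ at $B_i$ and at most $p_j<1-p_i$ at the other $B_j$, so a convex
    combination of them reaches $1-p_i$ at $B_i$ alone. As cell [i] has coordinate at least $1-p_i$,
    it meets the centre nowhere else. *)
Let bary_S0_eq i z : Delta z -> 1 - ratio3 i <= bary i (S0 z) -> z = vtx R i.
Proof.
move=> h; rewrite bary_S0 => le; apply: bary_eq1 => //; have s := bary_sum z.
have h1 := h i1; have h2 := h i2; have h3 := h i3.
have b j : i <> j -> bary i (S0 (vtx R j)) < 1 - ratio3 i.
  by move=> ij; have := bary_B_bound ij; have := P2 ij; lra.
have bb := bary_Bxx i.
have null (l m e f : R) : 0 <= l -> 0 <= m -> 0 < e -> 0 < f -> l * e + m * f <= 0 -> l + m <= 0.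
  move=> l0 m0 e0 f0 le0; have lle : l * e <= 0 by have := mulr_ge0 m0 (ltW f0); lra.
  have mf : m * f <= 0 by have := mulr_ge0 l0 (ltW e0); lra.
  by move: lle mf; rewrite !pmulr_lle0//; lra.
have e j : i <> j -> 0 < 1 - ratio3 i - bary i (S0 (vtx R j)) by move=> /b; rewrite subr_gt0.
case: i le b bb e => le b bb e.
- have := null _ _ _ _ h2 h3 (e i2 ltac:(by [])) (e i3 ltac:(by [])); nra.
- have := null _ _ _ _ h1 h3 (e i1 ltac:(by [])) (e i3 ltac:(by [])); nra.
- have := null _ _ _ _ h1 h2 (e i1 ltac:(by [])) (e i2 ltac:(by [])); nra.
Qed.

Let S0_scales : scales_by d r0 S0.
Proof.
have [r rr0 hr] := hS0 => x y; rewrite hr; congr (_ * _).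
by rewrite /r0 hr dist_vtx// mulr1.
Qed.

Let r0_gt0 : 0 < r0.
Proof. by have [r rr0 hr] := hS0; rewrite /r0 hr dist_vtx// mulr1. Qed.

(** From $B_2$ to $B_1$ the first two coordinates change by numbers of opposite signs and absolute
    values $u,v<1$, and $u^2-uv+v^2\le\max(u,v)^2$. *)
Let r0_lt1 : r0 < 1.
Proof.
rewrite -(@ltr_pXn2r _ 2%N) ?nnegrE ?euclidean_dist_ge0// expr1n euclidean_dist_bary !bary_Bxx.
have h1 := @bary_B_bound i2 i1 ltac:(by []); have h2 := @bary_B_bound i1 i2 ltac:(by []).
have := @P2 i1 i2 ltac:(by []); have := P0 i1; have := P0 i2.
set x := bary i1 _ in h1 *; set y := bary i2 _ in h2 *.
set a := ratio3 i1 in h1 h2 *; set b := ratio3 i2 in h1 h2 *; move=> a0 b0 ab.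
have hu : 0 < 1 - a - x < 1 by lra.
have hv : 0 < 1 - b - y < 1 by lra.
have : (1 - a - x) ^+ 2 - (1 - a - x) * (1 - b - y) + (1 - b - y) ^+ 2 < 1.
  have [le|/ltW le] := leP (1 - a - x) (1 - b - y); nra.
by congr (_ < _); ring.
Qed.

Let rho := Num.max r0 (Num.max p1 (Num.max p2 p3)).

Let ratio4_gt0 c : 0 < ratio4 c.
Proof. by case: c => [i|]; [exact: P0|exact: r0_gt0]. Qed.

Let ratio4_le c : ratio4 c <= rho.
Proof.
by rewrite /rho; case: c => [[]|] /=; rewrite !le_max lexx ?orbT.
Qed.

Let rho01 : 0 < rho < 1.
Proof.
rewrite (lt_le_trans r0_gt0 (ratio4_le None))/= /rho !gt_max r0_lt1.
by rewrite (P1 i1) (P1 i2) (P1 i3).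
Qed.

Let maps4_scales c : scales_by d (ratio4 c) (maps4 c).
Proof. by case: c => [i|]; [apply: corner_scales; exact: P0|exact: S0_scales]. Qed.

Let compK : compact K. Proof. by case: hK. Qed.
Let compK' : compact K'. Proof. by case: hK'. Qed.
Let closedc (X : set (plane R)) : compact X -> closed X.
Proof. by apply: compact_closed; apply: plane_hausdorff. Qed.

Let maps4K c x : K x -> K (maps4 c x).
Proof. by move=> Kx; apply/attractor4E; exists c; exists x. Qed.

Let maps4K' i x : K' x -> K' (maps4 (Some i) x).
Proof. by move=> Kx; apply/attractor3E; exists i; exists x. Qed.

Let Delta_vtx i : Delta (vtx R i).
Proof. by move=> k; have [->|ki] := pselect (k = i); rewrite ?bary_vtxx ?bary_vtx. Qed.

Lemma attractor4_triangle x : K x -> Delta x.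
Proof.
apply: (@invariant_subset R (option idx) maps4 ratio4 rho) => //.
- by move=> y /attractor4E.
- exact: closed_triangle.
- by exists (vtx R i1); apply: Delta_vtx.
Qed.

Lemma attractor3_sub : K' `<=` K.
Proof.
apply: (@invariant_subset R idx (fun i => maps4 (Some i)) (fun i => ratio4 (Some i)) rho) => //.
- by move=> y /attractor3E.
- exact: closedc.
- by case: hK.
- by move=> i x; apply: maps4K.
Qed.

Let K'Delta x : K' x -> Delta x.
Proof. by move=> /attractor3_sub/attractor4_triangle. Qed.

Let cell_ge i z : Delta z -> 1 - ratio3 i <= bary i (maps4 (Some i) z).
Proof. by move=> h; rewrite bary_cellxx lerDr mulr_ge0 ?(ltW (P0 i)). Qed.

Let cell_le i j z : i <> j -> Delta z -> bary j (maps4 (Some i) z) <= ratio3 i.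
Proof.
move=> ij h; rewrite bary_cell_neq; last exact: nesym.
by rewrite ler_piMr ?(ltW (P0 i))// bary_le1.
Qed.

(** In another cell [j] coordinate [i] is at most $p_j<1-p_i$. Applied to $B_i$, this puts $C_i$
    into [K']. *)
Let K'_cell i x : K' x -> 1 - ratio3 i <= bary i x -> (maps4 (Some i) @` K') x.
Proof.
move=> /attractor3E[j [y K'y <-]] le.
have [<-|ij] := pselect (j = i); first by exists y.
by have := cell_le ij (K'Delta K'y); have := P2 ij; lra.
Qed.

Let K'C i : K' (C i).
Proof.
have [_ _ KB BE] := u_P i.
have [|y K'y yB] := K'_cell (i := i) KB; first by rewrite bary_Bxx.
suff -> : C i = y by [].
by apply: (scales_by_inj (P0 i) (maps4_scales (Some i))); rewrite yB BE.
Qed.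

Let K'C_next i : (maps4 (Some (next_idx i)) @` K') (C i).
Proof. by apply: K'_cell => //; apply: cell_ge; have [] := u_P i. Qed.

Let K'A i : K' (vtx R i).
Proof.
have vE : maps4 (Some i) (vtx R i) = vtx R i by exact: corner_vtx.
suff : [set vtx R i] `<=` K' by apply.
apply: (@invariant_subset R unit (fun=> maps4 (Some i)) (fun=> ratio3 i) rho) => //.
- by move=> _; exact: (ratio4_le (Some i)).
- by move=> _; exact: (maps4_scales (Some i)).
- exact: compact_set1.
- by move=> x ->; exists tt; exists (vtx R i).
- exact: closedc.
- by case: hK'.
- by move=> _ x; apply: maps4K'.
Qed.

Let KO : K O.
Proof.
suff : [set O] `<=` K by apply.
apply: (@invariant_subset R unit (fun=> S0) (fun=> r0) rho) => //.
- by move=> _; exact: (ratio4_le None).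
- exact: compact_set1.
- by move=> x ->; exists tt; exists O.
- exact: closedc.
- by case: hK.
- by move=> _ x; apply: (maps4K None).
Qed.

Lemma admissible_arc_system :
  arc_system K K' maps4 ratio4 rho ((1 - (p1 + p2 + p3)) / 2) (vtx R) junction_pre O.
Proof.
have KD := attractor4_triangle.
split => //.
- split => //.
  + by move=> x y /KD hx /KD hy; apply: triangle_diam.
  + by move=> x /attractor4E.
  + by move=> i; apply: attractor3_sub.
  + by move=> i; apply: attractor3_sub; apply: K'C.
  + by move=> i; have [_ _ _ <-] := u_P i.
  + move=> i j x y /KD hx /KD hy e; apply: contrapT => ij.
    have := cell_ge i hx; rewrite e => h1; have := cell_le (nesym ij) hy.
    by have := P2 ij; lra.
  + move=> i x y /KD hx /KD hy e; apply: (bary_S0_eq hx).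
    by rewrite -[S0]/(maps4 None) e; apply: cell_ge.
- exact: attractor3_sub.
- by move=> x /attractor3E.
- by move=> i; apply: corner_vtx.
- by move=> i x /KD hx e; have := bary_S0_le i hx; rewrite -[S0]/(maps4 None) e bary_vtxx; have := P0 i; lra.
- by rewrite divr_gt0// subr_gt0.
(* Coordinate [i] is at least $1-p_i$ on one cell and at most $p_j$ on the other; the constant 2 of
   [bary_le_dist] halves the difference. *)
- move=> i j x y ij /KD hx /KD hy.
  have := bary_le_dist i (maps4 (Some i) x) (maps4 (Some j) y).
  have := cell_ge i hx; have := cell_le (nesym ij) hy.
  have h : ratio3 i + ratio3 j <= p1 + p2 + p3.
    have := P0 i1; have := P0 i2; have := P0 i3.
    by case: i ij {hx hy}; case: j => //= _; lra.
  lra.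
Qed.

Lemma bary_axis z : (bary i3 z = 0) <-> z.2 = 0.
Proof.
have q0 : Num.sqrt (3 : R) != 0 by rewrite gt_eqF// sqrtr_gt0.
rewrite /bary; split; last by move=> ->; rewrite mul0r mulr0.
by move/eqP; rewrite !mulf_eq0 pnatr_eq0/= invr_eq0 (negPf q0) orbF => /eqP.
Qed.

Lemma axis_segmentP (a b : R) z : a < b ->
  axis_segment a b z <-> z.2 = 0 /\ a <= z.1 <= b.
Proof.
move=> ab; have ba : 0 < b - a by rewrite subr_gt0.
split.
  move=> [t /=]; rewrite in_itv/= => /andP[t0 t1] <-.
  by split; rewrite /GRing.scale /= /GRing.scale/=; [ring|nra].
move=> [z2 z1]; exists ((z.1 - a) / (b - a)).
  by rewrite /= in_itv/= divr_ge0 ?ler_pdivrMr ?mul1r//; lra.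
have E (t : R) : (1 - t) *: ((a, 0) : plane R) + t *: ((b, 0) : plane R) =
    ((1 - t) * a + t * b, 0).
  by apply: injective_projections => //=; rewrite !scaler0 addr0.
rewrite E; case: z z1 z2 => z1 z2 /= h ->; congr (_, _).
by field; rewrite gt_eqF.
Qed.

Definition axis_part : set (plane R) := [set x | K x /\ bary i3 x = 0].

Let C1_axis : bary i3 (S0 (vtx R i1)) = 0 -> axis_part (C i1).
Proof.
rewrite bary_B_neq// => /eqP; rewrite mulf_eq0 (gt_eqF (P0 i1))/= => /eqP h.
by split => //; apply: attractor3_sub; apply: K'C.
Qed.

(** Coordinate [i3] is positive at $B_2$ and $B_3$, so the centre touches the side $[A_1A_2]$ at
    most in $B_1=S_1(C_1)$, a point of the first cell. *)
Lemma axis_part_cells x : axis_part x <->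
  (maps4 (Some i1) @` axis_part) x \/ (maps4 (Some i2) @` axis_part) x.
Proof.
split; last first.
  by move=> [] [y [Ky y3] <-]; split; rewrite ?bary_cell_neq ?y3 ?mulr0//; apply: maps4K.
move=> [/attractor4E[[i|] [y Ky yx]] x3].
  have Dy := attractor4_triangle Ky.
  case: i yx => yx; [left|right|]; last first.
  + have := cell_ge i3 Dy; rewrite yx x3; have := P1 i3; lra.
  + exists y => //; split => //; move: x3; rewrite -yx bary_cell_neq// => /eqP.
    by rewrite mulf_eq0 (gt_eqF (P0 i2))/= => /eqP.
  + exists y => //; split => //; move: x3; rewrite -yx bary_cell_neq// => /eqP.
    by rewrite mulf_eq0 (gt_eqF (P0 i1))/= => /eqP.
have Dy := attractor4_triangle Ky.
have := x3; rewrite -yx -[maps4 None y]/(S0 y) bary_S0 => h.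
have h1 := Dy i1; have h2 := Dy i2; have h3 := Dy i3.
have b1 := bary_B_ge0 i1 i3; have b2 := bary_B_ge0 i2 i3.
have b3 : 0 < bary i3 (S0 (vtx R i3)) by rewrite bary_Bxx subr_gt0.
have b2' : 0 < bary i3 (S0 (vtx R i2)).
  rewrite bary_B_neq// mulr_gt0// /C /junction_pre.
  by have [Du _ _ _] := u_P i2; apply: lt_le_trans (cell_ge i3 Du); rewrite subr_gt0.
have y3 : bary i3 y = 0 by nra.
have y2 : bary i2 y = 0 by nra.
have yA : y = vtx R i1.
  by apply: bary_eq1 => //; have := bary_sum y; lra.
left; exists (C i1).
  by apply: C1_axis; move: x3; rewrite -yx yA.
by have [_ _ _ <-] := u_P i1; rewrite yA.
Qed.

Lemma axis_part_compact : compact axis_part.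
Proof.
have -> : axis_part = K `&` [set x | bary i3 x <= 0].
  apply/seteqP; split => x [Kx /= h]; split => //=; first by rewrite h.
  by apply/eqP; rewrite eq_le h /=; exact: (attractor4_triangle Kx i3).
apply: compact_closedI => // z hz; rewrite /= leNgt; apply/negP => lt.
have nb : nbhs z [set w | d z w < bary i3 z / 2].
  by apply/nbhs_euclidean; exists (bary i3 z / 2) => //; rewrite divr_gt0.
have [w [/= hw zw]] := hz _ nb.
have := bary_le_dist i3 z w; lra.
Qed.

(** Two corner maps already cover the trace of [K] on the side, so this trace lies in [K']. *)
Lemma axis_part_sub : axis_part `<=` K'.
Proof.
pose f (b : bool) := maps4 (Some (if b then i1 else i2)).
pose g (b : bool) := ratio4 (Some (if b then i1 else i2)).
apply: (@invariant_subset R bool f g rho) => //.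
- by move=> b; apply: ratio4_gt0.
- by move=> b; apply: ratio4_le.
- by move=> b; apply: maps4_scales.
- exact: axis_part_compact.
- by move=> x /axis_part_cells[]; [exists true|exists false].
- exact: closedc.
- by case: hK'.
- by move=> b x; apply: maps4K'.
Qed.

Lemma axis_part_nonempty : axis_part !=set0.
Proof.
exists (vtx R i1); split; first exact: attractor3_sub.
by rewrite bary_vtx.
Qed.

Let axis_01 x : K x -> (axis_segment 0 1 x <-> bary i3 x = 0).
Proof.
move=> /attractor4_triangle h; rewrite (axis_segmentP _ ltr01) bary_axis; split; first by case.
move=> x2; split => //; have := h i1; have := h i2; rewrite /bary x2 mul0r; lra.
Qed.

Lemma attractor3_axis : K' `&` axis_segment 0 1 = axis_part.
Proof.
apply/seteqP; split => x.
  by move=> [/attractor3_sub Kx /(axis_01 Kx)].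
by move=> h; split; [exact: axis_part_sub|case: h => Kx /(axis_01 Kx)].
Qed.

Let axis_cells x : axis_part x -> bary i1 x = 1 - x.1 /\ bary i2 x = x.1.
Proof. by move=> [Kx /bary_axis x2]; rewrite /bary x2 mul0r !subr0. Qed.

Let axis_K x (a b : R) : 0 <= a -> a < b -> b <= 1 -> K x ->
  axis_segment a b x <-> axis_part x /\ a <= x.1 <= b.
Proof.
move=> a0 ab b1 Kx; rewrite (axis_segmentP _ ab) -bary_axis; split; first by case=> h ?.
by case=> -[_ h] ?.
Qed.

Lemma attractor4_axis_left : K `&` axis_segment 0 p1 = maps4 (Some i1) @` axis_part.
Proof.
have ax x := @axis_K x 0 p1 (lexx _) (P0 i1) (ltW (P1 i1)).
apply/seteqP; split => x.
  move=> [Kx /(ax x Kx)[Ex x1]]; have [e1 e2] := axis_cells Ex.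
  have [//|[y [Ky _] yx]] := (axis_part_cells x).1 Ex.
  have := cell_ge i2 (attractor4_triangle Ky); rewrite yx e2.
  by have := @P2 i1 i2 ltac:(by []); move: x1; rewrite /=; lra.
move=> hx; have Ex : axis_part x by apply/axis_part_cells; left.
have Kx : K x by case: Ex.
split => //; apply/(ax x Kx); split => //; have [e1 e2] := axis_cells Ex.
case: hx => y [Ky _] yx; have := cell_ge i1 (attractor4_triangle Ky).
rewrite yx e1 -e2 /= (attractor4_triangle Kx); lra.
Qed.

Lemma attractor4_axis_right : K `&` axis_segment (1 - p2) 1 = maps4 (Some i2) @` axis_part.
Proof.
have p20 : 0 <= 1 - p2 by have := P1 i2; rewrite /=; lra.
have p21 : 1 - p2 < 1 by have := P0 i2; rewrite /=; lra.
have ax x := @axis_K x (1 - p2) 1 p20 p21 (lexx _).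
apply/seteqP; split => x.
  move=> [Kx /(ax x Kx)[Ex x1]]; have [e1 e2] := axis_cells Ex.
  have [[y [Ky _] yx]|//] := (axis_part_cells x).1 Ex.
  have := cell_ge i1 (attractor4_triangle Ky); rewrite yx e1.
  by have := @P2 i1 i2 ltac:(by []); move: x1; rewrite /=; lra.
move=> hx; have Ex : axis_part x by apply/axis_part_cells; right.
have Kx : K x by case: Ex.
split => //; apply/(ax x Kx); split => //; have [e1 e2] := axis_cells Ex.
case: hx => y [Ky _] yx; have := cell_ge i2 (attractor4_triangle Ky).
rewrite yx e2 /=; have := attractor4_triangle Kx i1; rewrite e1; lra.
Qed.

Lemma junction_pre_opposite : bary i1 (junction_pre i1) = 0.
Proof. exact: bary_C. Qed.

(** The cell of [i1] misses the opposite side. In the cell of [i3] the position on the side is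
    forgotten: every arc from there to the axis passes through $O$. *)
Lemma opposite_cells c : K' c -> bary i1 c = 0 ->
  (exists2 y, K' y /\ bary i1 y = 0 & maps4 (Some i2) y = c) \/
  (exists2 y, K' y & maps4 (Some i3) y = c).
Proof.
move=> /attractor3E[[] [y K'y yc]] c1.
- have := cell_ge i1 (K'Delta K'y); rewrite yc c1; have := P1 i1; lra.
- left; exists y => //; split => //; move: c1; rewrite -yc bary_cell_neq// => /eqP.
  by rewrite mulf_eq0 (gt_eqF (P0 i2))/= => /eqP.
- by right; exists y.
Qed.

End admissible_system.

(** * The sets of lengths *)

Section real_line.
Context (R : realType).
Implicit Types (t a b : R) (X : set R).

Lemma real_dist_ge0 (x y : R) : 0 <= real_dist x y.
Proof. exact: normr_ge0. Qed.

Lemma affine_scales a b : 0 < a -> scales_by (@real_dist R) a (fun x => a * x + b).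
Proof.
move=> a0 x y; rewrite /real_dist -[in RHS](gtr0_norm a0) -normrM.
by congr `|_|; ring.
Qed.

(* Every vertex carries two edges, indexed by [bool]; they may coincide. *)
Lemma affine_gd_attractor (V : finType) (tgt : V -> bool -> V) (ratio shift : V -> bool -> R)
    (X : V -> set R) : (forall v (e : bool), 0 < ratio v e < 1) ->
  (forall v, X v !=set0) -> (forall v, compact (X v)) ->
  (forall v, X v = [set x | exists e : bool, exists2 y, X (tgt v e) y & ratio v e * y + shift v e = x]) ->
  exists (G : gd_system R) (Y : vertex G -> set R) (f : V -> vertex G),
    is_gd_attractor Y /\ forall v, Y (f v) = X v.
Proof.
move=> r01 X0 cX XE.
pose emap (e : V * bool) x := ratio e.1 e.2 * x + shift e.1 e.2.
have outs v : exists e : V * bool, e.1 = v by exists (v, true).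
have contr e : contracting_similarity (@real_dist R) (emap e).
  exists (ratio e.1 e.2); first exact: r01.
  by apply: affine_scales; case/andP: (r01 e.1 e.2).
exists (@GDSystem R V (V * bool)%type fst (fun e => tgt e.1 e.2) emap outs contr), X, id.
split => // v; split => //; apply/seteqP; split => x.
  by rewrite {1}XE => -[b [y Xy <-]]; exists (v, b) => //; exists y.
by move=> [[w b] /= -> [y Xy <-]]; rewrite XE; exists b, y.
Qed.

Lemma hausdorff_measure_affine t a b X : 0 <= t -> 0 < a ->
  hausdorff_measure (@real_dist R) t [set a * x + b | x in X] = 0%E ->
  hausdorff_measure (@real_dist R) t X = 0%E.
Proof.
move=> t0 a0 h; have d0 := real_dist_ge0.
have XE : X = (fun y => a^-1 * (y - b)) @` [set a * x + b | x in X].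
  rewrite image_comp -[LHS]image_id; apply: eq_imagel => x _ /=.
  by rewrite addrK mulKf// gt_eqF.
apply/eqP; rewrite eq_le hausdorff_measure_ge0// andbT {1}XE.
apply: (@le_trans _ _ ((a^-1 `^ t)%:E * hausdorff_measure (@real_dist R) t
    [set (a * x + b)%R | x in X])%E).
  apply: hausdorff_measure_image => //; first by rewrite invr_gt0.
  move=> x y _ _; rewrite /real_dist -mulrBr normrM ger0_norm ?invr_ge0 ?(ltW a0)//.
  by rewrite opprB addrA subrK.
by rewrite h mule0.
Qed.

Lemma hausdorff_dim_le (T T' : Type) (d : T -> T -> R) (d' : T' -> T' -> R)
    (X : set T) (Y : set T') :
  (forall t, 0 <= t -> hausdorff_measure d t X = 0%E -> hausdorff_measure d' t Y = 0%E) ->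
  (hausdorff_dim d' Y <= hausdorff_dim d X)%E.
Proof.
move=> h; apply: le_ereal_inf => _ [t [t0 ht] <-].
by exists t => //; split => //; apply: h.
Qed.

Lemma hausdorff_measure_above_dim (T : Type) (d : T -> T -> R) (X : set T) t :
  (forall x y, 0 <= d x y) -> (hausdorff_dim d X < t%:E)%E -> hausdorff_measure d t X = 0%E.
Proof.
move=> d0 /ereal_inf_lt[_ [t' [t'0 ht'] <-]]; rewrite lte_fin => tt.
by apply: (hausdorff_measure_eq0_le d0 _ ht'); rewrite t'0 ltW.
Qed.

End real_line.

(** The distance to [x] is 1-Lipschitz, and its image of [X] is an interval containing 0 and the
    distance from [x] to [y]. *)
Lemma connected_measure_neq0 (R : realType) (X : set (plane R)) (x y : plane R) (t : R) :
  connected X -> X x -> X y -> x <> y -> 0 <= t <= 1 ->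
  hausdorff_measure (@euclidean_dist R) t X <> 0%E.
Proof.
move=> cX Xx Xy xy t01 h; have d0 := @euclidean_dist_ge0 R; have rd0 := @real_dist_ge0 R.
have t0 : 0 <= t by case/andP: t01.
pose f z := euclidean_dist x z.
have f1 u v : X u -> X v -> `|f u - f v| <= 1 * euclidean_dist u v.
  move=> _ _; rewrite mul1r ler_norml /f.
  have := euclidean_dist_tri x u v; have := euclidean_dist_tri x v u.
  by rewrite (euclidean_distC v u); lra.
have := hausdorff_measure_segment (euclidean_dist_gt0 xy) t01; apply.
apply/eqP; rewrite eq_le hausdorff_measure_ge0// andbT.
apply: (@le_trans _ _ (hausdorff_measure (@real_dist R) t (f @` X))).
  apply: hausdorff_measure_sub => z; rewrite /= in_itv/= => zI.
  have : connected (f @` X).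
    by apply: connected_continuous_connected => //; apply: (lipschitz_within_real ltr01 f1).
  move=> /connected_intervalP /(_ 0 (euclidean_dist x y)); apply => //.
    by exists x => //; apply: euclidean_distxx.
  by exists y.
apply: le_trans (hausdorff_measure_image d0 rd0 t0 ltr01 f1) _.
by rewrite h mule0.
Qed.

(** * The graph-directed system of length sets *)

Section length_sets.
Context (R : realType) (K Q : set (plane R)) (S : option idx -> plane R -> plane R)
  (r : option idx -> R) (rho eps : R) (A C : idx -> plane R) (O : plane R) (s : R).
Hypothesis sys : arc_system K Q S r rho eps A C O.
Local Notation d := (@euclidean_dist R).
Local Notation gam := (arc_in K).
Local Notation Sc i := (S (Some i)).
Local Notation S0 := (S None).
Hypothesis s_ge1 : 1 <= s.
Hypothesis side_dim : forall t, s < t -> hausdorff_measure d t (gam (A i1) (A i2)) = 0%E.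
Context (E D : set (plane R)).
Hypothesis E_compact : compact E.
Hypothesis E0 : E !=set0.
Hypothesis EQ : E `<=` Q.
Hypothesis E_cells : forall x, E x <-> (Sc i1 @` E) x \/ (Sc i2 @` E) x.
Hypothesis DQ : D `<=` Q.
Hypothesis D_C : D (C i1).
Hypothesis D_cells : forall c, D c -> (exists2 y, D y & Sc i2 y = c) \/ (exists2 y, Q y & Sc i3 y = c).
Implicit Types (x y z c : plane R).

Local Notation len := (len K s).
Let ratio (e : option idx) := r e `^ s.

Let ratio01 e : 0 < ratio e < 1.
Proof.
have rc := ds_gt0 sys e; have rc1 : r e < 1.
  by apply: le_lt_trans (ds_le sys e) _; case/andP: (ds_rho sys).
rewrite powR_gt0//=; apply: le_lt_trans (rc1); rewrite -[leRHS]powRr1 ?(ltW rc)//.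
by apply: ger_powR => //; rewrite rc (ltW rc1).
Qed.

Let dE x y : E x -> E y -> d x y <= 1.
Proof. by move=> /EQ/(as_QK sys) Kx /EQ/(as_QK sys) Ky; apply: (ds_diam sys). Qed.

(** [powR_small_sum] gives an exponent below 1 at which the two pieces of [E] still contract the
    content. *)
Lemma axis_dim_lt1 : (hausdorff_dim d E < 1)%E.
Proof.
have d0 := @euclidean_dist_ge0 R.
have r1 := ds_gt0 sys (Some i1); have r2 := ds_gt0 sys (Some i2).
have rs : r (Some i1) + r (Some i2) < 1.
  by have := as_sum sys; have := ds_gt0 sys (Some i3); lra.
have [t /andP[t0 t1] ts] := powR_small_sum r1 r2 rs.
apply: (@le_lt_trans _ _ t%:E); last by rewrite lte_fin.
apply: ereal_inf_lbound; exists t => //; split; first exact: ltW.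
have q01 : 0 <= r (Some i1) `^ t + r (Some i2) `^ t < 1 by rewrite ts addr_ge0 ?powR_ge0.
apply: (hausdorff_measure_contract d0 (ltW t0) q01 (ds_rho sys) ltr01 dE) => delta de0.
have part i : (hausdorff_content d t delta (Sc i @` E) <=
    (r (Some i) `^ t)%:E * hausdorff_content d t (delta / rho) E)%E.
  have ri := ds_gt0 sys (Some i).
  rewrite -[delta in leLHS](divfK (lt0r_neq0 ri)) mulrC.
  apply: le_trans (hausdorff_content_image d0 d0 (delta / r (Some i)) (ltW t0) ri _) _.
    by move=> x y _ _; rewrite (ds_scales sys).
  apply: lee_wpmul2l; first by rewrite lee_fin powR_ge0.
  apply: hausdorff_content_antitone; rewrite ler_pM2l// lef_pV2 ?posrE//.
    exact: (ds_le sys).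
  by case/andP: (ds_rho sys).
apply: (@le_trans _ _ (hausdorff_content d t delta (Sc i1 @` E `|` Sc i2 @` E))).
  by apply: hausdorff_content_sub => x /E_cells.
apply: le_trans (hausdorff_content_setU _ _ _ _ _) _ => //.
rewrite EFinD ge0_muleDl ?lee_fin ?powR_ge0//.
by apply: leeD.
Qed.

Let M := [set len O x | x in Sc i1 @` E].
Let N := [set len O x | x in Sc i2 @` E].

Let E_sub i x : i = i1 \/ i = i2 -> E x -> E (Sc i x).
Proof. by move=> ii Ex; apply/E_cells; case: ii => ->; [left|right]; exists x. Qed.

Let lens c := [set len c y | y in E].

Let lensO : lens O = M `|` N.
Proof.
apply/seteqP; split => t.
  by move=> [y /E_cells[] hy <-]; [left|right]; exists y.
by case=> -[y hy <-]; exists y => //; apply/E_cells; [left|right].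
Qed.

Let Q_C i : Q (C i). Proof. exact: (as_QC sys). Qed.

Let ME : M = [set ratio (Some i1) * t + ratio None * len O (A i1) | t in lens (C i1)].
Proof.
apply/seteqP; split => t.
  move=> [_ [y Ey <-] <-]; exists (len (C i1) y); first by exists y.
  by rewrite (len_cell sys s_ge1 side_dim) 1?addrC//; apply: EQ.
move=> [_ [y Ey <-] <-]; exists (Sc i1 y); first by exists y.
by rewrite (len_cell sys s_ge1 side_dim) 1?addrC//; apply: EQ.
Qed.

Let len_center i c y : i <> i1 -> i <> i2 -> Q c -> E y ->
  len (Sc i c) y = len (Sc i c) O + len O y.
Proof.
move=> n1 n2 Qc /E_cells[] [y' /EQ Qy' <-];
  exact: (len_through_O sys s_ge1 side_dim).
Qed.

Let shiftN := ratio (Some i2) * len (C i2) O + ratio None * len O (A i2).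

(** [C i2] lies in the cell of [i3], so all arcs from it to [E] pass through [O] and its set of
    lengths is a translate of [lens O]. *)
Let NE : N = [set ratio (Some i2) * t + shiftN | t in M `|` N].
Proof.
have C2 : forall y, E y -> len (C i2) y = len (C i2) O + len O y.
  by have [c Qc <-] := as_Cnext sys i2 => y Ey; apply: len_center.
have key y : E y -> len O (Sc i2 y) = ratio (Some i2) * len O y + shiftN.
  move=> Ey; rewrite (len_cell sys s_ge1 side_dim); last exact: EQ.
  by rewrite C2// /shiftN /ratio; ring.
rewrite -lensO; apply/seteqP; split => t.
  by move=> [_ [y Ey <-] <-]; exists (len O y); [exists y|rewrite key].
by move=> [_ [y Ey <-] <-]; exists (Sc i2 y); [exists y|rewrite key].
Qed.

Let lens_next c : Q c -> lens (Sc i2 c) =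
  [set t + len (Sc i2 c) O | t in M] `|` [set ratio (Some i2) * t | t in lens c].
Proof.
move=> Qc; have k1 y : E y -> len (Sc i2 c) (Sc i1 y) = len O (Sc i1 y) + len (Sc i2 c) O.
  by move=> /EQ Qy; rewrite (len_through_O sys s_ge1 side_dim) 1?addrC.
have k2 y : E y -> len (Sc i2 c) (Sc i2 y) = ratio (Some i2) * len c y.
  by move=> /EQ Qy; rewrite (len_scale sys s_ge1 side_dim).
apply/seteqP; split => t.
  move=> [_ /E_cells[] [y Ey <-] <-]; [left|right].
    by rewrite k1//; exists (len O (Sc i1 y)) => //; exists (Sc i1 y) => //; exists y.
  by rewrite k2//; exists (len c y) => //; exists y.
move=> [[_ [_ [y Ey <-] <-] <-]|[_ [y Ey <-] <-]].
  by exists (Sc i1 y); [apply: E_sub => //; left|rewrite k1].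
by exists (Sc i2 y); [apply: E_sub => //; right|rewrite k2].
Qed.

Let lens_last c : Q c -> lens (Sc i3 c) = [set t + len (Sc i3 c) O | t in M `|` N].
Proof.
move=> Qc; rewrite -lensO; apply/seteqP; split => t.
  by move=> [y Ey <-]; exists (len O y); [exists y|rewrite [RHS]len_center 1?addrC].
by move=> [_ [y Ey <-] <-]; exists y => //; rewrite len_center 1?addrC.
Qed.

(* Take preimages of [C i1] under [Sc i2] until they leave the cell of [i2];
   if they never do, then [C i1] is the fixed point of [Sc i2]. *)
Let chain : exists n (c : nat -> plane R) (b : bool),
  [/\ c 0%N = C i1, forall k, Q (c k), forall k, (k < n)%N -> c k = Sc i2 (c k.+1) &
    if b then exists2 u, Q u & c n = Sc i3 u else c n = Sc i2 (c n)].
Proof.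
pose last3 c := exists2 y, Q y & Sc i3 y = c.
have /choice[nx nxP] : forall c, exists c', D c -> ~ last3 c -> D c' /\ Sc i2 c' = c.
  move=> c; have [Dc|nDc] := pselect (D c); last by exists c.
  have [[c' Dc' cc]|h] := D_cells Dc; first by exists c'.
  by exists c => _ /(_ h).
pose c k := iter k nx (C i1).
have [[n0 hn0]|no] := pselect (exists n, last3 (c n)).
  have ex : exists n, `[< last3 (c n) >] by exists n0; apply/asboolP.
  have [n /asboolP[u Qu uc] nmin] := ex_minnP ex.
  have Dc k : (k <= n)%N -> D (c k) /\ ((k < n)%N -> D (c k.+1) /\ Sc i2 (c k.+1) = c k).
    elim: k => [|k IH] kn.
      split => // n0'; apply: nxP => // h; have /nmin : `[< last3 (c 0%N) >] by apply/asboolP.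
      by rewrite leqNgt n0'.
    have [_ /(_ kn)[Dk _]] := IH (ltnW kn); split => // kn'; apply: nxP => // h.
    have /nmin : `[< last3 (c k.+1) >] by apply/asboolP.
    by rewrite leqNgt kn'.
  (* Beyond [n] the value [C i1] merely keeps the sequence in [Q]. *)
  exists n, (fun k => if (k <= n)%N then c k else C i1), true; split.
  - by [].
  - by move=> k; case: ifP => [/Dc[/DQ]|_]; last exact: Q_C.
  - by move=> k kn; rewrite kn (ltnW kn); have [_ /(_ kn)[_ ->]] := Dc k (ltnW kn).
  - by exists u => //; rewrite leqnn.
have Dc k : D (c k).
  elim: k => [//|k IH]; have [] := nxP (c k) IH => // h; apply: no; by exists k.
have cS k : Sc i2 (c k.+1) = c k.
  by have [] := nxP (c k) (Dc k) => // h; apply: no; exists k.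
(* An infinite chain puts [C i1] into all iterated images of [K] under [Sc i2], which shrink to the
   fixed point. *)
have CA : C i1 = A i2.
  apply: euclidean_dist_eq0; apply/eqP; rewrite eq_le euclidean_dist_ge0 andbT leNgt.
  apply/negP => lt.
  have rho01 := ds_rho_ge0 sys.
  have [n /(_ n (leqnn n))] := expr_lt_eventually rho01 lt; rewrite ltNge => /negP; apply.
  have K_c k : K (c k) by apply: (as_QK sys); apply: DQ.
  have le k : d (C i1) (A i2) <= rho ^+ k * d (c k) (A i2).
    elim: k => [|k IH]; first by rewrite expr0 mul1r.
    apply: le_trans IH _; rewrite exprSr -mulrA ler_wpM2l//.
      by rewrite exprn_ge0//; case/andP: rho01.
    rewrite -cS -{1}(as_Afix sys i2) (ds_scales sys).
    by rewrite ler_wpM2r ?euclidean_dist_ge0// (ds_le sys).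
  apply: le_trans (le n) _; rewrite ler_piMr//.
    by rewrite exprn_ge0//; case/andP: rho01.
  by apply: (ds_diam sys) => //; apply: (ds_A sys).
exists 0%N, (fun=> C i1), false; split => //.
by rewrite {2}CA (as_Afix sys).
Qed.

Let len_compact c (X : set (plane R)) (m : R) : c = O \/ Q c -> X `<=` Q -> compact X ->
  compact [set m * len c y | y in X].
Proof.
move=> hc XQ cX; have [L L0 hL] := len_lipschitz sys s_ge1 side_dim.
have h1 : 0 < (`|m| + 1) * L by rewrite mulr_gt0// ltr_pwDr.
apply: continuous_compact => //; apply: (lipschitz_within_real h1) => x y /XQ Qx /XQ Qy.
rewrite -mulrBr normrM -mulrA; apply: ler_pM => //; last exact: hL.
by rewrite lerDl.
Qed.

Let cell_compact i : i = i1 \/ i = i2 -> compact (Sc i @` E) /\ Sc i @` E `<=` Q.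
Proof.
move=> ii; split.
  exact: (scales_by_compact (ds_gt0 sys _) (ds_scales sys _)).
by move=> _ [y Ey <-]; apply: EQ; apply: E_sub.
Qed.

Lemma length_sets_gd : exists (G : gd_system R) (X : vertex G -> set R) (v w : vertex G),
  [/\ is_gd_attractor X, X v = M & X w = N].
Proof.
have [n [c [b [c0 Qc cS cn]]]] := chain.
have /andP[a0 a1] := ratio01 (Some i1).
(* The scaling by [mu] turns the translation of [M] into [lens (c k)] and the map
   from [lens (c 0)] to [M] into contractions. *)
pose mu := (1 + ratio (Some i1)) / 2.
have mu01 : 0 < mu < 1 by rewrite /mu; lra.
have [mu0 mu1] := andP mu01.
have amu : 0 < ratio (Some i1) / mu < 1.
  by rewrite divr_gt0//= ltr_pdivrMr// mul1r /mu; lra.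
(* [None] stands for [M], [Some None] for [N], and [Some (Some k)] for the scaled set of lengths
   from [c k]. *)
pose V : finType := option (option 'I_n.+1).
pose P k := [set mu * len (c k) y | y in E].
have PE k : P k = [set mu * t | t in lens (c k)].
  by rewrite /lens image_comp.
pose X (v : V) := match v with
  | None => M | Some None => N | Some (Some k) => P k end.
(* Both edges of [M] carry the same map. At the last index [b] decides between an edge to [N], for a
   point in the cell of [i3], and a loop, for the fixed point. *)
pose tgt (v : V) (e : bool) : V := match v with
  | None => Some (Some ord0)
  | Some None => if e then Some None else None
  | Some (Some k) => if e then
      (if (k < n)%N then Some (Some (inord k.+1)) else if b then Some None else Some (Some k))
      else None end.
pose ra (v : V) (e : bool) : R := match v with
  | None => ratio (Some i1) / mu
  | Some None => ratio (Some i2)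
  | Some (Some k) => if e then
      (if (k < n)%N then ratio (Some i2) else if b then mu else ratio (Some i2))
      else mu end.
pose sh (v : V) (e : bool) : R := match v with
  | None => ratio None * len O (A i1)
  | Some None => shiftN
  | Some (Some k) => if e then
      (if (k < n)%N then 0 else if b then mu * len (c k) O else 0)
      else mu * len (c k) O end.
have [cE1 E1Q] := cell_compact (or_introl (erefl i1)).
have [cE2 E2Q] := cell_compact (or_intror (erefl i2)).
have one (Y : set (plane R)) : [set len O x | x in Y] = [set 1 * len O x | x in Y].
  by apply: eq_imagel => x _; rewrite mul1r.
have [|||v|G [Y [f [hY fY]]]] := @affine_gd_attractor R V tgt ra sh X; last first.
- by exists G, Y, (f None), (f (Some None)); split; rewrite ?fY.
- case: v => [[k|]|] /=; last 2 first.
  + rewrite {1}NE; apply/seteqP; split => t.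
      by move=> [u [Mu|Nu] <-]; [exists false, u|exists true, u].
    by move=> [[] [u hu <-]]; exists u => //; [right|left].
  + rewrite {1}ME -c0; apply/seteqP; split => t.
      move=> [_ [y Ey <-] <-]; exists true, (mu * len (c 0%N) y); first by exists y.
      by rewrite mulrA divfK// gt_eqF.
    move=> [e [_ [y Ey <-] <-]]; exists (len (c 0%N) y); first by exists y.
    by rewrite mulrA divfK// gt_eqF.
  have kn : (k <= n)%N by rewrite -ltnS.
  have [lt|ge] := ltnP k n.
    have iE : X (Some (Some (inord k.+1))) = P k.+1 by rewrite /X inordK.
    rewrite (PE k) (cS k lt) (lens_next (Qc k.+1)) -(cS k lt).
    apply/seteqP; split => t.
      move=> [_ [[m Mm <-]|[_ [y Ey <-] <-]] <-].
        by exists false, m => //; rewrite mulrDr.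
      exists true, (mu * len (c k.+1) y); first by rewrite iE; exists y.
      by rewrite addr0 mulrCA.
    move=> [[] [u]]; rewrite ?iE => hu <-.
      case: hu => y Ey <-; exists (ratio (Some i2) * len (c k.+1) y).
        by right; exists (len (c k.+1) y) => //; exists y.
      by rewrite addr0 mulrCA.
    by exists (u + len (c k) O); [left; exists u|rewrite mulrDr].
  have kE : nat_of_ord k = n by apply/eqP; rewrite eqn_leq kn.
  have XkE : X (Some (Some k)) = P n by rewrite /X kE.
  rewrite kE {kE}.
  rewrite (PE n); have [bt|/negPf bf] := boolP b.
    rewrite bt in cn; have [u Qu cu] := cn.
    rewrite cu lens_last// -cu; apply/seteqP; split => t.
      move=> [_ [m [Mm|Nm] <-] <-]; [exists false, m|exists true, m] => //;
        by rewrite mulrDr.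
    by move=> [[] [m hm <-]]; exists (m + len (c n) O); rewrite ?mulrDr//;
      exists m => //; [right|left].
  rewrite bf in cn; rewrite {1}cn lens_next// -cn; apply/seteqP; split => t.
    move=> [_ [[m Mm <-]|[_ [y Ey <-] <-]] <-].
      by exists false, m => //; rewrite mulrDr.
    exists true, (mu * len (c n) y); first by rewrite XkE; exists y.
    by rewrite addr0 mulrCA.
  move=> [[] [m]]; rewrite ?XkE => hm <-.
    case: hm => y Ey <-; exists (ratio (Some i2) * len (c n) y).
      by right; exists (len (c n) y) => //; exists y.
    by rewrite addr0 mulrCA.
  by exists (m + len (c n) O); [left; exists m|rewrite mulrDr].
- case=> [[k|]|] /=.
  + by apply: len_compact => //; right.
  + by rewrite /N one; apply: len_compact => //; left.
  + by rewrite /M one; apply: len_compact => //; left.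
- have [y Ey] := E0; case=> [[k|]|] /=.
  + by exists (mu * len (c k) y); exists y.
  + by exists (len O (Sc i2 y)); exists (Sc i2 y) => //; exists y.
  + by exists (len O (Sc i1 y)); exists (Sc i1 y) => //; exists y.
- case=> [[k|]|] e /=; [|exact: ratio01|exact: amu].
  by case: e => //; case: ifP => _; [exact: ratio01|case: ifP => // _; exact: ratio01].
Qed.

Local Notation HMR := (hausdorff_measure (@real_dist R)).
Let rd0 := @real_dist_ge0 R.

(** By [NE], [N] is a copy of [M] together with a copy of itself of ratio below 1, so for null [M]
    the content of [N] contracts. At exponent 0 there is no contraction, but a null set is empty. *)
Let M_null_N t : 0 <= t -> HMR t M = 0%E ->
  HMR t N = 0%E.
Proof.
move=> t0 hM; have [tz|tn0] := eqVneq t 0.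
  have [y Ey] := E0; move: hM; rewrite tz => /hausdorff_measure0_eq0 M0.
  have : M (len O (Sc i1 y)) by exists (Sc i1 y) => //; exists y.
  by rewrite M0.
have tpos : 0 < t by rewrite lt_neqAle eq_sym tn0.
have [L L0 hL] := len_lipschitz sys s_ge1 side_dim.
have NL (x y : R) : N x -> N y -> real_dist x y <= L.
  move=> [_ [u Eu <-] <-] [_ [v Ev <-] <-].
  have Eu' := E_sub (or_intror (erefl i2)) Eu; have Ev' := E_sub (or_intror (erefl i2)) Ev.
  apply: le_trans (hL O (or_introl erefl) _ _ (EQ Eu') (EQ Ev')) _.
  by rewrite ler_piMr ?(ltW L0)// dE.
have a01 := ratio01 (Some i2); have /andP[a0 a1] := a01.
have q01 : 0 <= ratio (Some i2) `^ t < 1.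
  have : ratio (Some i2) `^ t < 1 `^ t by apply: gt0_ltr_powR; rewrite ?nnegrE ?(ltW a0).
  by rewrite powR_ge0 powR1.
apply: (hausdorff_measure_contract rd0 t0 q01 a01 L0 NL) => delta de0.
pose phi (x : R) := ratio (Some i2) * x + shiftN.
have phiL (X : set R) (x y : R) : X x -> X y -> real_dist (phi x) (phi y) <= ratio (Some i2) * real_dist x y.
  by move=> _ _; rewrite (affine_scales shiftN a0).
have NU : N `<=` phi @` M `|` phi @` N by rewrite {1}NE image_setU.
apply: le_trans (hausdorff_content_sub _ _ _ NU) _.
apply: le_trans (hausdorff_content_setU _ _ _ _ _) _ => //.
rewrite -[leRHS]add0e; apply: leeD.
  apply: le_trans (hausdorff_content_le_measure _ _ _ de0) _.
  apply: le_trans (hausdorff_measure_image rd0 rd0 t0 a0 (phiL M)) _.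
  by rewrite hM mule0.
rewrite -[delta in leLHS](divfK (lt0r_neq0 a0)) mulrC.
exact: (hausdorff_content_image rd0 rd0 _ t0 a0 (phiL N)).
Qed.

Let N_null_M t : 0 <= t -> HMR t N = 0%E ->
  HMR t M = 0%E.
Proof.
move=> t0 hN; have /andP[a0 a1] := ratio01 (Some i2).
apply: (@hausdorff_measure_affine R t (ratio (Some i2)) shiftN) => //.
apply/eqP; rewrite eq_le hausdorff_measure_ge0// andbT -hN.
apply: hausdorff_measure_sub => x [m Mm <-]; rewrite NE; exists m => //; by left.
Qed.

Lemma length_sets_dim_eq :
  hausdorff_dim (@real_dist R) M = hausdorff_dim (@real_dist R) N.
Proof.
apply/eqP; rewrite eq_le; apply/andP; split; apply: hausdorff_dim_le => t t0.
  exact: N_null_M.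
exact: M_null_N.
Qed.

Lemma length_sets_dim_le : (hausdorff_dim (@real_dist R) N <= hausdorff_dim d E)%E.
Proof.
apply: hausdorff_dim_le => t t0 hE; have [L L0 hL] := len_lipschitz sys s_ge1 side_dim.
have d0 := @euclidean_dist_ge0 R.
apply/eqP; rewrite eq_le hausdorff_measure_ge0// andbT.
apply: (@le_trans _ _ (HMR t (len O @` E))).
  apply: hausdorff_measure_sub => _ [x [y Ey <-] <-].
  by exists (Sc i2 y) => //; apply: E_sub => //; right.
have lip x y : E x -> E y -> real_dist (len O x) (len O y) <= L * d x y.
  by move=> /EQ Qx /EQ Qy; apply: hL => //; left.
by apply: le_trans (hausdorff_measure_image d0 rd0 t0 L0 lip) _; rewrite hE mule0.
Qed.

End length_sets.

(** The dimension is given for the arc from [O] to $A_1$, while the estimates concern the arc from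
    $A_1$ to $A_2$; the former contains a copy of the latter under $S_1\circ S_0$. *)
Lemma arc_to_O_dim (R : realType) (K Q : set (plane R)) (S : option idx -> plane R -> plane R)
    (r : option idx -> R) (rho eps : R) (A C : idx -> plane R) (O : plane R) (s : R) :
  arc_system K Q S r rho eps A C O ->
  s%:E = hausdorff_dim (@euclidean_dist R) (arc_in K O (A i1)) ->
  1 <= s /\ forall t, s < t ->
    hausdorff_measure (@euclidean_dist R) t (arc_in K (A i1) (A i2)) = 0%E.
Proof.
move=> sys hs; have d0 := @euclidean_dist_ge0 R.
have KA i := ds_A sys i; have KC i := ds_C sys i; have KO := as_KO sys.
have null t : s < t -> hausdorff_measure (@euclidean_dist R) t (arc_in K O (A i1)) = 0%E.
  by move=> st; apply: hausdorff_measure_above_dim => //; rewrite -hs lte_fin.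
have O1 : ~ (S (Some i1) @` K) O.
  move=> [y Ky yO]; have OA := ds_center sys KO Ky (etrans (as_O sys) (esym yO)).
  by apply: (as_A_center sys (i := i1) KO); rewrite -[RHS]OA (as_O sys).
have OA : O <> A i1 by move=> h; apply: O1; rewrite h -(as_Afix sys i1); exists (A i1).
split.
  rewrite leNgt -lte_fin hs; apply/negP => /ereal_inf_lt[_ [t [t0 ht] <-]].
  rewrite lte_fin => t1; have t01 : 0 <= t <= 1 by rewrite t0 ltW.
  have ho := arc_in_left sys KO (KA i1); have ha := arc_in_right sys KO (KA i1).
  exact: (connected_measure_neq0 (arc_in_connected sys KO (KA i1)) ho ha OA t01).
move=> t st; have s0 : 0 <= t.
  have : (0%:E <= s%:E)%E by rewrite hs; apply: le_ereal_inf_tmp => _ [u [u0 _] <-]; rewrite lee_fin.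
  by rewrite lee_fin => /le_trans; apply; exact: ltW.
have hB : arc_in K O (A i1) (S None (A i1)).
  rewrite (arc_inC sys)// -{1}(as_Afix sys i1); exact: (arc_in_junction sys).
have sub : S (Some i1) @` (S None @` arc_in K (A i1) (A i2)) `<=` arc_in K O (A i1).
  apply: (@subset_trans _ (arc_in K (A i1) (S None (A i1)))); last first.
    apply: (arc_in_sub_arc_in sys) => //; exact: (arc_in_right sys).
  rewrite -{2}(as_Afix sys i1) -(ds_SC sys i1) (arc_in_scale sys)//.
  apply: image_subset => x hx.
  by have [y Ky ->] := arc_decompose_AC sys i1; right; left.
have sc c := hausdorff_measure_scales _ s0 (ds_gt0 sys c) (ds_scales sys c).
have : hausdorff_measure (@euclidean_dist R) t
    (S (Some i1) @` (S None @` arc_in K (A i1) (A i2))) = 0%E.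
  apply/eqP; rewrite eq_le hausdorff_measure_ge0// andbT -(null t st).
  exact: hausdorff_measure_sub.
have rp c : (r c `^ t)%:E != 0%E by rewrite eqe gt_eqF// powR_gt0// (ds_gt0 sys).
by rewrite !sc => /eqP; rewrite !mule_eq0 !(negPf (rp _))/= => /eqP.
Qed.

(** Lengths are extended reals; the equations with [EFin] include their finiteness. *)
Theorem theorem3 (R : realType) (p1 p2 p3 : R) (B1 B2 B3 : plane R)
    (K' K : set (plane R)) (S0 : plane R -> plane R) (O : plane R) (s : R)
    (hK' : is_attractor [:: S1 p1; S2 p2; S3 p3] K')
    (hadm : admissible K' p1 p2 p3 B1 B2 B3)
    (hS0 : similarity (@euclidean_dist R) S0)
    (hS01 : S0 (A1 R) = B1) (hS02 : S0 (A2 R) = B2) (hS03 : S0 (A3 R) = B3)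
    (hK : is_attractor [:: S0; S1 p1; S2 p2; S3 p3] K)
    (hO : S0 O = O)
    (hs : s%:E = hausdorff_dim (@euclidean_dist R) (arc_in K O (A1 R))) :
  exists M N : set R,
    [/\ EFin @` M = [set arc_length s K O x | x in K `&` axis_segment 0 p1],
        EFin @` N =
          [set arc_length s K O x | x in K `&` axis_segment (1 - p2) 1],
        exists (G : gd_system R) (X : vertex G -> set R) (v w : vertex G),
          [/\ is_gd_attractor X, X v = M & X w = N] &
        [/\ hausdorff_dim (@real_dist R) M = hausdorff_dim (@real_dist R) N,
            (hausdorff_dim (@real_dist R) N <=
               hausdorff_dim (@euclidean_dist R) (K' `&` axis_segment 0 1))%E &
            (hausdorff_dim (@euclidean_dist R) (K' `&` axis_segment 0 1)
               < 1)%E]].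
Proof.
have sys := admissible_arc_system hK' hadm hS0 hS01 hS02 hS03 hK hO.
have [s1 sdim] := arc_to_O_dim sys hs.
have EK' := axis_part_sub hK' hadm hS0 hS01 hS02 hS03 hK.
have Ecells := axis_part_cells hK' hadm hS0 hS01 hS02 hS03 hK.
have Ec := axis_part_compact hadm hS0 hS01 hS02 hS03 hK.
have E0 := axis_part_nonempty hK' hadm hS0 hS01 hS02 hS03 hK.
(* The trace of [K'] on the side $[A_2A_3]$, where $C_1$ lies. *)
pose D := [set c | K' c /\ bary i1 c = 0].
have DK' : D `<=` K' by move=> c [].
have DC : D (junction_pre p1 p2 p3 K' S0 i1).
  split; first exact: (as_QC sys).
  exact: (junction_pre_opposite hadm hS01 hS02 hS03).
have Dcells c : D c ->
    (exists2 y, D y & maps4 p1 p2 p3 S0 (Some i2) y = c) \/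
    (exists2 y, K' y & maps4 p1 p2 p3 S0 (Some i3) y = c).
  by move=> [K'c c1]; apply: (opposite_cells hK' hadm hS0 hS01 hS02 hS03 hK).
have image_len (X : set (plane R)) : X `<=` K' ->
    EFin @` [set len K s O x | x in X] = [set arc_length s K O x | x in X].
  move=> XK'; rewrite image_comp; apply: eq_imagel => x Xx /=.
  by rewrite /arc_length (lenE_O sys s1 sdim)//; apply: XK'.
have cellK' i : i = i1 \/ i = i2 -> maps4 p1 p2 p3 S0 (Some i) @` axis_part K `<=` K'.
  by move=> ii _ [x Ex <-]; apply: (as_QS sys); apply: EK'.
exists [set len K s O x | x in maps4 p1 p2 p3 S0 (Some i1) @` axis_part K].
exists [set len K s O x | x in maps4 p1 p2 p3 S0 (Some i2) @` axis_part K].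
rewrite (attractor4_axis_left hK' hadm hS0 hS01 hS02 hS03 hK).
rewrite (attractor4_axis_right hK' hadm hS0 hS01 hS02 hS03 hK).
rewrite (attractor3_axis hK' hadm hS0 hS01 hS02 hS03 hK).
split; [exact: image_len (cellK' i1 (or_introl erefl))|
  exact: image_len (cellK' i2 (or_intror erefl))| |split].
- exact: (length_sets_gd sys s1 sdim Ec E0 EK' Ecells DK' DC Dcells).
- exact: (length_sets_dim_eq sys s1 sdim E0 EK' Ecells).
- exact: (length_sets_dim_le sys s1 sdim EK' Ecells).
- exact: (axis_dim_lt1 sys EK' Ecells).
Qed.
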